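(* Let $\varphi$ be a toll function and let $\Phi(T)=\sum_{v\in T}\varphi(T^v)$ be the corresponding additive functional on tries. Let $a(\lambda)$ and $b(\lambda)$ be real-valued functions and suppose that for some $r>2$, as $\lambda\to\infty$, $$\mathbb E\,\Phi(\widetilde{\mathcal T}_\lambda)=a(\lambda)+o(\sqrt\lambda),\qquad \operatorname{Var}\Phi(\widetilde{\mathcal T}_\lambda)=b(\lambda)+o(\lambda),\qquad \operatorname{Var}\Phi(\widetilde{\mathcal T}_\lambda)=O(\lambda),$$ $$\operatorname{Var}\varphi(\widetilde{\mathcal T}_\lambda)=o(\lambda),\qquad \mathbb E\bigl|\varphi(\widetilde{\mathcal T}_\lambda)-\mathbb E\varphi(\widetilde{\mathcal T}_\lambda)\bigr|^r=O(\lambda^{r/2}).$$ (i) Then, as $\lambda\to\infty$, $$\frac{\Phi(\widetilde{\mathcal T}_\lambda)-a(\lambda)}{\sqrt\lambda}\overset{d}{\approx}N\bigl(0,b(\lambda)/\lambda\bigr)$$ or, equivalently, $$\frac{\Phi(\widetilde{\mathcal T}_\lambda)-\mathbb E\,\Phi(\widetilde{\mathcal T}_\lambda)}{\sqrt\lambda}\overset{d}{\approx}N\bigl(0,\operatorname{Var}[\Phi(\widetilde{\mathcal T}_\lambda)]/\lambda\bigr),$$ in both cases with all moments and absolute moments of order $s<r$. (ii) Suppose further that $b(\lambda)=\Omega(\lambda)$ as $\lambda\to\infty$. Then, as $\lambda\to\infty$, $$\frac{\Phi(\widetilde{\mathcal T}_\lambda)-a(\lambda)}{\sqrt{b(\lambda)}}\overset{d}{\longrightarrow}N(0,1)\qquad\text{and}\qquad\frac{\Phi(\widetilde{\mathcal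 T}_\lambda)-\mathbb E\,\Phi(\widetilde{\mathcal T}_\lambda)}{\sqrt{\operatorname{Var}\Phi(\widetilde{\mathcal T}_\lambda)}}\overset{d}{\longrightarrow}N(0,1),$$ in both cases with convergence of all moments and absolute moments of order $s<r$.
   Context: Strings. $\mathcal A$ is a fixed finite alphabet with $|\mathcal A|\ge2$; $\mathbf p=(p_\alpha)_{\alpha\in\mathcal A}$ is a probability distribution with all $p_\alpha>0$. $\mathcal A^*=\bigcup_{m\ge0}\mathcal A^m$ is the set of finite strings, with empty string $\epsilon$. $\Xi^{(1)},\Xi^{(2)},\dots$ are i.i.d. random infinite strings, each with i.i.d. letters having distribution $\mathbf p$. Tries. Given a set of $n$ distinct infinite strings, let $\nu_{\boldsymbol\alpha}$ be the number of them having prefix $\boldsymbol\alpha\in\mathcal A^*$. The trie they generate is the empty tree $\emptyset$ if $n=0$; otherwise it is the finite rooted tree (root $\epsilon$, the children of $\boldsymbol\alpha$ being the nodes $\boldsymbol\alpha\gamma$, $\gamma\in\mathcal A$) whose nodes are all $\boldsymbol\alpha\in\mathcal A^*$ with either $\nu_{\boldsymbol\alpha}\ge2$ (internal nodes), or $\nu_{\boldsymbol\alpha}=1$ and $\boldsymbol\alpha=\epsilon$ or the parent of $\boldsymbol\alpha$ is an internal node (external nodes = leaves). A trie is any tree arising in this way. For a trie $T$ and $v\in\mathcal A^*$, the fringe tree is $T^v:=\{\boldsymbol\beta\in\mathcal A^*:v\boldsymbol\beta\in T\}$, again a trie. For $\lambda>0$, $N_\lambda\sim\mathrm{Po}(\lambda)$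 is independent of the strings and $\widetilde{\mathcal T}_\lambda$ is the random trie generated by $\Xi^{(1)},\dots,\Xi^{(N_\lambda)}$. A toll function is a real-valued function $\varphi$ on the set of tries with $\varphi(\emptyset)=0$; its additive functional is $\Phi(T)=\sum_{v\in T}\varphi(T^v)$. Approximation in distribution. $X_\lambda\overset{d}{\approx}Y_\lambda$ means $\mathbb E f(X_\lambda)=\mathbb E f(Y_\lambda)+o(1)$ for every bounded continuous $f$; it holds with absolute moments of order $s>0$ if moreover $\mathbb E|X_\lambda|^s=\mathbb E|Y_\lambda|^s+o(1)$ (both sides finite), and with moments of order $s\in\mathbb N$ if moreover $\mathbb EX_\lambda^s=\mathbb EY_\lambda^s+o(1)$ (both sides finite). ''All moments and absolute moments of order $s<r$'': absolute moments for all real $0<s<r$, ordinary moments for all integers $1\le s<r$. $N(0,\cdot)$ stands for a random variable with that law; $N(0,0)$ is the point mass at $0$. $b(\lambda)=\Omega(\lambda)$ means $b(\lambda)\ge c\lambda$ for some $c>0$ and all large $\lambda$. The functions $a,b$ need only be defined for large $\lambda$. *)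

(* Defs.v *)
From HB Require Import structures.
From mathcomp Require Import all_boot all_order all_algebra finmap.
From mathcomp Require Import all_classical all_reals all_analysis.

Set Implicit Arguments.
Unset Strict Implicit.
Unset Printing Implicit Defensive.

Import Order.TTheory GRing.Theory Num.Theory.
Import numFieldNormedType.Exports.

Local Open Scope classical_set_scope.
Local Open Scope ring_scope.

Section tries.
Context {A : finType}.
Implicit Types (s : seq (nat -> A)) (u v : seq A) (t : {fset (seq A)}).

Definition has_prefix (x : nat -> A) u : bool := mkseq x (size u) == u.

Definition nprefix s u : nat := count (has_prefix^~ u) s.

Definition parent u : seq A := take (size u).-1 u.

Definition trie_node s u : bool :=
  (1 < nprefix s u)%N ||
  (nprefix s u == 1%N) && ((u == [::]) || (1 < nprefix s (parent u))%N).

(** A trie is identified with its set of nodes. If the strings in [s] are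
    distinct, the set of nodes is finite; otherwise it is infinite and
    [fset_set] returns the empty set, so that [trie s] is a trie in all cases. *)
Definition trie s : {fset (seq A)} := fset_set [set u | trie_node s u].

Definition fringe t v : {fset (seq A)} := fset_set [set u | v ++ u \in t].

(** Tolls are total functions on finite sets of words; only their values at
    tries matter, since the fringe trees of a trie are tries. *)
Definition toll_function {R : realType} (phi : {fset (seq A)} -> R) : Prop :=
  phi fset0 = 0.

Definition additive_functional {R : realType} (phi : {fset (seq A)} -> R) t : R :=
  \sum_(v <- t) phi (fringe t v).

End tries.

Section model.
Context {d : measure_display} {T : measurableType d} {R : realType}.
Variable P : probability T R.

Definition mutually_independent (I : choiceType) (F : I -> set_system T) : Prop :=
  forall (J : {fset I}) (E : I -> set T), (forall i, i \in J -> F i (E i)) ->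
    P (\bigcap_(i in [set` J]) E i) = (\prod_(i <- J) P (E i))%E.

Context {A : finType}.

Definition letter_events (X : T -> A) : set_system T :=
  [set X @^-1` B | B in [set: set A]].

Definition string_events (X : T -> nat -> A) : set_system T :=
  <<s \bigcup_j letter_events (fun w => X w j) >>.

Definition all_string_events (Xi : nat -> T -> nat -> A) : set_system T :=
  <<s \bigcup_i string_events (Xi i) >>.

Definition iid_letters (p : A -> R) (X : T -> nat -> A) : Prop :=
  [/\ forall j, letter_events (fun w => X w j) `<=` measurable,
      forall j a, P [set w | X w j = a] = (p a)%:E
    & mutually_independent (fun j => letter_events (fun w => X w j))].

Definition iid_strings (p : A -> R) (Xi : nat -> T -> nat -> A) : Prop :=
  (forall i, iid_letters p (Xi i)) /\
  mutually_independent (fun i => string_events (Xi i)).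

Definition poisson_distributed (l : R) (N : T -> nat) : Prop :=
  measurable_fun setT N /\
  forall k, P (N @^-1` [set k]) = (poisson_pmf l k)%:E.

Definition independent_of_strings (Xi : nat -> T -> nat -> A) (N : T -> nat) : Prop :=
  forall (B : set nat) (E : set T), all_string_events Xi E ->
    P (N @^-1` B `&` E) = (P (N @^-1` B) * P E)%E.

Definition random_trie (Xi : nat -> T -> nat -> A) (N : T -> nat) (w : T) :
    {fset (seq A)} :=
  trie [seq Xi i w | i <- iota 0 (N w)].

End model.

Section mean.
Context {d : measure_display} {T : measurableType d} {R : realType}.

Definition has_mean (P : probability T R) (X : T -> R) : Prop :=
  P.-integrable setT (EFin \o X).

Definition mean (P : probability T R) (X : T -> R) : R := fine 'E_P[X].

Definition var (P : probability T R) (X : T -> R) : R := fine 'V_P[X].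

End mean.

Section approximation.
Context {R : realType}.

(** Landau symbols as l tends to +oo; the canonical filter structures required
    by the notations of [landau] are not available for [pinfty_nbhs]. *)
Definition little_o (f h : R -> R) : Prop :=
  forall e : R, 0 < e -> \forall l \near +oo_R, `|f l| <= e * `|h l|.

Definition big_O (f h : R -> R) : Prop :=
  exists C : R, \forall l \near +oo_R, `|f l| <= C * `|h l|.

Definition big_Omega (f h : R -> R) : Prop :=
  exists2 c : R, 0 < c & \forall l \near +oo_R, c * h l <= f l.

Definition bounded_continuous (f : R -> R) : Prop :=
  continuous f /\ exists M, forall x, `|f x| <= M.

Section two_families.
Context {d : measure_display} {T : measurableType d}.
Context {d' : measure_display} {T' : measurableType d'}.
Variables (P : R -> probability T R) (X : R -> T -> R).
Variables (Q : R -> probability T' R) (Y : R -> T' -> R).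

Definition approx_mean (g : R -> R) : Prop :=
  little_o (fun l => mean (P l) (g \o X l) - mean (Q l) (g \o Y l)) (fun=> 1).

Definition approx_in_distribution : Prop :=
  forall f, bounded_continuous f -> approx_mean f.

Definition approx_moment (g : R -> R) : Prop :=
  (\forall l \near +oo_R, has_mean (P l) (g \o X l) /\ has_mean (Q l) (g \o Y l)) /\
  approx_mean g.

Definition approx_moments_below (r : R) : Prop :=
  (forall s : R, 0 < s < r -> approx_moment (fun x => `|x| `^ s)) /\
  (forall k : nat, (0 < k)%N -> k%:R < r -> approx_moment (fun x => x ^+ k)).

End two_families.

Section convergence.
Context {d : measure_display} {T : measurableType d}.
Context {d' : measure_display} {T' : measurableType d'}.
Variables (P : R -> probability T R) (X : R -> T -> R).
Variables (Q : probability T' R) (Y : T' -> R).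

Definition cvg_mean (g : R -> R) : Prop :=
  mean (P l) (g \o X l) @[l --> +oo_R] --> mean Q (g \o Y).

Definition cvg_in_distribution : Prop :=
  forall f, bounded_continuous f -> cvg_mean f.

Definition cvg_moment (g : R -> R) : Prop :=
  [/\ \forall l \near +oo_R, has_mean (P l) (g \o X l),
      has_mean Q (g \o Y) & cvg_mean g].

Definition cvg_moments_below (r : R) : Prop :=
  (forall s : R, 0 < s < r -> cvg_moment (fun x => `|x| `^ s)) /\
  (forall k : nat, (0 < k)%N -> k%:R < r -> cvg_moment (fun x => x ^+ k)).

End convergence.

(** The law N(0, v), with the point mass at 0 for v <= 0. The case split is
    needed because [normal_prob 0 0] is the uniform law on [0, 1]. *)
Definition centered_normal (v : R) : probability (measurableTypeR R) R :=
  if 0 < v then (normal_prob 0 (Num.sqrt v) : probability (measurableTypeR R) R)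
  else (\d_(0 : measurableTypeR R) : probability (measurableTypeR R) R).

End approximation.

(* Main.v *)
(* By Poisson splitting, the strings of the model with parameter [l] that start with a given
   letter [a], stripped of it, form the model with parameter [l * p a], independently for
   distinct letters. Hence the centered functional satisfies [U_l = \sum_a U_(l * p a) + Y_l] with
   independent summands, where [Y_l] is, up to a bounded term, the centered toll, so that
   [E Y_l^2 = o(l)] and [E |Y_l|^r = O(l^(r/2))].

   Iterating this recursion, [E |U_l|^r = O(l^(r/2))] because [\sum_a p a ^ (r/2) < 1]; that these
   moments are finite at all follows from a cruder recursion, truncated at the height of the trie,
   for [|Phi|^r] weighted by a power of the number of strings.

   Let [q = min(r, 3)]. For a test function with third-order Taylor bounds, replacing [U_l] by a
   Gaussian variable of the same variance costs at most [C l^(q/2)]. If the cost at every [l] is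
   [C l^(q/2) + o(sqrt l)], then exchanging the branches one at a time shows that it is also
   [theta C l^(q/2) + o(sqrt l)] with [theta = \sum_a p a ^ (q/2) < 1]: the defects [Y_l] only
   contribute to the [o(sqrt l)], through the Lipschitz constant. Iterating gives the normal
   approximation of [U_l / sqrt l]; it extends to continuous test functions of growth
   less than [|x|^r] by smoothing and the moment bound. *)
Require Import Defs.
From HB Require Import structures.
From mathcomp Require Import all_boot all_order all_algebra finmap.
From mathcomp Require Import all_classical all_reals all_analysis measurable_realfun.
From mathcomp Require Import ring lra.

Set Implicit Arguments.
Unset Strict Implicit.
Unset Printing Implicit Defensive.

Import Order.TTheory GRing.Theory Num.Theory.
Import numFieldNormedType.Exports.

Local Open Scope classical_set_scope.
Local Open Scope ring_scope.

(** * Combinatorics of tries *)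

Section word_lists.
Context {T : eqType}.

(** The two error terms in the comparison of [U_l] with a Gaussian behave differently under the
    recursion. The Taylor term is of order [l ^ (q/2)] with [q/2 > 1], so a step contracts it. The
    Lipschitz term is of order [sqrt l], and [\sum_a sqrt (p a)] exceeds 1, so a step enlarges it;
    this is harmless only because each step may start from an arbitrarily small multiple of
    [sqrt l], at the price of a larger threshold for [l]. The number of steps is therefore fixed
    before [l] tends to infinity. The bound [q <= 3] comes from the cubic Taylor remainder, [q <= r]
    from the available moments. The toll is arbitrary, and its moments are controlled for large [l]
    only. Since tries form a countable set, every toll of a random trie is measurable once each
    single trie is an event. Given the number of strings, the law of the trie does not depend on
    [l], so a comparison of Poisson weights carries moments from large [l] to small ones, with a
    factor [l ^ 2] for two strings or more. The square makes the truncated moment recursion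
    contract, by [\sum_a p a ^ 2 < 1]. *)

Fixpoint lists (e : seq T) n : seq (seq T) :=
  if n is m.+1 then [seq x :: u | x <- e, u <- lists e m] else [:: [::]].

Lemma mem_lists e n u : (u \in lists e n) = (size u == n) && all [in e] u.
Proof.
elim: n u => [|n IH] [|x u] //=; first by apply/negP => /allpairsP[[? ?] []].
rewrite eqSS; apply/allpairsP/idP => [[[y v] /= [ye vl [-> ->]]]|/and3P[su xe ue]].
  by move: vl; rewrite IH ye => /andP[-> ->].
by exists (x, u); rewrite /= IH su ue.
Qed.

Lemma lists_uniq e n : uniq e -> uniq (lists e n).
Proof.
by move=> ue; elim: n => // n IH; apply: allpairs_uniq => // -[x u] [y v] _ _ [-> ->].
Qed.

End word_lists.

Section trie_branches.
Context {A : finType}.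
Implicit Types (x : nat -> A) (s : seq (nat -> A)) (u v : seq A) (a : A).

Definition tl x : nat -> A := fun j => x j.+1.

Definition branch s a : seq (nat -> A) := [seq tl x | x <- s & x 0%N == a].

(** A finite certificate that the strings are distinct. For the random strings it holds almost
    surely at some depth, and it persists at larger depths. *)
Definition separated L s : bool := uniq [seq mkseq x L | x <- s].

(** Unlike [trie s], this part depends on finitely many letters, and it is the whole trie as soon as
    [separated L s]. Events about tries are reached through it. *)
Definition trie_depth L s : {fset (seq A)} :=
  fset_set [set u | trie_node s u /\ (size u <= L)%N].

Lemma mkseqS x n : mkseq x n.+1 = x 0%N :: mkseq (tl x) n.
Proof. by rewrite /mkseq /= -[1%N]addn0 iotaDl -map_comp. Qed.

Lemma has_prefix_cons x a u :
  has_prefix x (a :: u) = (x 0%N == a) && has_prefix (tl x) u.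
Proof. by rewrite /has_prefix /= mkseqS eqseq_cons. Qed.

Lemma nprefix_cons s a u : nprefix s (a :: u) = nprefix (branch s a) u.
Proof.
rewrite /nprefix /branch count_map count_filter; apply: eq_count => x /=.
by rewrite has_prefix_cons andbC.
Qed.

Lemma nprefix_nil s : nprefix s [::] = size s.
Proof. by rewrite /nprefix (eq_count (a2 := predT)) ?count_predT. Qed.

Lemma take_mkseq x n m : (n <= m)%N -> take n (mkseq x m) = mkseq x n.
Proof. by move=> nm; rewrite /mkseq -map_take take_iota (minn_idPl nm). Qed.

Lemma nprefix_depth s L u : (size u <= L)%N ->
  nprefix s u = count (fun w => take (size u) w == u) [seq mkseq x L | x <- s].
Proof.
move=> uL; rewrite /nprefix count_map; apply: eq_count => x /=.
by rewrite /has_prefix take_mkseq.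
Qed.

Lemma nprefix_take s u n : (nprefix s u <= nprefix s (take n u))%N.
Proof.
apply: sub_count => x; rewrite /has_prefix => /eqP xu; apply/eqP.
rewrite -{2}xu /mkseq -map_take take_iota; congr (map _ (iota _ _)).
by rewrite size_take_min.
Qed.

Lemma separated_nprefix L s u : separated L s -> (L <= size u)%N ->
  (nprefix s u <= 1)%N.
Proof.
move=> sL uL; apply: leq_trans (nprefix_take s u L) _.
have su : size (take L u) = L by rewrite size_take_min; apply/minn_idPl.
rewrite (@nprefix_depth s L) ?su//.
rewrite (@eq_in_count _ _ (pred1 (take L u))) ?count_uniq_mem ?leq_b1//.
by move=> w /mapP[x _ ->] /=; rewrite take_oversize ?size_mkseq.
Qed.

Lemma trie_node_size L s u : separated L s -> trie_node s u -> (size u <= L)%N.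
Proof.
move=> sL; rewrite leqNgt; apply: contraTN => uL.
rewrite /trie_node negb_or -leqNgt (separated_nprefix sL (ltnW uL)) /=.
rewrite negb_and negb_or; apply/orP; right; apply/andP; split.
  by case: u uL.
rewrite -leqNgt; apply: separated_nprefix sL _; rewrite /parent size_take_min.
by case: u uL => //= a u; rewrite ltnS => uL; rewrite (minn_idPl (leqnSn _)).
Qed.

Lemma finite_words L : finite_set [set u : seq A | (size u <= L)%N].
Proof.
apply: (@sub_finite_set _ _ [set` flatten [seq lists (enum A) n | n <- iota 0 L.+1]]).
  move=> u uL; suff: u \in flatten [seq lists (enum A) n | n <- iota 0 L.+1] by [].
  apply/flattenP; exists (lists (enum A) (size u)).
    by apply/mapP; exists (size u); rewrite ?mem_iota.
  by rewrite mem_lists eqxx; apply/allP => x _; exact: mem_enum.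
exact: finite_seq.
Qed.

Lemma mem_trie_depth L s u :
  (u \in trie_depth L s) = trie_node s u && (size u <= L)%N.
Proof.
rewrite in_fset_set; last first.
  by apply: sub_finite_set (finite_words L) => v [].
by apply/idP/andP; rewrite inE.
Qed.

Lemma trie_separated L s : separated L s -> trie s = trie_depth L s.
Proof.
move=> sL; congr fset_set; apply/seteqP; split=> [u us|u []//].
by split=> //; exact: trie_node_size us.
Qed.

Lemma mem_trie L s u : separated L s -> (u \in trie s) = trie_node s u.
Proof.
move=> sL; rewrite (trie_separated sL) mem_trie_depth andb_idr//.
exact: trie_node_size.
Qed.

(** If no depth separates the strings, then for every [L] two of them share a prefix of length [L],
    which is an internal node. The node set is thus infinite and [fset_set] returns its default
    value [fset0]. *)
Lemma trie_not_separated s : (forall L, ~~ separated L s) -> trie s = fset0.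
Proof.
move=> sL; rewrite /trie /fset_set; case: pselect => // fin.
exfalso; apply: infinite_nat.
apply: (@sub_finite_set _ _ (size @` [set u : seq A | trie_node s u])); last first.
  exact: finite_image.
move=> L _.
have [u ul] : exists u, ~~ (count_mem u [seq mkseq x L | x <- s] == (u \in [seq mkseq x L | x <- s]))%N.
  apply/not_existsP => h; move: (sL L); rewrite /separated; apply/negP/negPn.
  apply: count_mem_uniq => u; apply/eqP/negPn/negP; exact: h.
have us : u \in [seq mkseq x L | x <- s].
  by apply: contraNT ul => us; rewrite (negbTE us); exact/eqP/count_memPn.
have su : size u = L by case/mapP: us => x _ ->; rewrite size_mkseq.
exists u => //=; rewrite /trie_node; apply/orP; left.
rewrite (@nprefix_depth s L) ?su// (@eq_in_count _ _ (pred1 u)); last first.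
  by move=> w /mapP[x _ ->] /=; rewrite take_oversize ?size_mkseq.
by move: ul; rewrite us ltn_neqAle eq_sym => -> /=; rewrite -has_count has_pred1.
Qed.

Lemma separatedS L s : separated L s -> separated L.+1 s.
Proof.
rewrite /separated => sL; apply: (@map_uniq _ _ (take L)); rewrite -map_comp.
by rewrite (eq_map (g := fun x => mkseq x L))// => x /=; rewrite take_mkseq.
Qed.

Lemma map_mkseq_branch L s a :
  [seq a :: mkseq x L | x <- branch s a] = [seq mkseq x L.+1 | x <- s & x 0%N == a].
Proof.
rewrite /branch -map_comp; elim: s => //= x s IH.
case: eqP => xa; last exact: IH.
by rewrite !map_cons; congr cons; [rewrite /= mkseqS xa|exact: IH].
Qed.

Lemma separated_branch L s a : separated L.+1 s -> separated L (branch s a).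
Proof.
rewrite /separated => sL; rewrite -(map_inj_uniq (f := cons a)); last by move=> u v [].
rewrite -map_comp (eq_map (g := fun x => a :: mkseq x L))// map_mkseq_branch.
by apply: subseq_uniq sL; apply: map_subseq; exact: filter_subseq.
Qed.

(** Factorisation through the prefixes of length [L]. For such [g], events about [g] of finitely
    many random strings concern finitely many letters, and their probabilities are finite sums. *)
Definition depth_determined {U : Type} L (g : seq (nat -> A) -> U) : Prop :=
  forall s s', [seq mkseq x L | x <- s] = [seq mkseq x L | x <- s'] -> g s = g s'.

Lemma eq_map_mkseq_branch L s s' a :
  [seq mkseq x L.+1 | x <- s] = [seq mkseq x L.+1 | x <- s'] ->
  [seq mkseq x L | x <- branch s a] = [seq mkseq x L | x <- branch s' a].
Proof.
elim: s s' => [|x s IH] [|y s'] //= [xy0 xy /IH ss'].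
move: xy0; rewrite /branch /= => ->; case: eqP => //= _; rewrite ss'; congr cons.
have := mkseqS x L; have := mkseqS y L.
by rewrite /mkseq /= xy => -[->] -[->].
Qed.

Lemma depth_determined_branch U L (g : seq (nat -> A) -> U) a :
  depth_determined L g -> depth_determined L.+1 (fun s => g (branch s a)).
Proof. by move=> gL s s' ss'; apply: gL; exact: eq_map_mkseq_branch. Qed.

Lemma depth_determined_separated L : depth_determined L (separated L).
Proof. by move=> s s'; rewrite /separated => ->. Qed.

Lemma depth_determined_trie L : depth_determined L (trie_depth L).
Proof.
move=> s s' ss'; congr fset_set; apply/seteqP.
have nE u : (size u <= L)%N -> nprefix s u = nprefix s' u.
  by move=> uL; rewrite !(@nprefix_depth _ L)// ss'.
have pL u : (size u <= L)%N -> (size (parent u) <= L)%N.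
  by move=> uL; apply: leq_trans uL; rewrite /parent size_take_min geq_minr.
by split=> u [us uL]; split=> //; move: us; rewrite /trie_node !nE// pL.
Qed.

Lemma trie_node_cons s a u : (1 < size s)%N ->
  trie_node s (a :: u) = trie_node (branch s a) u.
Proof.
move=> s1; rewrite /trie_node nprefix_cons; congr (_ || _ && _).
case: u => [|b u]; first by rewrite /parent /= nprefix_nil s1.
by rewrite /parent /= nprefix_cons.
Qed.

Lemma trie_nil : trie [::] = fset0 :> {fset (seq A)}.
Proof. by rewrite /trie -[RHS]fset_set0; congr fset_set; apply/seteqP; split. Qed.

Lemma trie1 x : trie [:: x] = [fset [::]]%fset.
Proof.
rewrite /trie -fset_set1; congr fset_set; apply/seteqP; split=> u /=.
  rewrite /trie_node; case: u => // a u.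
  have n1 v : (nprefix [:: x] v <= 1)%N by rewrite /nprefix -[1%N]/(size [:: x]) count_size.
  by rewrite !ltnNge !n1 /= andbF.
by move=> ->; rewrite /trie_node nprefix_nil.
Qed.

Lemma branch_size s : (\sum_a size (branch s a))%N = size s.
Proof.
rewrite /branch; elim: s => [|x s IH]; first by rewrite big1.
rewrite /= -IH -add1n (bigD1 (x 0%N))//= eqxx /= [in RHS](bigD1 (x 0%N))//= addnA add1n.
by congr (_ + _)%N; apply: eq_bigr => a; rewrite eq_sym => /negbTE ->.
Qed.

Context {R : realType}.
Implicit Types phi : {fset (seq A)} -> R.

Lemma additive_functional0 phi : additive_functional phi fset0 = 0.
Proof. by rewrite /additive_functional big_seq_fset0. Qed.

Lemma fringe_nil (t : {fset (seq A)}) : fringe t [::] = t.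
Proof. exact: set_fsetK. Qed.

Lemma additive_functional1 phi : additive_functional phi [fset [::]]%fset = phi [fset [::]]%fset.
Proof. by rewrite /additive_functional big_seq_fset1 fringe_nil. Qed.

(** With two strings or more the root is internal, so the nodes other than the root are the words
    [a :: u] with [u] in the trie of the branch of [a], and the fringe trees at [a :: u] and at [u]
    coincide. *)
Lemma additive_functional_branch phi L s : (1 < size s)%N -> separated L.+1 s ->
  additive_functional phi (trie s) =
  phi (trie s) + \sum_a additive_functional phi (trie (branch s a)).
Proof.
move=> s1 sL.
have eqT : perm_eq (trie s) ([::] :: flatten [seq [seq a :: u | u <- trie (branch s a)] | a <- enum A]).
  apply: uniq_perm; first exact: fset_uniq.
    rewrite /=; apply/andP; split.
      by apply/negP => /flattenP[_ /mapP[a _ ->]] /mapP[].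
    apply: allpairs_uniq_dep; first exact: enum_uniq.
      by move=> a _; exact: fset_uniq.
    by move=> [a u] [b v] _ _ /= [-> ->].
  move=> u; rewrite in_cons (mem_trie _ sL); case: u => [|a u] /=.
    by rewrite /trie_node nprefix_nil s1.
  rewrite trie_node_cons//; apply/idP/flattenP => [uT|[_ /mapP[b _ ->]]].
    exists [seq a :: w | w <- trie (branch s a)].
      by apply/mapP; exists a; rewrite ?mem_enum.
    by apply/mapP; exists u => //; rewrite (mem_trie _ (separated_branch a sL)).
  by move=> /mapP[v]; rewrite (mem_trie _ (separated_branch b sL)) => vT [-> ->].
rewrite {1}/additive_functional (perm_big _ eqT) /= big_cons fringe_nil.
congr (_ + _); rewrite big_flatten /= big_map big_enum /=.
apply: eq_bigr => a _; rewrite big_map; apply: eq_bigr => u _; congr phi.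
congr fset_set; apply/seteqP; split=> w /=;
  by rewrite (mem_trie _ sL) (mem_trie _ (separated_branch a sL)) trie_node_cons.
Qed.

Lemma mem_nil_trie L s : (1 < size s)%N -> separated L s -> [::] \in trie s.
Proof. by move=> s1 sL; rewrite (mem_trie _ sL) /trie_node nprefix_nil s1. Qed.

(** Height truncation for the moment recursion: the height drops by one in each branch, so an
    induction on [h] can run before any moment is known to be finite. *)
Definition lower h (t : {fset (seq A)}) : bool := all (fun u => size u < h)%N t.

Lemma lower_branch h L s a : (1 < size s)%N -> separated L.+1 s ->
  lower h.+1 (trie s) -> lower h (trie (branch s a)).
Proof.
move=> s1 sL /allP lt; apply/allP => u.
rewrite (mem_trie _ (separated_branch a sL)) -trie_node_cons// -(mem_trie _ sL).
by move=> /lt.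
Qed.

Lemma lower0 L s : (1 < size s)%N -> separated L s -> lower 0 (trie s) = false.
Proof. by move=> s1 sL; apply/negP => /allP/(_ _ (mem_nil_trie s1 sL)). Qed.

Lemma lower_ex (t : {fset (seq A)}) : exists h, lower h t.
Proof.
exists (\max_(u <- t) size u).+1; apply/allP => u ut; rewrite ltnS.
by rewrite (big_rem u)//= leq_maxl.
Qed.

Lemma lowerW h h' (t : {fset (seq A)}) : (h <= h')%N -> lower h t -> lower h' t.
Proof. by move=> hh /allP lt; apply/allP => u /lt /leq_trans; exact. Qed.

End trie_branches.

(** * Poisson splitting *)

Section list_expectation.
Context {R : realType} {T : eqType}.
Variables (e : seq T) (q : T -> R).

Definition list_mean n (h : seq T -> R) : R :=
  \sum_(u <- lists e n) (\prod_(x <- u) q x) * h u.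

Lemma list_mean0 h : list_mean 0 h = h [::].
Proof. by rewrite /list_mean /= big_seq1 big_nil mul1r. Qed.

Lemma list_meanS n h :
  list_mean n.+1 h = \sum_(x <- e) q x * list_mean n (h \o cons x).
Proof.
rewrite /list_mean /= big_allpairs_dep; apply: eq_bigr => x _.
by rewrite mulr_sumr; apply: eq_bigr => u _; rewrite big_cons mulrA.
Qed.

End list_expectation.

Section letter_counts.
Context {R : realType} {A : finType}.
Variable p : A -> R.
Implicit Types (a b : A) (c : A -> nat -> R) (n k N : nat).

(** Effect of one further letter [a] in the word: its count grows by one, so [c a] is read one place
    further. *)
Definition shift a c b k := if b == a then c b k.+1 else c b k.

(* The mean of [\prod_a c a (N_a)], [N_a] being the number of letters [a] in a
   random word of length [n]. *)
Fixpoint count_mean n c : R :=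
  if n is m.+1 then \sum_a p a * count_mean m (shift a c) else \prod_a c a 0%N.

Definition set_count c a (f : nat -> R) b k := if b == a then f k else c b k.

(** Every product [\prod_b c b (N_b)] has exactly one factor of index [a], so [count_mean] is linear
    in [c a]. This moves the mean over the rest of a string inside its branch. *)
Lemma count_mean_linear (T : Type) (e : seq T) (w : T -> R) (f : T -> nat -> R) n a c :
  \sum_(v <- e) w v * count_mean n (set_count c a (f v)) =
  count_mean n (set_count c a (fun k => \sum_(v <- e) w v * f v k)).
Proof.
have aE g k : set_count c a g a k = g k by rewrite /set_count eqxx.
elim: n c f aE => [|n IH] c f aE /=.
  rewrite [RHS](bigD1 a)//= aE mulr_suml.
  apply: eq_bigr => v _; rewrite (bigD1 a)//= aE mulrA.
  by congr (_ * _); apply: eq_bigr => b /negbTE ba; rewrite /set_count ba.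
under eq_bigr do rewrite mulr_sumr.
rewrite exchange_big /=; apply: eq_bigr => b _.
under eq_bigr do rewrite mulrCA.
rewrite -mulr_sumr; congr (_ * _).
have sE g : shift b (set_count c a g) =
    set_count (shift b c) a (if b == a then g \o succn else g).
  apply/funext => x; apply/funext => k; rewrite /shift /set_count.
  by case: (x =P b) => xb; case: (x =P a) => xa; case: (b =P a) => ba //; exfalso; congruence.
under eq_bigr do rewrite sE.
have aE' g k : set_count (shift b c) a g a k = g k by rewrite /set_count eqxx.
rewrite sE; case: eqP => _; last exact: IH.
exact: (IH (shift b c) (fun v => f v \o succn)).
Qed.

(** Exponential generating function of the sequence [p a ^+ k * c a k], cut at degree [N] to be a
    polynomial. *)
Definition count_poly N c a : {poly R} := \poly_(k < N.+1) (p a ^+ k * c a k / k`!%:R).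

Lemma eq_coef_prod (I : Type) (s : seq I) (F G : I -> {poly R}) n :
  (forall i k, (k <= n)%N -> (F i)`_k = (G i)`_k) ->
  forall k, (k <= n)%N -> (\prod_(i <- s) F i)`_k = (\prod_(i <- s) G i)`_k.
Proof.
move=> FG; elim: s => [|i s IH] k kn; first by rewrite !big_nil.
rewrite !big_cons !coefM; apply: eq_bigr => j _.
rewrite FG ?IH//; first exact: leq_trans (leq_subr _ _) kn.
by apply: leq_trans kn; rewrite -ltnS.
Qed.

Lemma deriv_prod (I : eqType) (s : seq I) (F : I -> {poly R}) : uniq s ->
  (\prod_(i <- s) F i)^`() =
  \sum_(a <- s) \prod_(i <- s) (if i == a then (F i)^`() else F i).
Proof.
elim: s => [|x s IH]; first by rewrite !big_nil derivC.
move=> /= /andP[xs us]; rewrite !big_cons derivM IH// eqxx.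
congr (_ + _).
  congr (_ * _); rewrite big_seq [RHS]big_seq; apply: eq_bigr => i si.
  by case: eqP => // ix; move: xs; rewrite -ix si.
rewrite mulr_sumr; apply: eq_big_seq => a sa.
rewrite big_cons; case: eqP => // xa; by move: xs; rewrite xa sa.
Qed.

(** Differentiating a product of exponential generating functions shifts the sequence of one letter
    and brings out its factor [p a], which is the recursion defining [count_mean]. Coefficients of
    degree at most [N] do not see the cut. *)
Lemma coef_count_poly n N c : (n <= N)%N ->
  (\prod_a count_poly N c a)`_n = count_mean n c / n`!%:R.
Proof.
elim: n N c => [|n IH] [|N] c // nN.
- rewrite coef0_prod /= fact0 divr1; apply: eq_bigr => a _.
  by rewrite coef_poly fact0 divr1 expr0 mul1r.
- rewrite coef0_prod /= fact0 divr1; apply: eq_bigr => a _.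
  by rewrite coef_poly fact0 divr1 expr0 mul1r.
have n1 : n.+1%:R != 0 :> R by rewrite pnatr_eq0.
apply: (mulIf n1); rewrite mulr_natr -coef_deriv.
rewrite (deriv_prod _ (index_enum_uniq A)) coef_sum /=.
have k0 : n`!%:R != 0 :> R by rewrite pnatr_eq0 -lt0n fact_gt0.
rewrite [RHS](_ : _ = (\sum_a p a * count_mean n (shift a c)) / n`!%:R); last first.
  rewrite factS natrM; move: n1 k0; move: (n.+1%:R : R) (n`!%:R : R) (\sum_a _) => x y z x0 y0.
  by field; rewrite x0 y0.
rewrite mulr_suml.
apply: eq_bigr => a _; rewrite -mulrA -(IH N.+1); last exact: ltnW.
rewrite -coefZ.
have -> : p a *: \prod_b count_poly N.+1 (shift a c) b =
    \prod_b ((if b == a then p a else 1) *: count_poly N.+1 (shift a c) b).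
  rewrite scaler_prod; congr (_ *: _).
  by rewrite (bigD1 a)//= eqxx big1 ?mulr1// => b /negbTE ->.
apply: (@eq_coef_prod _ _ _ _ n) => // b k kn.
rewrite coefZ; case: (eqVneq b a) => [->|ba]; last first.
  by rewrite mul1r /count_poly !coef_poly /shift (negbTE ba).
rewrite coef_deriv !coef_poly /shift eqxx !ltnS (leq_trans kn nN).
rewrite (leq_trans kn (leq_trans (leqnSn _) nN)).
rewrite factS natrM exprS -[LHS]mulr_natr.
have k1 : k.+1%:R != 0 :> R by rewrite pnatr_eq0.
have k2 : k`!%:R != 0 :> R by rewrite pnatr_eq0 -lt0n fact_gt0.
move: k1 k2; move: (k.+1%:R : R) (k`!%:R : R) => x y x0 y0; by field; rewrite x0 y0.
Qed.

Lemma count_mean_ge0 n c : (forall a, 0 <= p a) -> (forall a k, 0 <= c a k) -> 0 <= count_mean n c.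
Proof.
move=> p0; elim: n c => [|n IH] c c0 /=; first by apply: prodr_ge0.
apply: sumr_ge0 => a _; rewrite mulr_ge0// IH// => b k.
by rewrite /shift; case: ifP.
Qed.

Lemma ler_coef_prod (I : Type) (s : seq I) (F G : I -> {poly R}) :
  (forall i k, 0 <= (F i)`_k <= (G i)`_k) ->
  forall k, 0 <= (\prod_(i <- s) F i)`_k <= (\prod_(i <- s) G i)`_k.
Proof.
move=> FG; elim: s => [|i s IH] k.
  by rewrite !big_nil lexx andbT coef1; case: (k == 0)%N.
rewrite !big_cons !coefM; apply/andP; split.
  by apply: sumr_ge0 => j _; rewrite mulr_ge0//; [case/andP: (FG i j)|case/andP: (IH (k - j)%N)].
apply: ler_sum => j _.
by apply: ler_pM; [case/andP: (FG i j)|case/andP: (IH (k - j)%N)|case/andP: (FG i j)|case/andP: (IH (k - j)%N)].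
Qed.

Lemma cvg_finprod (F : A -> nat -> R) (S : A -> R) :
  (forall a, F a n @[n --> \oo] --> S a) ->
  \prod_a F a n @[n --> \oo] --> \prod_a S a.
Proof.
move=> FS; rewrite -[X in X @ _ --> _]/(fun n => \prod_(a <- index_enum A) F a n).
elim: (index_enum A) => [|a s IH].
  by rewrite big_nil; under eq_fun do rewrite big_nil; exact: cvg_cst.
rewrite big_cons; under eq_fun do rewrite big_cons.
exact: cvgM (FS a) IH.
Qed.

Let partial c n : R := \sum_(k < n) count_mean k c / k`!%:R.

(** The terms are nonnegative. The product [Q n] of the cut series has the right coefficients up to
    degree [n] and smaller ones beyond, finitely many in all, so the [Q n] and the partial sums of
    the series bound each other and share their limit. *)
Lemma cvg_count_mean c (S : A -> R) :
  (forall a, 0 <= p a) -> (forall a k, 0 <= c a k) ->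
  (forall a, \sum_(k < n) (p a ^+ k * c a k / k`!%:R) @[n --> \oo] --> S a) ->
  \sum_(k < n) (count_mean k c / k`!%:R) @[n --> \oo] --> \prod_a S a.
Proof.
move=> p0 c0 cS.
have term0 k : 0 <= count_mean k c / k`!%:R.
  by rewrite divr_ge0// count_mean_ge0.
have ndp : {homo partial c : n m / (n <= m)%N >-> n <= m}.
  move=> n m nm; rewrite /partial -!(big_mkord xpredT (fun k => count_mean k c / k`!%:R)).
  by rewrite (big_cat_nat (leq0n n) nm)//= lerDl sumr_ge0.
pose Q n := (\prod_a count_poly n c a).[1].
have QE n : Q n = \prod_a \sum_(k < n.+1) (p a ^+ k * c a k / k`!%:R).
  rewrite /Q horner_prod; apply: eq_bigr => a _; rewrite horner_poly.
  by apply: eq_bigr => k _; rewrite expr1n mulr1.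
have Q1 n : partial c n <= Q n.
  rewrite /Q (horner_coef_wide (n := maxn (size (\prod_a count_poly n c a)) n) _ (leq_maxl _ _)).
  rewrite -(big_mkord xpredT (fun k => (\prod_a count_poly n c a)`_k * 1 ^+ k)).
  rewrite (big_cat_nat (leq0n n) (leq_maxr _ _))//= big_mkord ler_wpDr//.
    apply: sumr_ge0 => k _; rewrite expr1n mulr1.
    have [] // := andP (@ler_coef_prod _ (index_enum A) (count_poly n c) (count_poly n c) _ k).
    move=> a j; rewrite lexx andbT coef_poly; case: ifP => // _.
    by rewrite divr_ge0// mulr_ge0// exprn_ge0.
  apply: ler_sum => k _; rewrite expr1n mulr1 coef_count_poly//.
  exact: ltnW.
have Q2 n : exists m, Q n <= partial c m.
  exists (size (\prod_a count_poly n c a)).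
  rewrite /Q horner_coef; apply: ler_sum => k _; rewrite expr1n mulr1.
  rewrite -(@coef_count_poly k (maxn k n)) ?leq_maxl//.
  have [] // := andP (@ler_coef_prod _ (index_enum A) (count_poly n c) (count_poly (maxn k n) c) _ k).
  move=> a j; rewrite !coef_poly; case: ifP => [jn|_].
    rewrite ltnS in jn; rewrite ltnS (leq_trans jn (leq_maxr _ _)) lexx andbT.
    by rewrite divr_ge0// mulr_ge0// exprn_ge0.
  by rewrite lexx /=; case: ifP => // _; rewrite divr_ge0// mulr_ge0// exprn_ge0.
have Qcvg : Q n @[n --> \oo] --> \prod_a S a.
  under eq_fun do rewrite QE.
  by apply: cvg_finprod => a; have := cS a; rewrite -cvg_shiftS.
have Qnd : {homo Q : n m / (n <= m)%N >-> n <= m}.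
  move=> n m nm; rewrite !QE; apply: ler_prod => a _.
  have t0 k : 0 <= p a ^+ k * c a k / k`!%:R by rewrite divr_ge0// mulr_ge0// exprn_ge0.
  rewrite sumr_ge0//= -!(big_mkord xpredT (fun k => p a ^+ k * c a k / k`!%:R)).
  by rewrite [leRHS](big_cat_nat (n := n.+1))//= lerDl sumr_ge0.
have Qle n : Q n <= \prod_a S a.
  rewrite -(cvg_lim (@Rhausdorff R) Qcvg).
  by apply: nondecreasing_cvgn_le => //; apply/cvg_ex; eexists; exact: Qcvg.
have pub : has_ubound (range (partial c)).
  by exists (\prod_a S a) => _ [n _ <-]; exact: le_trans (Q1 n) (Qle n).
have pc := nondecreasing_is_cvgn ndp pub.
suff -> : \prod_a S a = limn (partial c) by exact: pc.
apply/eqP; rewrite eq_le; apply/andP; split.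
  rewrite -(cvg_lim (@Rhausdorff R) Qcvg); apply: limr_le.
    by apply/cvg_ex; eexists; exact: Qcvg.
  apply: nearW => n; have [m nm] := Q2 n; apply: le_trans nm _.
  exact: nondecreasing_cvgn_le.
by apply: limr_le => //; apply: nearW => n; exact: le_trans (Q1 n) (Qle n).
Qed.

End letter_counts.

(** * Factorisation of a Poisson mixture over the letters *)

Section poisson_splitting.
Context {R : realType} {A : finType}.
Variable p : A -> R.
Hypotheses (p_gt0 : forall a, 0 < p a) (p_sum : \sum_a p a = 1).

Lemma count_mean_scale l n (c : A -> nat -> R) :
  count_mean (fun a => l * p a) n c = l ^+ n * count_mean p n c.
Proof.
elim: n c => [|n IH] c /=; first by rewrite mul1r.
rewrite exprS mulr_sumr; apply: eq_bigr => a _; rewrite IH; ring.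
Qed.

Lemma nneseries_EFin (u : nat -> R) (s : R) :
  \sum_(k < n) u k @[n --> \oo] --> s -> (\sum_(n <oo) (u n)%:E = s%:E)%E.
Proof.
move=> us; apply/cvg_lim => //.
under eq_fun do rewrite sumEFin big_mkord.
by apply: cvg_EFin us; exact: nearW.
Qed.

Lemma cvg_poisson_weighted (l : R) (c : nat -> R) : 0 < l -> (forall k, 0 <= c k <= 1) ->
  cvgn (fun n => \sum_(k < n) (l ^+ k * c k / k`!%:R)).
Proof.
move=> l0 c01; apply: nondecreasing_is_cvgn.
  move=> n m nm; rewrite -!(big_mkord xpredT (fun k => l ^+ k * c k / k`!%:R)).
  rewrite (big_cat_nat (leq0n n) nm)//= lerDl sumr_ge0// => k _.
  by rewrite divr_ge0// mulr_ge0 ?exprn_ge0 ?(ltW l0)//; case/andP: (c01 k).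
exists (expR l) => _ [n _ <-].
apply: (@le_trans _ _ (\sum_(k < n) exp_coeff l k)).
  apply: ler_sum => k _; rewrite /exp_coeff /= ler_wpM2r// ler_piMr//.
    by rewrite exprn_ge0 ?ltW.
  by case/andP: (c01 k).
rewrite -(big_mkord xpredT (exp_coeff l)); apply: nondecreasing_cvgn_le.
  move=> a b ab; rewrite /series /= (big_cat_nat (leq0n a) ab)//= lerDl sumr_ge0// => k _.
  by rewrite /exp_coeff /= divr_ge0// exprn_ge0// ltW.
exact: is_cvg_series_exp_coeff.
Qed.

(** The factor [expR (- l)] is the product of the [expR (- (l * p a))] because the [p a] sum to 1;
    the remaining power series factorises by [cvg_count_mean] with weights [l * p a]. *)
Lemma poisson_splitting l (c : A -> nat -> R) : 0 < l ->
  (forall a k, 0 <= c a k <= 1) ->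
  (\sum_(n <oo) (poisson_pmf l n * count_mean p n c)%:E =
   \prod_a \sum_(k <oo) (poisson_pmf (l * p a) k * c a k)%:E)%E.
Proof.
move=> l0 c01.
have lp a : 0 < l * p a by rewrite mulr_gt0.
have cS a := @cvg_poisson_weighted (l * p a) (c a) (lp a) (c01 a).
pose S a := limn (fun n => \sum_(k < n) ((l * p a) ^+ k * c a k / k`!%:R)).
have pS : (expR (- l) * \prod_a S a) = \prod_a (expR (- (l * p a)) * S a).
  rewrite big_split /= -expR_sum sumrN; congr (expR (- _) * _).
  by rewrite -mulr_sumr p_sum mulr1.
have -> : (\prod_a \sum_(k <oo) (poisson_pmf (l * p a) k * c a k)%:E =
    \prod_a (expR (- (l * p a)) * S a)%:E)%E.
  apply: eq_bigr => a _; apply: nneseries_EFin.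
  rewrite (_ : (fun n => _) = fun n => expR (- (l * p a)) * \sum_(k < n) ((l * p a) ^+ k * c a k / k`!%:R)).
    by apply: cvgMr; exact: cS.
  apply/funext => n; rewrite mulr_sumr; apply: eq_bigr => k _.
  by rewrite /poisson_pmf lp; ring.
rewrite prodEFin -pS; apply: nneseries_EFin.
rewrite (_ : (fun n => _) = fun n => expR (- l) * \sum_(k < n) (count_mean (fun a => l * p a) k c / k`!%:R)).
  apply: cvgMr; apply: cvg_count_mean => [a|a k|a]; first exact: ltW.
    by case/andP: (c01 a k).
  exact: cS.
apply/funext => n; rewrite mulr_sumr; apply: eq_bigr => k _.
by rewrite /poisson_pmf l0 count_mean_scale; ring.
Qed.

End poisson_splitting.

(** * The law of the random trie *)

Section sigma_algebra_closure.
Context {T : Type} (S : set_system T) (sS : sigma_algebra [set: T] S).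

Lemma sigma_algebra_setC B : S B -> S (~` B).
Proof. by case: sS => _ /(_ B) + _; rewrite setTD. Qed.

Lemma sigma_algebra_bigcup (F : nat -> set T) : (forall i, S (F i)) -> S (\bigcup_i F i).
Proof. by case: sS => _ _; apply. Qed.

Lemma sigma_algebra_bigcapn (F : nat -> set T) : (forall i, S (F i)) -> S (\bigcap_i F i).
Proof.
move=> SF; rewrite -[X in S X]setCK setC_bigcap; apply: sigma_algebra_setC.
by apply: sigma_algebra_bigcup => i; exact: sigma_algebra_setC.
Qed.

Lemma sigma_algebra_set0 : S set0.
Proof. by case: sS. Qed.

Lemma sigma_algebra_setT : S setT.
Proof. by rewrite -setC0; apply: sigma_algebra_setC; exact: sigma_algebra_set0. Qed.

Lemma sigma_algebra_setI B C : S B -> S C -> S (B `&` C).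
Proof.
move=> SB SC; rewrite (_ : B `&` C = \bigcap_i (if i is 0%N then B else C)).
  by apply: sigma_algebra_bigcapn => -[].
apply/seteqP; split=> [w [Bw Cw] [|i] _ //|w h].
by split; [exact: (h 0%N)|exact: (h 1%N)].
Qed.

Lemma sigma_algebra_setU B C : S B -> S C -> S (B `|` C).
Proof.
move=> SB SC; rewrite -[X in S X]setCK setCU.
by apply/sigma_algebra_setC/sigma_algebra_setI; exact: sigma_algebra_setC.
Qed.

Lemma sigma_algebra_bigcap_lt n (F : nat -> set T) :
  (forall i, (i < n)%N -> S (F i)) -> S [set w | forall i, (i < n)%N -> F i w].
Proof.
move=> SF; rewrite (_ : mkset _ = \bigcap_i (if (i < n)%N then F i else setT)).
  apply: sigma_algebra_bigcapn => i; case: ifP => [/SF //|_].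
  exact: sigma_algebra_setT.
apply/seteqP; split=> [w h i _|w h i ni].
  by case: ifP => // /h.
by have := h i I; rewrite ni.
Qed.

Lemma sigma_algebra_preimage_countable (C : countType) (f : T -> C) :
  (forall c, S (f @^-1` [set c])) -> forall B, S (f @^-1` B).
Proof.
move=> Sf B.
rewrite (_ : f @^-1` B = \bigcup_k (if @choice.unpickle C k is Some c then
    if `[< B c >] then f @^-1` [set c] else set0 else set0)).
  apply: sigma_algebra_bigcup => k; case: choice.unpickle => [c|]; last exact: sigma_algebra_set0.
  by case: ifP => _; [exact: Sf|exact: sigma_algebra_set0].
apply/seteqP; split=> [w Bw|w [k _]].
  by exists (@choice.pickle C (f w)) => //; rewrite choice.pickleK asboolT.
case: choice.unpickle => // c; case: ifP => // /asboolP Bc; by rewrite /preimage /= => ->.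
Qed.

End sigma_algebra_closure.

(** * Joint laws of finitely many prefixes *)

Section prefixes.
Context {d : measure_display} {T : measurableType d} {R : realType}.
Variable P : probability T R.
Context {A : finType}.
Variables (p : A -> R) (Xi : nat -> T -> nat -> A).
Hypotheses (p_gt0 : forall a, 0 < p a) (p_sum : \sum_a p a = 1).
Hypothesis Xi_iid : iid_strings P p Xi.

Lemma independent_nat (F : nat -> set_system T) n (E : nat -> set T) :
  mutually_independent P F -> (forall i, (i < n)%N -> F i (E i)) ->
  P [set w | forall i, (i < n)%N -> E i w] = (\prod_(i < n) P (E i))%E.
Proof.
move=> FI FE; pose J := [fset i | i in iota 0 n]%fset.
have JE i : (i \in J) = (i < n)%N by rewrite in_fset /= mem_iota.
have := FI J E _; rewrite (_ : \bigcap_(i in _) _ = [set w | forall i, (i < n)%N -> E i w]).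
  move=> -> //; last by move=> i; rewrite JE; exact: FE.
  rewrite -(big_mkord xpredT (fun i => P (E i))) /index_iota subn0; apply: perm_big.
  by apply: uniq_perm; [exact: fset_uniq|exact: iota_uniq|move=> i; rewrite JE mem_iota].
by apply/seteqP; split=> w h i; [rewrite -JE => /h|rewrite /= JE => /h].
Qed.

Lemma string_events_letter i j a : string_events (Xi i) [set w | Xi i w j = a].
Proof.
apply: sub_sigma_algebra; exists j => //; exists [set a] => //.
Qed.

Lemma string_events_word i L u : string_events (Xi i) [set w | mkseq (Xi i w) L = u].
Proof.
have sS := @smallest_sigma_algebra T setT (\bigcup_j letter_events (fun w => Xi i w j)).
case: (eqVneq (size u) L) => [uL|uL]; last first.
  rewrite (_ : mkset _ = set0); first exact: (sigma_algebra_set0 sS).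
  apply/seteqP; split=> w //= wu; move: uL; by rewrite -wu size_mkseq eqxx.
case: u uL => [|a0 u] uL.
  rewrite (_ : mkset _ = setT); first exact: (sigma_algebra_setT sS).
  by apply/seteqP; split=> w //= _; rewrite -uL.
rewrite (_ : mkset _ = [set w | forall j, (j < L)%N -> Xi i w j = nth a0 (a0 :: u) j]).
  apply: (@sigma_algebra_bigcap_lt _ _ sS L (fun j => [set w | Xi i w j = nth a0 (a0 :: u) j])).
  by move=> j _; exact: string_events_letter.
apply/seteqP; split=> w /= h.
  by move=> j jL; rewrite -h nth_mkseq.
apply: (@eq_from_nth _ a0); first by rewrite size_mkseq.
by move=> j; rewrite size_mkseq => jL; rewrite nth_mkseq// h.
Qed.

Lemma probability_word i u :
  P [set w | mkseq (Xi i w) (size u) = u] = (\prod_(a <- u) p a)%:E.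
Proof.
have [Li Lp Lind] := Xi_iid.1 i.
case: u => [|a0 u].
  rewrite big_nil (_ : mkset _ = setT) ?probability_setT//.
  by apply/seteqP; split.
set v := a0 :: u; have -> : [set w | mkseq (Xi i w) (size v) = v] =
    [set w | forall j, (j < size v)%N -> [set w | Xi i w j = nth a0 v j] w].
  apply/seteqP; split=> w /= h.
    by move=> j jL; rewrite -h nth_mkseq.
  apply: (@eq_from_nth _ a0); first by rewrite size_mkseq.
  by move=> j; rewrite size_mkseq => jL; rewrite nth_mkseq// h.
rewrite (independent_nat Lind); last first.
  by move=> j _; exists [set nth a0 v j].
rewrite (big_nth a0) big_mkord -prodEFin.
by apply: eq_bigr => j _; exact: Lp.
Qed.

Definition strings n w : seq (nat -> A) := [seq Xi i w | i <- iota 0 n].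

Definition prefixes L n w : seq (seq A) := [seq mkseq x L | x <- strings n w].

Lemma size_strings n w : size (strings n w) = n.
Proof. by rewrite size_map size_iota. Qed.

Lemma prefixesE L n us : size us = n ->
  [set w | prefixes L n w = us] =
  [set w | forall i, (i < n)%N -> [set w | mkseq (Xi i w) L = nth [::] us i] w].
Proof.
move=> usn; rewrite /prefixes /strings; apply/seteqP; split=> w /= h.
  by move=> i ni; rewrite -h -map_comp (nth_map 0%N) ?size_iota// nth_iota.
apply: (@eq_from_nth _ [::]); first by rewrite !size_map size_iota.
move=> i; rewrite !size_map size_iota => ni; rewrite -h// -map_comp.
by rewrite (nth_map 0%N) ?size_iota// nth_iota.
Qed.

Let all_sS := @smallest_sigma_algebra T setT (\bigcup_i string_events (Xi i)).

Lemma all_string_events_prefixes L n B : all_string_events Xi (prefixes L n @^-1` B).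
Proof.
apply: (sigma_algebra_preimage_countable all_sS) => us.
have [usn|usn] := eqVneq (size us) n; last first.
  rewrite (_ : _ @^-1` _ = set0); first exact: (sigma_algebra_set0 all_sS).
  apply/seteqP; split=> w //= wus; move: usn.
  by rewrite -wus /prefixes size_map size_strings eqxx.
rewrite -[X in _ X]/[set w | prefixes L n w = us] (prefixesE L usn).
apply: (@sigma_algebra_bigcap_lt _ _ all_sS n (fun i => [set w | mkseq (Xi i w) L = nth [::] us i])).
move=> i _; apply: sub_sigma_algebra; exists i => //; exact: string_events_word.
Qed.

Lemma all_string_events_measurable E : all_string_events Xi E -> measurable E.
Proof.
have mS := @sigma_algebra_measurable _ T.
move: E; apply: smallest_sub => // E [i _]; move: E.
apply: smallest_sub => // E [j _]; exact: (let: And3 h _ _ := Xi_iid.1 i in h j).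
Qed.

Lemma probability_prefixes L n us : size us = n -> all (fun u => size u == L) us ->
  P [set w | prefixes L n w = us] = (\prod_(u <- us) \prod_(a <- u) p a)%:E.
Proof.
move=> usn /allP usL; rewrite (prefixesE L usn) (independent_nat Xi_iid.2); last first.
  by move=> i _; exact: string_events_word.
rewrite (big_nth [::]) big_mkord usn -prodEFin; apply: eq_bigr => i _.
have := usL (nth [::] us i); rewrite mem_nth ?usn// => /(_ isT)/eqP uL.
by rewrite -{1}uL probability_word.
Qed.

Definition word_weight (u : seq A) : R := \prod_(a <- u) p a.

Definition strings_mean L n (h : seq (seq A) -> R) : R :=
  list_mean (lists (enum A) L) word_weight n h.

Lemma probability_prefixes_mean L n (B : set (seq (seq A))) :
  P (prefixes L n @^-1` B) = (strings_mean L n (\1_B))%:E.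
Proof.
pose W := [seq us <- lists (lists (enum A) L) n | us \in B].
have Wu : uniq W by rewrite filter_uniq// !lists_uniq// enum_uniq.
have WE us : us \in W -> size us = n /\ all (fun u => size u == L) us.
  rewrite mem_filter mem_lists => /and3P[_ /eqP -> h]; split=> //.
  by apply: sub_all h => u /=; rewrite mem_lists => /andP[].
have -> : prefixes L n @^-1` B = \bigcup_(us in [set` W]) [set w | prefixes L n w = us].
  apply/seteqP; split=> [w Bw|w [us /=]].
    exists (prefixes L n w) => //=; rewrite mem_filter mem_set//= mem_lists.
    rewrite /prefixes size_map size_strings eqxx /=; apply/allP => _ /mapP[x _ ->].
    rewrite mem_lists size_mkseq eqxx; apply/allP => a _; exact: mem_enum.
  by rewrite mem_filter => /andP[+ _] pus; rewrite inE /preimage /= pus.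
rewrite measure_fin_bigcup//; first last.
- move=> us _; apply: all_string_events_measurable.
  exact: (all_string_events_prefixes L n [set us]).
- by move=> u v _ _ [w [/= -> ->]].
- exact: finite_seq.
rewrite -fsbig_seq//= /strings_mean /list_mean -sumEFin big_filter big_mkcond /=.
rewrite big_seq [RHS]big_seq; apply: eq_bigr => us usl; rewrite indicE.
case: ifPn => usB; last by rewrite mulr0.
have [//|usn usL] := WE us; first by rewrite mem_filter usB.
by rewrite mulr1 probability_prefixes.
Qed.

Variable a0 : A.

(** A word is prolonged by the letter [a0], so that functions of infinite strings can be evaluated
    at prefixes; a function determined at depth [L] does not see the prolongation of words of length
    [L]. *)
Definition word_string (u : seq A) : nat -> A := nth a0 u.

Lemma mkseq_word_string (x : nat -> A) L : mkseq (word_string (mkseq x L)) L = mkseq x L.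
Proof.
apply: (@eq_from_nth _ a0); rewrite !size_mkseq// => i iL.
by rewrite nth_mkseq// /word_string nth_mkseq.
Qed.

Lemma depth_determined_strings U L (g : seq (nat -> A) -> U) n w :
  depth_determined L g -> g (strings n w) = g (map word_string (prefixes L n w)).
Proof.
move=> gL; apply: gL; rewrite /prefixes -!map_comp; apply: eq_map => i /=.
by rewrite mkseq_word_string.
Qed.

Lemma all_string_events_depth U L (g : seq (nat -> A) -> U) n B :
  depth_determined L g -> all_string_events Xi [set w | B (g (strings n w))].
Proof.
move=> gL; rewrite (_ : mkset _ = prefixes L n @^-1` [set us | B (g (map word_string us))]).
  exact: all_string_events_prefixes.
by apply/seteqP; split=> w /=; rewrite (depth_determined_strings n w gL).
Qed.

Lemma probability_depth U L (g : seq (nat -> A) -> U) n (B : set U) :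
  depth_determined L g ->
  P [set w | B (g (strings n w))] =
  (strings_mean L n (fun us => (`[< B (g (map word_string us)) >])%:R))%:E.
Proof.
move=> gL; rewrite (_ : mkset _ = prefixes L n @^-1` [set us | B (g (map word_string us))]).
  rewrite probability_prefixes_mean; congr (_%:E).
by apply/seteqP; split=> w /=; rewrite (depth_determined_strings n w gL).
Qed.

(** Remove the first word [a :: v]: it adds [v] to the branch of [a] and leaves the other branches
    alone. The remaining words are handled by induction, and the mean over [v] acts on the factor of
    [a] only. *)
Lemma strings_mean_branch L n (h : A -> seq (nat -> A) -> R) :
  strings_mean L.+1 n (fun us => \prod_a h a (branch (map word_string us) a)) =
  count_mean p n (fun a k => strings_mean L k (h a \o map word_string)).
Proof.
elim: n h => [|n IH] h /=.
  rewrite /strings_mean list_mean0; apply: eq_bigr => a _.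
  by rewrite list_mean0.
rewrite {1}/strings_mean list_meanS /= big_allpairs_dep /= big_enum /=.
apply: eq_bigr => a _.
pose h' v b s := if b == a then h b (word_string v :: s) else h b s.
transitivity (p a * \sum_(v <- lists (enum A) L) word_weight v *
    count_mean p n (set_count (fun b k => strings_mean L k (h b \o map word_string)) a
      (fun k => strings_mean L k (h a \o map word_string \o cons v)))).
  rewrite mulr_sumr; apply: eq_bigr => v _.
  rewrite /word_weight big_cons -mulrA; congr (_ * (_ * _)).
  transitivity (strings_mean L.+1 n (fun us => \prod_b h' v b (branch (map word_string us) b))).
    congr list_mean; apply/funext => us /=; apply: eq_bigr => b _.
    by rewrite /h' /branch /= eq_sym; case: (eqVneq b a) => [->|].
  rewrite IH; congr count_mean; apply/funext => b; apply/funext => k.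
  rewrite /set_count /h'; case: (eqVneq b a) => [->|ba]; congr list_mean; apply/funext => us /=.
congr (_ * _); rewrite count_mean_linear; congr count_mean.
apply/funext => b; apply/funext => k; rewrite /set_count /shift.
by case: (eqVneq b a) => [->|//]; rewrite {2}/strings_mean list_meanS.
Qed.

End prefixes.

(** * From prefixes to tries, and Poisson splitting of the random trie *)

Section random_tries.
Context {d : measure_display} {T : measurableType d} {R : realType}.
Variable P : probability T R.
Context {A : finType}.
Variables (p : A -> R) (Xi : nat -> T -> nat -> A).
Hypotheses (A_gt1 : (1 < #|A|)%N) (p_gt0 : forall a, 0 < p a) (p_sum : \sum_a p a = 1).
Hypothesis Xi_iid : iid_strings P p Xi.

Local Notation strings := (strings Xi).

Lemma max_letter : exists2 rho : R, 0 < rho < 1 & forall a, p a <= rho.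
Proof.
have /card_gt0P[a0 _] : (0 < #|A|)%N by exact: ltnW.
have [b _ bmax] := @Order.TotalTheory.arg_maxP _ R A a0 xpredT p isT.
exists (p b); last by move=> a; exact: bmax.
rewrite p_gt0 /= -p_sum (bigD1 b)//= ltrDl.
have [c cb] : exists c, c != b.
  have := A_gt1; rewrite (cardD1 b) inE add1n ltnS => /card_gt0P[c].
  by rewrite !inE => /andP[cb _]; exists c.
rewrite (bigD1 c)//= ltr_pwDl// sumr_ge0// => a _; exact: ltW.
Qed.

Lemma sum_word_weight L : \sum_(u <- lists (enum A) L) word_weight p u = 1.
Proof.
elim: L => [|L IH]; first by rewrite /= big_seq1 /word_weight big_nil.
rewrite /= big_allpairs_dep /= big_enum /= -p_sum; apply: eq_bigr => a _.
rewrite -[RHS]mulr1 -IH mulr_sumr; apply: eq_bigr => u _.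
by rewrite /word_weight big_cons.
Qed.

Lemma word_weight_le rho u : 0 <= rho -> (forall a, p a <= rho) ->
  word_weight p u <= rho ^+ size u.
Proof.
move=> rho0 prho; rewrite /word_weight; elim: u => [|a u IH]; first by rewrite big_nil.
by rewrite big_cons exprS ler_pM ?(ltW (p_gt0 _)) ?prodr_ge0// => b _; exact: ltW.
Qed.

Lemma word_weight_ge0 u : 0 <= word_weight p u.
Proof. by apply: prodr_ge0 => a _; exact: ltW. Qed.

Lemma le_strings_mean L n h h' : (forall us, size us = n -> h us <= h' us) ->
  strings_mean p L n h <= strings_mean p L n h'.
Proof.
move=> hh; rewrite /strings_mean /list_mean big_seq [leRHS]big_seq.
apply: ler_sum => us; rewrite mem_lists => /andP[/eqP usn _].
by rewrite ler_wpM2l ?hh// prodr_ge0// => u _; exact: word_weight_ge0.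
Qed.

Lemma strings_mean_cst L n x : strings_mean p L n (fun=> x) = x.
Proof.
elim: n => [|n IH]; first by rewrite /strings_mean list_mean0.
rewrite /strings_mean list_meanS -[RHS]mul1r -(sum_word_weight L) mulr_suml.
by apply: eq_bigr => u _; congr (_ * _); exact: IH.
Qed.

Lemma strings_meanD L n h h' :
  strings_mean p L n (fun us => h us + h' us) = strings_mean p L n h + strings_mean p L n h'.
Proof.
by rewrite /strings_mean /list_mean -big_split /=; apply: eq_bigr => us _; rewrite mulrDr.
Qed.

(** Union bound: a new word of length [L] equals a given one with probability at most [rho ^+ L],
    and fewer than [n * n] comparisons occur when [n] is positive. *)
Lemma strings_mean_not_uniq rho L n : 0 <= rho -> (forall a, p a <= rho) ->
  strings_mean p L n (fun us => (~~ uniq us)%:R) <= (n * n)%:R * rho ^+ L.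
Proof.
move=> rho0 prho; elim: n => [|n IH].
  by rewrite /strings_mean list_mean0 mul0r.
rewrite {1}/strings_mean list_meanS.
apply: (@le_trans _ _ (\sum_(u <- lists (enum A) L) word_weight p u *
    (strings_mean p L n (fun us => (u \in us)%:R) + strings_mean p L n (fun us => (~~ uniq us)%:R)))).
  apply: ler_sum => u _; rewrite ler_wpM2l ?word_weight_ge0// -strings_meanD.
  apply: le_strings_mean => us _ /=; rewrite negb_and negbK -natrD ler_nat.
  by case: (u \in us) => //=; case: uniq.
under eq_bigr do rewrite mulrDr.
rewrite big_split /= -mulr_suml sum_word_weight mul1r.
apply: (@le_trans _ _ (n%:R * rho ^+ L + (n * n)%:R * rho ^+ L)); last first.
  by rewrite -mulrDl ler_wpM2r ?exprn_ge0// -natrD ler_nat -mulSn leq_mul.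
apply: lerD => //.
have -> : \sum_(u <- lists (enum A) L) word_weight p u * strings_mean p L n (fun us => (u \in us)%:R) =
    strings_mean p L n (fun us => \sum_(u <- lists (enum A) L) word_weight p u * (u \in us)%:R).
  rewrite /strings_mean /list_mean; under eq_bigr do rewrite mulr_sumr.
  rewrite exchange_big /=; apply: eq_bigr => us _; rewrite mulr_sumr.
  by apply: eq_bigr => u _; rewrite mulrCA.
rewrite -(strings_mean_cst L n (n%:R * rho ^+ L)); apply: le_strings_mean => us usn.
apply: (@le_trans _ _ (\sum_(u <- lists (enum A) L) \sum_(v <- us) rho ^+ L * (u == v)%:R)).
  rewrite big_seq [leRHS]big_seq; apply: ler_sum => u.
  rewrite mem_lists => /andP[/eqP uL _]; rewrite -mulr_sumr.
  apply: ler_pM => //; [exact: word_weight_ge0|by rewrite -uL word_weight_le|].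
  case: (boolP (u \in us)) => uus; last by apply: sumr_ge0 => v _.
  by rewrite (big_rem u)//= eqxx lerDl sumr_ge0.
rewrite exchange_big /=.
apply: (@le_trans _ _ (\sum_(v <- us) rho ^+ L)); last first.
  by rewrite big_const_seq count_predT usn iter_addr_0 mulr_natl.
apply: ler_sum => v _; rewrite -mulr_sumr ler_piMr ?exprn_ge0//.
case: (boolP (v \in lists (enum A) L)) => [vl|vl].
  rewrite (bigD1_seq v) ?lists_uniq ?enum_uniq//= eqxx big1 ?addr0// => u /negbTE uv.
  by rewrite uv.
by rewrite big_seq big1// => u ul; case: eqP => // uv; move: vl; rewrite -uv ul.
Qed.

Variable a0 : A.

Lemma probability_not_separated rho L n : 0 <= rho -> (forall a, p a <= rho) ->
  fine (P [set w | ~~ separated L (strings n w)]) <= (n * n)%:R * rho ^+ L.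
Proof.
move=> rho0 prho.
rewrite (probability_depth Xi_iid a0 n [set b : bool | ~~ b] (@depth_determined_separated A L)) /=.
rewrite [leLHS](_ : _ = strings_mean p L n (fun us => (~~ uniq us)%:R)).
  exact: strings_mean_not_uniq.
rewrite /strings_mean /list_mean big_seq [RHS]big_seq; apply: eq_bigr => us.
rewrite mem_lists => /andP[_ /allP usl]; congr (_ * (nat_of_bool _)%:R).
rewrite asboolb /separated -map_comp; congr (~~ uniq _); rewrite -[RHS]map_id.
apply/eq_in_map => u /usl; rewrite mem_lists => /andP[/eqP uL _] /=.
apply: (@eq_from_nth _ a0); first by rewrite size_mkseq.
by move=> i; rewrite size_mkseq => iL; rewrite nth_mkseq.
Qed.

(** The number of strings is kept beside the trie because changes of the intensity weigh it through
    [poisson_pmf], and because fewer than two strings are an exception in the recursion. *)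
Definition sized_trie (s : seq (nat -> A)) : nat * {fset (seq A)} := (size s, trie s).

Definition sized_trie_depth L (s : seq (nat -> A)) : nat * {fset (seq A)} :=
  (size s, trie_depth L s).

Lemma depth_determined_sized_trie L : depth_determined L (sized_trie_depth L).
Proof.
move=> s s' ss'; congr (_, _); last exact: depth_determined_trie.
by rewrite -(size_map (fun x => mkseq x L)) ss' size_map.
Qed.

Lemma sized_trie_separated L s : separated L s -> sized_trie s = sized_trie_depth L s.
Proof. by move=> sL; congr (_, _); exact: trie_separated. Qed.

Let all_sS := @smallest_sigma_algebra T setT (\bigcup_i string_events (Xi i)).

(** On strings separated at depth [L] the event concerns [sized_trie_depth L]; on strings that are
    never separated the trie is [fset0]. Both cases are countable combinations of events of finite
    depth. Here [f] is the identity or the passage to a branch. *)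
Lemma all_string_events_sized_trie (f : seq (nat -> A) -> seq (nat -> A)) n B :
  (forall U L (g : seq (nat -> A) -> U), depth_determined L g -> exists L', depth_determined L' (g \o f)) ->
  all_string_events Xi [set w | B (sized_trie (f (strings n w)))].
Proof.
move=> fd.
have allE U L (g : seq (nat -> A) -> U) B' : depth_determined L g ->
    all_string_events Xi [set w | B' (g (f (strings n w)))].
  by move=> /fd[L' gL']; exact: (all_string_events_depth a0 n B' gL').
rewrite (_ : mkset _ =
  \bigcup_L ([set w | separated L (f (strings n w))] `&`
             [set w | B (sized_trie_depth L (f (strings n w)))]) `|`
  ((~` \bigcup_L [set w | separated L (f (strings n w))]) `&`
   [set w | B (size (f (strings n w)), fset0)])).
  apply: (sigma_algebra_setU all_sS).
    apply: (sigma_algebra_bigcup all_sS) => L; apply: (sigma_algebra_setI all_sS).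
      exact: (allE _ _ _ [set b : bool | b] (@depth_determined_separated A L)).
    exact: (allE _ _ _ B (@depth_determined_sized_trie L)).
  apply: (sigma_algebra_setI all_sS).
    apply: (sigma_algebra_setC all_sS); apply: (sigma_algebra_bigcup all_sS) => L.
    exact: (allE _ _ _ [set b : bool | b] (@depth_determined_separated A L)).
  apply: (allE _ 0%N (fun s => (size s, fset0)) B).
  by move=> s s' ss'; rewrite -(size_map (fun x => mkseq x 0)) ss' size_map.
apply/seteqP; split=> w.
  move=> /= Bw; have [[L sL]|nsep] := pselect (exists L, separated L (f (strings n w))).
    by left; exists L => //; split=> //=; rewrite -sized_trie_separated.
  right; split=> [[L _ sL]|]; first by apply: nsep; exists L.
  rewrite /= -(@trie_not_separated A (f (strings n w)))// => L.
  by apply/negP => sL; apply: nsep; exists L.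
move=> [[L _ [/= sL]]|[nsep /=]]; first by rewrite -sized_trie_separated.
rewrite -(@trie_not_separated A (f (strings n w)))// => L.
by apply/negP => sL; apply: nsep; exists L.
Qed.

Lemma all_string_events_trie n B :
  all_string_events Xi [set w | B (sized_trie (strings n w))].
Proof. by apply: (@all_string_events_sized_trie id) => U L g gL; exists L. Qed.

Lemma all_string_events_branches n (B : A -> set (nat * {fset (seq A)})) :
  all_string_events Xi [set w | forall a, B a (sized_trie (branch (strings n w) a))].
Proof.
rewrite (_ : mkset _ = [set w | forall i, (i < #|A|)%N ->
    [set w | B (nth a0 (enum A) i) (sized_trie (branch (strings n w) (nth a0 (enum A) i)))] w]).
  apply: (@sigma_algebra_bigcap_lt _ _ all_sS #|A|) => i _.
  apply: (@all_string_events_sized_trie (branch^~ (nth a0 (enum A) i))) => U L g gL.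
  by exists L.+1; exact: depth_determined_branch.
apply/seteqP; split=> w /= h => [i _|a]; first exact: h.
have := h (index a (enum A)); rewrite nth_index ?mem_enum//; apply.
by rewrite cardE index_mem mem_enum.
Qed.

Definition trie_prob n B : R := fine (P [set w | B (sized_trie (strings n w))]).

Lemma trie_prob01 n B : 0 <= trie_prob n B <= 1.
Proof.
have mB : measurable [set w | B (sized_trie (strings n w))].
  by apply: (all_string_events_measurable Xi_iid); exact: all_string_events_trie.
by rewrite fine_ge0//= -lee_fin fineK ?fin_num_measure// probability_le1.
Qed.

Lemma probability_eq_on (X Y G : set T) : measurable X -> measurable Y -> measurable G ->
  X `&` G = Y `&` G -> `|fine (P X) - fine (P Y)| <= fine (P (~` G)).
Proof.
move=> mX mY mG XY.
have key X' Y' : measurable X' -> measurable Y' -> X' `&` G = Y' `&` G ->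
    fine (P X') <= fine (P Y') + fine (P (~` G)).
  move=> mX' mY' XY'; have mGC := measurableC mG.
  rewrite -fineD ?fin_num_measure//; apply: fine_le; rewrite ?fin_num_measure//.
    by rewrite fin_numD !fin_num_measure.
  apply: (@le_trans _ _ (P (Y' `|` ~` G))); last exact: measureU2.
  apply: le_measure; rewrite ?inE//; first exact: measurableU.
  move=> w Xw; have [Gw|] := pselect (G w); last by right.
  by left; have : (X' `&` G) w by []; rewrite XY' => -[].
by rewrite ler_distl lerBlDr key// addrC -lerBlDl lerBlDl addrC key.
Qed.

Lemma cvg_count_mean_seq (c_ : nat -> A -> nat -> R) (c : A -> nat -> R) n :
  (forall a k, c_ L a k @[L --> \oo] --> c a k) ->
  count_mean p n (c_ L) @[L --> \oo] --> count_mean p n c.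
Proof.
elim: n c_ c => [|n IH] c_ c cc /=; first by apply: cvg_finprod => a; exact: cc.
suff : forall s : seq A, (\sum_(a <- s) p a * count_mean p n (shift a (c_ L))) @[L --> \oo]
    --> \sum_(a <- s) p a * count_mean p n (shift a c) by exact.
elim=> [|a s IHs].
  by rewrite big_nil; under eq_fun do rewrite big_nil; exact: cvg_cst.
rewrite big_cons; under eq_fun do rewrite big_cons.
apply: cvgD => //; apply: cvgMr; apply: (IH (fun L => shift a (c_ L))) => b k.
by rewrite /shift; case: ifP => _; exact: cc.
Qed.

Lemma cvg_not_separated n : fine (P [set w | ~~ separated L (strings n w)]) @[L --> \oo] --> (0 : R).
Proof.
have [rho /andP[rho0 rho1] prho] := max_letter.
apply: (@squeeze_cvgr _ _ _ _ (cst 0) (fun L => (n * n)%:R * rho ^+ L)).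
- apply: nearW => L; rewrite fine_ge0//= probability_not_separated//; exact: ltW.
- exact: cvg_cst.
- rewrite -[X in _ --> X](mulr0 (n * n)%:R); apply: cvgMr; apply: cvg_expr.
  by rewrite ger0_norm// ltW.
Qed.

(** At finite depth this is [strings_mean_branch]. Truncation changes the event on the left, and
    each [trie_prob] on the right, by at most a probability of non-separation, which tends to 0 with
    the depth. *)
Lemma trie_branch_prob n (B : A -> set (nat * {fset (seq A)})) :
  P [set w | forall a, B a (sized_trie (branch (strings n w) a))] =
  (count_mean p n (fun a k => trie_prob k (B a)))%:E.
Proof.
have mE E : all_string_events Xi E -> measurable E := @all_string_events_measurable _ _ _ _ _ _ _ Xi_iid E.
pose X := [set w | forall a, B a (sized_trie (branch (strings n w) a))].
pose X_ L := [set w | forall a, B a (sized_trie_depth L (branch (strings n w) a))].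
pose c_ L a k := fine (P [set w | B a (sized_trie_depth L (strings k w))]).
have mX : measurable X := mE _ (all_string_events_branches n B).
pose hB L a s : R := (`[< B a (sized_trie_depth L s) >])%:R.
have X_E L : P (X_ L) = (count_mean p n (c_ L))%:E.
  pose g L s := [forall a, `[< B a (sized_trie_depth L (branch s a)) >]].
  have gd : depth_determined L.+1 (g L).
    move=> s s' ss'; apply: eq_forallb => a; congr (`[< B a _ >]).
    exact: (depth_determined_branch a (@depth_determined_sized_trie L)).
  rewrite (_ : X_ L = [set w | [set b : bool | b] (g L (strings n w))]); last first.
    apply/seteqP; split=> w /=; first by move=> h; apply/forallP => a; exact/asboolP.
    by move=> /forallP h a; exact/asboolP.
  rewrite (probability_depth Xi_iid a0 n _ gd); congr (_%:E).
  transitivity (strings_mean p L.+1 n (fun us => \prod_a hB L a (branch (map (word_string a0) us) a))).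
    apply: eq_bigr => us _; congr (_ * _); rewrite asboolb /g /hB.
    case: forallP => [h|h]; first by rewrite big1// => a _; rewrite (h a).
    apply/esym/eqP/prodf_eq0; move: h => /existsNP[a /negP/negbTE h].
    by exists a => //; rewrite h.
  rewrite strings_mean_branch//; congr count_mean; apply/funext => a; apply/funext => k.
  by rewrite /c_ (probability_depth Xi_iid a0 k (B a) (@depth_determined_sized_trie L)).
have mX_ L : measurable (X_ L).
  rewrite (_ : X_ L = [set w | forall a, [set t | B a (sized_trie_depth L t)] (branch (strings n w) a)])//.
  pose g := fun s (a : A) => `[< B a (sized_trie_depth L (branch s a)) >].
  have gd : depth_determined L.+1 g.
    move=> s s' ss'; apply/funext => a; congr (`[< B a _ >]).
    exact: (depth_determined_branch a (@depth_determined_sized_trie L)).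
  apply: mE; rewrite (_ : mkset _ = [set w | [set f : A -> bool | forall a, f a] (g (strings n w))]).
    exact: (all_string_events_depth a0 n _ gd).
  by apply/seteqP; split=> w /= h a; apply/asboolP; exact: h.
have mS k L : measurable [set w | separated L (strings k w)].
  apply: mE; exact: (all_string_events_depth a0 k [set b : bool | b] (@depth_determined_separated A L)).
have nsE k L : ~` [set w | separated L (strings k w)] = [set w | ~~ separated L (strings k w)].
  by apply/seteqP; split=> w /= /negP.
have lim1 : fine (P (X_ L)) @[L --> \oo] --> fine (P X).
  (* A branch has lost one letter: [X_ L.+1] agrees with [X] when the strings are separated at depth
     [L.+2]. *)
  rewrite -cvg_shiftS /=; apply/cvgrPdist_lt => e e0.
  have := cvg_not_separated n; move=> /cvgr0_norm_lt/(_ e e0) [L0 _ hL0].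
  exists L0 => // L /= L0L.
  have L1 : (L0 <= L.+2)%N by rewrite (leq_trans L0L)// ltnW.
  have := hL0 _ L1; apply: le_lt_trans; rewrite [leRHS]ger0_norm ?fine_ge0// -nsE distrC.
  apply: probability_eq_on => //; apply/seteqP; split=> w [/= h sL]; split=> // a.
    by rewrite (sized_trie_separated (separated_branch a sL)); exact: h.
  by rewrite -(sized_trie_separated (separated_branch a sL)); exact: h.
have lim2 a k : c_ L a k @[L --> \oo] --> trie_prob k (B a).
  apply/cvgrPdist_lt => e e0.
  have := cvg_not_separated k; move=> /cvgr0_norm_lt/(_ e e0) [L0 _ hL0].
  exists L0 => // L /= L0L; have := hL0 _ L0L; apply: le_lt_trans.
  rewrite [leRHS]ger0_norm ?fine_ge0// -nsE distrC; apply: probability_eq_on => //.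
  - exact: mE (all_string_events_depth a0 k (B a) (@depth_determined_sized_trie L)).
  - exact: mE (all_string_events_trie k (B a)).
  - apply/seteqP; split=> w [/= h sL]; split=> //=.
      by rewrite (sized_trie_separated sL).
    by rewrite -(sized_trie_separated sL).
rewrite -[LHS]fineK ?fin_num_measure//; congr (_%:E).
have lim3 := @cvg_count_mean_seq c_ _ n lim2.
rewrite -(cvg_lim (@Rhausdorff R) lim1) -(cvg_lim (@Rhausdorff R) lim3).
by congr (limn _); apply/funext => L /=; rewrite X_E.
Qed.

Variables (l : R) (N : T -> nat).
Hypotheses (l_gt0 : 0 < l) (N_poisson : poisson_distributed P l N).
Hypothesis N_independent : independent_of_strings P Xi N.

Lemma measurable_size n : measurable (N @^-1` [set n]).
Proof. by rewrite -[X in measurable X]setTI; apply: N_poisson.1. Qed.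

Lemma probability_poisson_mixture (E : nat -> set T) :
  (forall n, all_string_events Xi (E n)) ->
  P [set w | E (N w) w] = (\sum_(n <oo) (poisson_pmf l n * fine (P (E n)))%:E)%E.
Proof.
move=> SE; have mE n : measurable (E n) by exact: (all_string_events_measurable Xi_iid).
have -> : [set w | E (N w) w] = \bigcup_n (N @^-1` [set n] `&` E n).
  by apply/seteqP; split=> [w Ew|w [n _ [/= ->]]//]; exists (N w).
rewrite measure_bigcup; last 2 first.
- by move=> n _; apply: measurableI => //; exact: measurable_size.
- by move=> i j _ _ [w [[/= -> _] [/= -> _]]].
rewrite (eq_eseriesl (Q := xpredT)); last by move=> n; rewrite in_setT.
apply: eq_eseriesr => n _; rewrite EFinM fineK ?fin_num_measure// -N_poisson.2.
exact: N_independent.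
Qed.

Lemma measurable_mixture (E : nat -> set T) : (forall n, all_string_events Xi (E n)) ->
  measurable [set w | E (N w) w].
Proof.
move=> SE; rewrite (_ : mkset _ = \bigcup_n (N @^-1` [set n] `&` E n)).
  apply: bigcup_measurable => n _; apply: measurableI; first exact: measurable_size.
  exact: (all_string_events_measurable Xi_iid).
by apply/seteqP; split=> [w Ew|w [n _ [/= ->]]//]; exists (N w).
Qed.

Lemma random_trie_prob B :
  P [set w | B (sized_trie (strings (N w) w))] =
  (\sum_(n <oo) (poisson_pmf l n * trie_prob n B)%:E)%E.
Proof.
exact: (@probability_poisson_mixture (fun n => [set w | B (sized_trie (strings n w))])
  (fun n => all_string_events_trie n B)).
Qed.

Lemma measurable_random_trie B : measurable [set w | B (sized_trie (strings (N w) w))].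
Proof.
exact: (@measurable_mixture (fun n => [set w | B (sized_trie (strings n w))])
  (fun n => all_string_events_trie n B)).
Qed.

Lemma random_branches_prob (B : A -> set (nat * {fset (seq A)})) :
  P [set w | forall a, B a (sized_trie (branch (strings (N w) w) a))] =
  (\prod_a \sum_(k <oo) (poisson_pmf (l * p a) k * trie_prob k (B a))%:E)%E.
Proof.
rewrite (@probability_poisson_mixture
  (fun n => [set w | forall a, B a (sized_trie (branch (strings n w) a))])
  (fun n => all_string_events_branches n B)).
under eq_eseriesr do rewrite trie_branch_prob /=.
by apply: poisson_splitting => // a k; exact: trie_prob01.
Qed.

Lemma measurable_random_branches (B : A -> set (nat * {fset (seq A)})) :
  measurable [set w | forall a, B a (sized_trie (branch (strings (N w) w) a))].
Proof.
exact: (@measurable_mixture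
  (fun n => [set w | forall a, B a (sized_trie (branch (strings n w) a))])
  (fun n => all_string_events_branches n B)).
Qed.

Lemma random_strings_separated : {ae P, forall w, exists L, separated L (strings (N w) w)}.
Proof.
have sepE L n : all_string_events Xi [set w | ~~ separated L (strings n w)].
  exact: (all_string_events_depth a0 n [set b : bool | ~~ b] (@depth_determined_separated A L)).
have mE E : all_string_events Xi E -> measurable E := @all_string_events_measurable _ _ _ _ _ _ _ Xi_iid E.
have SE n : all_string_events Xi [set w | forall L, ~~ separated L (strings n w)].
  rewrite (_ : mkset _ = \bigcap_L [set w | ~~ separated L (strings n w)]).
    by apply: (sigma_algebra_bigcapn all_sS) => L; exact: sepE.
  by apply/seteqP; split=> w /= h L; [move=> _|]; exact: (h L).
exists [set w | forall L, ~~ separated L (strings (N w) w)]; split.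
- exact: (@measurable_mixture (fun n => [set w | forall L, ~~ separated L (strings n w)]) SE).
- rewrite (@probability_poisson_mixture (fun n => [set w | forall L, ~~ separated L (strings n w)]) SE).
  apply: eseries0 => n _ _; rewrite [X in (_ * X)%:E](_ : _ = 0) ?mulr0//.
  apply/eqP; rewrite eq_le fine_ge0// andbT.
  rewrite -(cvg_lim (@Rhausdorff R) (cvg_not_separated n)); apply: limr_ge.
    by apply/cvg_ex; eexists; exact: cvg_not_separated.
  apply: nearW => L; have mX := mE _ (SE n); have mY := mE _ (sepE L n).
  by apply: fine_le; rewrite ?fin_num_measure ?le_measure ?inE// => w; exact.
- by move=> w /= nw L; apply/negP => sL; apply: nw; exists L.
Qed.

End random_tries.

(** * Discrete variables and independence *)

Section discrete_variables.
Context {d : measure_display} {T : measurableType d} {R : realType}.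
Variable P : probability T R.
Context {C : countType}.
Implicit Types (D : T -> C).

(** Since [C] is countable, the atoms suffice: any function of [D], in particular any toll, is then
    measurable. *)
Definition discrete_variable D : Prop := forall c, measurable (D @^-1` [set c]).

Lemma discrete_measurable_preimage D (B : set C) : discrete_variable D -> measurable (D @^-1` B).
Proof.
move=> mD; apply: (@sigma_algebra_preimage_countable _ measurable) => //.
by split=> [|E mE|F mF]; [exact: measurable0|rewrite setTD; exact: measurableC|exact: bigcup_measurable].
Qed.

Lemma measurable_fun_discrete d' (T' : measurableType d') D (f : C -> T') :
  discrete_variable D -> measurable_fun setT (fun w => f (D w)).
Proof.
move=> mD _ B mB; rewrite setTI; exact: (@discrete_measurable_preimage D (f @^-1` B)).
Qed.

(** Both integrals are sums over atoms and are compared term by term. As [g] and [g'] may differ,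
    this covers changes of measure as well as equality in law. *)
Lemma le_integral_discrete D D' (g g' : C -> \bar R) :
  discrete_variable D -> discrete_variable D' ->
  (forall c, 0 <= g c)%E -> (forall c, 0 <= g' c)%E ->
  (forall c, g c * P (D @^-1` [set c]) <= g' c * P (D' @^-1` [set c]))%E ->
  (\int[P]_w g (D w) <= \int[P]_w g' (D' w))%E.
Proof.
move=> mD mD' g0 g'0 gg'.
pose F (E : T -> C) k := [set w | @choice.pickle C (E w) = k].
have FT E : \bigcup_k F E k = setT.
  by apply/seteqP; split=> // w _; exists (@choice.pickle C (E w)).
have FI E : trivIset setT (F E) by move=> i j _ _ [w [/= <- <-]].
have mF E k : discrete_variable E -> measurable (F E k).
  by move=> mE; exact: (@discrete_measurable_preimage E [set c | choice.pickle c = k]).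
have intE E (h : C -> \bar R) : discrete_variable E -> (forall c, 0 <= h c)%E ->
    (\int[P]_w h (E w) = \sum_(k <oo) \int[P]_(w in F E k) h (E w))%E.
  move=> mE h0; rewrite -(FT E) ge0_integral_bigcup//; first by move=> k; exact: mF.
  by rewrite FT; exact: measurable_fun_discrete.
rewrite (intE D)// (intE D')//; apply: lee_nneseries => [k _ _|k _]; first exact: integral_ge0.
have [[c ck]|nc] := pselect (exists c, @choice.pickle C c = k); last first.
  have F0 E : F E k = set0.
    by apply/seteqP; split=> // w /= wk; apply: nc; exists (E w).
  by rewrite !F0 !integral_set0.
have FE E : F E k = E @^-1` [set c].
  apply/seteqP; split=> w; last by rewrite /F /= => ->.
  by rewrite /F /= -ck => /(pcan_inj choice.pickleK).
have intc E (h : C -> \bar R) : discrete_variable E ->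
    (\int[P]_(w in F E k) h (E w) = h c * P (E @^-1` [set c]))%E.
  move=> mE; rewrite FE; transitivity (\int[P]_(w in E @^-1` [set c]) h c)%E.
    by apply: eq_integral => w; rewrite inE => /= ->.
  by rewrite integral_cst//; exact: mE.
by rewrite !intc.
Qed.

End discrete_variables.

Section bounded_integrals.
Context {d : measure_display} {T : measurableType d} {R : realType}.
Variable P : probability T R.

Lemma bounded_integrable (f : T -> R) M : measurable_fun setT f -> (forall w, `|f w| <= M) ->
  P.-integrable setT (EFin \o f).
Proof.
move=> mf fM; apply: measurable_bounded_integrable => //.
  by rewrite /= probability_setT ltry.
exists M; split; first by rewrite num_real.
by move=> x Mx w _ /=; apply: le_trans (fM w) (ltW Mx).
Qed.

Lemma Rintegral_probability_cst (c : R) : \int[P]_w c = c.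
Proof. by rewrite Rintegral_cst//= probability_setT mulr1. Qed.

Lemma Rintegral_EFin (f : T -> R) : P.-integrable setT (EFin \o f) ->
  (\int[P]_w (f w)%:E)%E = (\int[P]_w f w)%:E.
Proof. by move=> fi; rewrite /Rintegral fineK//; exact: integrable_fin_num. Qed.

Lemma ler_normr_Rintegral (f g : T -> R) : P.-integrable setT (EFin \o f) ->
  P.-integrable setT (EFin \o g) -> (forall w, `|f w| <= g w) ->
  `|\int[P]_w f w| <= \int[P]_w g w.
Proof.
move=> fi gi fg; apply: le_trans (le_normr_Rintegral _ fi) _ => //.
by apply: le_Rintegral => //; exact: integrable_norm.
Qed.

Lemma ler_dist_Rintegral (f g : T -> R) e : P.-integrable setT (EFin \o f) ->
  P.-integrable setT (EFin \o g) -> (forall w, `|f w - g w| <= e) ->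
  `|\int[P]_w f w - \int[P]_w g w| <= e.
Proof.
move=> fi gi fg; rewrite -RintegralB// -[leRHS]Rintegral_probability_cst.
apply: ler_normr_Rintegral => //.
  exact: (integrableB measurableT fi gi).
by apply: (@bounded_integrable _ `|e|).
Qed.

Lemma bounded_Rintegral (f : T -> R) M : measurable_fun setT f -> (forall w, `|f w| <= M) ->
  `|\int[P]_w f w| <= M.
Proof.
move=> mf fM; rewrite -[leRHS]Rintegral_probability_cst; apply: ler_normr_Rintegral => //.
  exact: bounded_integrable fM.
by apply: (@bounded_integrable _ `|M|).
Qed.

End bounded_integrals.

Section bounded_fubini.
Context {d1 d2 : measure_display} {T1 : measurableType d1} {T2 : measurableType d2}.
Context {R : realType}.
Variables (P1 : probability T1 R) (P2 : probability T2 R).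
Variables (h : T1 * T2 -> R) (M : R).
Hypotheses (mh : measurable_fun setT h) (hM : forall z, `|h z| <= M).

Let hi : (P1 \x P2)%E.-integrable setT (EFin \o h).
Proof.
apply: measurable_bounded_integrable => //.
  rewrite [ltLHS](_ : _ = 1%E) ?ltry//.
  transitivity ((P1 \x P2)%E (setT `*` setT)); first by rewrite setXTT.
  by rewrite product_measure1E//= !probability_setT mule1.
exists M; split; first by rewrite num_real.
by move=> x Mx w _ /=; apply: le_trans (hM w) (ltW Mx).
Qed.

Let h1 x : measurable_fun setT (fun y => h (x, y)).
Proof. exact: measurableT_comp mh (pair1_measurable x). Qed.

Let h2 y : measurable_fun setT (fun x => h (x, y)).
Proof. exact: measurableT_comp mh (pair2_measurable y). Qed.

Lemma measurable_bounded_fubini1 : measurable_fun setT (fun x => \int[P2]_y h (x, y)).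
Proof.
apply/measurable_EFinP; have := measurable_fubini_F hi; apply: eq_measurable_fun => x _.
by rewrite /fubini_F /= Rintegral_EFin//; apply: (@bounded_integrable _ _ _ _ _ M).
Qed.

Lemma measurable_bounded_fubini2 : measurable_fun setT (fun y => \int[P1]_x h (x, y)).
Proof.
apply/measurable_EFinP; have := measurable_fubini_G hi; apply: eq_measurable_fun => y _.
by rewrite /fubini_G /= Rintegral_EFin//; apply: (@bounded_integrable _ _ _ _ _ M).
Qed.

Lemma bounded_fubini1 : \int[(P1 \x P2)%E]_z h z = \int[P1]_x \int[P2]_y h (x, y).
Proof.
rewrite {1 2}/Rintegral -(integral12_prod_meas1 hi); apply: (congr1 fine); apply: eq_integral => x _.
by rewrite -Rintegral_EFin//; apply: (@bounded_integrable _ _ _ _ _ M).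
Qed.

Lemma bounded_fubini : \int[P1]_x \int[P2]_y h (x, y) = \int[P2]_y \int[P1]_x h (x, y).
Proof.
rewrite -bounded_fubini1 {1 2}/Rintegral -(integral21_prod_meas1 hi).
apply: (congr1 fine); apply: eq_integral => y _.
by rewrite -Rintegral_EFin//; apply: (@bounded_integrable _ _ _ _ _ M).
Qed.

End bounded_fubini.

(** * Independent pairs and sums of independent discrete variables *)

Section independence.
Context {d : measure_display} {T : measurableType d} {R : realType}.
Variable P : probability T R.
Implicit Types (X Y : T -> R).

Definition independent_pair X Y : Prop := forall B C : set R, measurable B -> measurable C ->
  P (X @^-1` B `&` Y @^-1` C) = (P (X @^-1` B) * P (Y @^-1` C))%E.

Let rv X (mX : measurable_fun setT X) : {mfun T >-> R} :=
  HB.pack X (isMeasurableFun.Build _ _ _ _ _ mX).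

Lemma Rintegral_distribution X (mX : measurable_fun setT X) (f : R -> R) M :
  measurable_fun setT f -> (forall y, `|f y| <= M) ->
  \int[distribution P (rv mX)]_y f y = \int[P]_w f (X w).
Proof.
move=> mf fM; rewrite /Rintegral; apply: (congr1 fine); apply: (@integral_distribution _ _ _ _ _ P (rv mX) (EFin \o f)).
  exact/measurable_EFinP.
apply: (@bounded_integrable _ _ _ _ (f \o X) M); first exact: measurableT_comp mf mX.
by move=> w; exact: fM.
Qed.

Section pair_law.
Variables (X Y : T -> R).
Hypotheses (mX : measurable_fun setT X) (mY : measurable_fun setT Y).
Hypothesis XY : independent_pair X Y.

Let mZ : measurable_fun setT (fun w => (X w, Y w)).
Proof. exact: measurable_fun_pair. Qed.

Let Z : {mfun T >-> (R * R)%type} := HB.pack (fun w => (X w, Y w)) (isMeasurableFun.Build _ _ _ _ _ mZ).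

Let law_pair S : measurable S ->
  (distribution P (rv mX) \x distribution P (rv mY))%E S = distribution P Z S.
Proof. by apply: product_measure_unique => B C mB mC; exact: XY. Qed.

Lemma independent_integral (h : R * R -> \bar R) :
  measurable_fun setT h -> (forall z, 0 <= h z)%E ->
  (\int[P]_w h (X w, Y w) = \int[P]_w \int[P]_v h (X w, Y v))%E.
Proof.
move=> mh h0.
transitivity (\int[distribution P Z]_z h z)%E.
  by rewrite ge0_integral_distribution.
transitivity (\int[(distribution P (rv mX) \x distribution P (rv mY))%E]_z h z)%E.
  by apply: eq_measure_integral => S mS _; exact/esym/law_pair.
rewrite fubini_tonelli1// ge0_integral_distribution//.
- apply: eq_integral => w _ /=; rewrite /fubini_F ge0_integral_distribution//.
  exact: measurableT_comp mh (pair1_measurable _).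
- exact: measurable_fun_fubini_tonelli_F.
- by move=> y; apply: integral_ge0.
Qed.

Lemma independent_bounded_integral (h : R * R -> R) M :
  measurable_fun setT h -> (forall z, `|h z| <= M) ->
  \int[P]_w h (X w, Y w) = \int[P]_w \int[P]_v h (X w, Y v).
Proof.
move=> mh hM.
transitivity (\int[distribution P Z]_z h z).
  rewrite /Rintegral; apply: (congr1 fine); apply/esym.
  apply: (@integral_distribution _ _ _ _ _ P Z (EFin \o h)); first exact/measurable_EFinP.
  apply: (@bounded_integrable _ _ _ _ (h \o Z) M); first exact: measurableT_comp mh mZ.
  by move=> w; exact: hM.
transitivity (\int[(distribution P (rv mX) \x distribution P (rv mY))%E]_z h z).
  rewrite /Rintegral; apply: (congr1 fine).
  by apply: eq_measure_integral => S mS _; exact/esym/law_pair.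
rewrite (bounded_fubini1 _ _ mh hM) (@Rintegral_distribution _ _ _ M).
- apply: eq_Rintegral => w _; apply: (@Rintegral_distribution _ _ _ M) => //.
  exact: measurableT_comp mh (pair1_measurable _).
- exact: (@measurable_bounded_fubini1 _ _ _ _ _ (distribution P (rv mX)) (distribution P (rv mY)) h M).
- move=> y; apply: bounded_Rintegral => // .
  exact: measurableT_comp mh (pair1_measurable _).
Qed.

End pair_law.

Section independent_discrete_sums.
Context {C : countType} {A : finType}.
Variable D : A -> T -> C.
Hypothesis mD : forall a, discrete_variable (D a).

Definition independent_discrete : Prop := forall B : A -> set C,
  P [set w | forall a, B a (D a w)] = (\prod_a P (D a @^-1` B a))%E.

Hypothesis indD : independent_discrete.

Lemma countable_independence (C' : countType) (K : T -> C') (G : set T) :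
  discrete_variable K -> measurable G ->
  (forall k, P (K @^-1` [set k] `&` G) = (P (K @^-1` [set k]) * P G)%E) ->
  forall B, P (K @^-1` B `&` G) = (P (K @^-1` B) * P G)%E.
Proof.
move=> mK mG KG B.
pose F n := [set w | choice.pickle (K w) = n] `&` (K @^-1` B).
have mF n : measurable (F n).
  apply: measurableI; last exact: discrete_measurable_preimage.
  exact: (discrete_measurable_preimage [set c | choice.pickle c = n] mK).
have tF : trivIset setT F by move=> i j _ _ [w [[/= <- _] [/= <- _]]].
have FB : K @^-1` B = \bigcup_n F n.
  by apply/seteqP; split=> [w Bw|w [n _ []]//]; exists (choice.pickle (K w)).
rewrite FB setI_bigcupl measure_bigcup; last 2 first.
- by move=> n _; apply: measurableI.
- by move=> i j _ _ [w [[Fi _] [Fj _]]]; apply: (tF i j) => //; exists w.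
rewrite measure_bigcup//.
rewrite -[X in _ = (_ * X)%E](@fineK _ (P G)) ?fin_num_measure// muleC -nneseriesZl//.
apply: eq_eseriesr => n _; rewrite fineK ?fin_num_measure// muleC.
have [[k kn]|nk] := pselect (exists k, choice.pickle k = n /\ B k); last first.
  rewrite (_ : F n = set0) ?set0I ?measure0 ?mul0e//.
  by apply/seteqP; split=> // w [/= Kn Bw]; apply: nk; exists (K w).
have -> : F n = K @^-1` [set k].
  case: kn => kn Bk; apply/seteqP; split=> w; rewrite /F /preimage /=.
    by rewrite -kn => -[/(pcan_inj choice.pickleK)].
  by move=> ->.
exact: KG.
Qed.

Variable f : A -> C -> R.

Let X a w := f a (D a w).

Lemma measurable_discrete_sum s : measurable_fun setT (fun w => \sum_(b <- s) X b w).
Proof. by apply: measurable_sum => a; exact: measurable_fun_discrete. Qed.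

(** The sum is a function of the tuple [K] of the values [D b], [b] in [s]. On an atom of [K],
    independence from [D a] is an instance of [independent_discrete] with [setT] for the remaining
    letters; countably many atoms make up any event about the sum. *)
Lemma independent_discrete_sum s a : uniq s -> a \notin s ->
  independent_pair (fun w => \sum_(b <- s) X b w) (X a).
Proof.
move=> us as' B B' mB mB'.
pose K w := [seq D b w | b <- s].
have c0 (w : T) : C := D a w.
pose F (k : seq C) := \sum_(i <- zip s k) f i.1 i.2.
have SE w : \sum_(b <- s) X b w = F (K w).
  rewrite /F /K; elim: (s) => [|b s' IH] /=; first by rewrite !big_nil.
  by rewrite !big_cons IH.
have mK : discrete_variable K.
  move=> k; rewrite /K; elim: (s) k => [|b s' IH] [|c k].
  - by rewrite (_ : _ @^-1` _ = setT)//; apply/seteqP; split.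
  - by rewrite (_ : _ @^-1` _ = set0)//; apply/seteqP; split.
  - by rewrite (_ : _ @^-1` _ = set0)//; apply/seteqP; split.
  rewrite (_ : _ @^-1` _ = D b @^-1` [set c] `&` (fun w => [seq D b w | b <- s']) @^-1` [set k]).
    by apply: measurableI; [exact: mD|exact: IH].
  by apply/seteqP; split=> w /= => [[-> ->]//|[/= -> ->]].
pose G := D a @^-1` (f a @^-1` B').
have mG : measurable G by exact: discrete_measurable_preimage.
have -> : X a @^-1` B' = G by [].
rewrite (_ : (fun w => _) @^-1` B = K @^-1` (F @^-1` B)); last first.
  by apply/seteqP; split=> w; rewrite /preimage /= SE.
apply: countable_independence => // k.
have [sk|sk] := eqVneq (size k) (size s); last first.
  rewrite (_ : K @^-1` _ = set0) ?set0I ?measure0 ?mul0e//.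
  by apply/seteqP; split=> // w /= Kk; move: sk; rewrite -Kk size_map eqxx.
case: s us as' @K @F SE mK sk => [|b0 s'] us as' K F SE mK sk.
  rewrite (_ : K @^-1` _ = setT) ?setTI ?probability_setT ?mul1e//.
  by apply/seteqP; split=> // w _; rewrite /K /=; case: k sk.
set s := b0 :: s' in us as' K F SE mK sk *.
case: k sk => [//|k0 k'] sk; set k := k0 :: k' in sk *.
pose BB b := if b \in s then [set nth k0 k (index b s)] else setT.
have KE : K @^-1` [set k] = [set w | forall b, BB b (D b w)].
  apply/seteqP; split=> w /=.
    move=> Kk b; rewrite /BB; case: ifP => // bs.
    suff: D b w = nth k0 k (index b s) by [].
    by rewrite -Kk /K (nth_map b) ?index_mem// nth_index.
  move=> h; apply: (@eq_from_nth _ k0); first by rewrite size_map.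
  move=> i; rewrite size_map => si; rewrite (nth_map b0)//.
  by have := h (nth b0 s i); rewrite /BB mem_nth// index_uniq.
have KGE : K @^-1` [set k] `&` G = [set w | forall b, (if b == a then f a @^-1` B' else BB b) (D b w)].
  rewrite KE; apply/seteqP; split=> w /= => [[h Gw] b|h].
    by case: eqP => [->//|_].
  split; last by have := h a; rewrite eqxx.
  move=> b; have := h b; case: eqP => // -> _; by rewrite /BB (negbTE as').
rewrite KGE KE (indD (fun b => if b == a then f a @^-1` B' else BB b)) (indD BB).
have BBa : BB a = setT by rewrite /BB (negbTE as').
rewrite [LHS](bigD1 a)//= [X in _ = (X * _)%E](bigD1 a)//= BBa preimage_setT probability_setT mul1e.
rewrite eqxx muleC; congr (_ * _)%E.
by apply: eq_bigr => b /negbTE ->.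
Qed.

End independent_discrete_sums.

End independence.

(** * Gaussian laws *)

Section density.
Context {d : measure_display} {T : measurableType d} {R : realType}.
Variables (mu nu : {measure set T -> \bar R}) (h : T -> R).
Hypotheses (mh : measurable_fun setT h) (h0 : forall x, 0 <= h x).
Hypothesis nuE : forall B, measurable B -> nu B = (\int[mu]_(x in B) (h x)%:E)%E.

Import HBNNSimple.

Let ge0_integral_density_nnsfun (g : {nnsfun T >-> R}) :
  (\int[nu]_x (g x)%:E = \int[mu]_x (g x * h x)%:E)%E.
Proof.
have mgk (k : R) : measurable (g @^-1` [set k]) by [].
under [LHS]eq_integral do rewrite fimfunE -fsumEFin//.
rewrite [LHS]ge0_integral_fsum//; last 2 first.
  - by move=> r; exact/measurable_EFinP/measurableT_comp.
  - by move=> n x _; rewrite EFinM nnfun_muleindic_ge0.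
under [RHS]eq_integral.
  move=> x xD; rewrite EFinM fimfunE -fsumEFin// ge0_mule_fsuml; last first.
    by move=> r; rewrite EFinM nnfun_muleindic_ge0.
  over.
rewrite [RHS]ge0_integral_fsum//; last 2 first.
  - move=> r; apply: emeasurable_funM; last exact/measurable_EFinP.
    by apply/measurable_EFinP; exact: measurableT_comp.
  - by move=> n x _; rewrite EFinM mule_ge0 ?nnfun_muleindic_ge0// lee_fin.
apply: eq_fsbigr => r _; rewrite integralZl_indic_nnsfun// integral_indic// setIT nuE//.
have [r0|r0] := ltP r 0.
  rewrite preimage_nnfun0// integral_set0 mule0 integral0_eq// => x _.
  by rewrite indic0 mulr0 mul0e.
under [RHS]eq_integral do rewrite EFinM -muleA.
rewrite ge0_integralZl//; last 2 first.
  - apply: emeasurable_funM; last exact/measurable_EFinP.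
    by apply/measurable_EFinP; exact: measurable_indic.
  - by move=> x _; rewrite mule_ge0// lee_fin.
congr (_ * _)%E; rewrite integral_mkcond; apply: eq_integral => x _.
by rewrite patchE indicE; case: ifP; rewrite ?mul1e ?mul0e.
Qed.

Lemma ge0_integral_density (f : T -> \bar R) : measurable_fun setT f -> (forall x, 0 <= f x)%E ->
  (\int[nu]_x f x = \int[mu]_x (f x * (h x)%:E))%E.
Proof.
move=> mf f0; pose f_ := nnsfun_approx measurableT mf.
transitivity (limn (fun n => \int[nu]_x (f_ n x)%:E)%E).
  rewrite -monotone_convergence//=.
  - apply: eq_integral => x /[!inE] xD; apply/esym/cvg_lim => //=.
    exact: cvg_nnsfun_approx.
  - by move=> n; apply: measurableT_comp => //; exact: measurable_funTS.
  - by move=> n x _; rewrite lee_fin.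
  - by move=> x _ a b ab; rewrite lee_fin//; exact/lefP/nd_nnsfun_approx.
rewrite [RHS](_ : _ = limn (fun n => \int[mu]_x (f_ n x * h x)%:E)%E).
  by congr (limn _); apply/funext => n; exact: ge0_integral_density_nnsfun.
rewrite -monotone_convergence//=.
- apply: eq_integral => x /[!inE] xD; apply/esym/cvg_lim => //=.
  under eq_fun do rewrite EFinM.
  apply: cvgeZr => //; exact: cvg_nnsfun_approx.
- by move=> n; apply/measurable_EFinP; apply: measurable_funM.
- by move=> n x _; rewrite lee_fin mulr_ge0.
- move=> x _ a b ab; rewrite lee_fin ler_wpM2r//; exact/lefP/nd_nnsfun_approx.
Qed.

End density.

Section gaussian.
Context {R : realType}.
Local Notation mu := (@lebesgue_measure R).
Implicit Types (s t v x y z : R).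

Lemma ge0_integral_normal_prob m s (f : R -> \bar R) : measurable_fun setT f -> (forall x, 0 <= f x)%E ->
  (\int[normal_prob m s]_x f x = \int[mu]_x (f x * (normal_pdf m s x)%:E))%E.
Proof.
move=> mf f0; apply: ge0_integral_density => //.
  exact: measurable_normal_pdf.
by move=> x; exact: normal_pdf_ge0.
Qed.

Definition gauss_pdf v x : R := normal_pdf 0 (Num.sqrt v) x.

Lemma measurable_gauss_pdf v : measurable_fun setT (gauss_pdf v).
Proof. exact: measurable_normal_pdf. Qed.

Lemma gauss_pdf_ge0 v x : 0 <= gauss_pdf v x.
Proof. exact: normal_pdf_ge0. Qed.

Lemma normal_pdf_sqrt m v x : 0 < v ->
  normal_pdf m (Num.sqrt v) x = (Num.sqrt (v * pi *+ 2))^-1 * expR (- (x - m) ^+ 2 / (v *+ 2)).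
Proof.
move=> v0; rewrite normal_pdfE ?gt_eqF ?sqrtr_gt0// /normal_peak /normal_fun.
by rewrite sqr_sqrtr// ltW.
Qed.

Let measurable_idR : measurable_fun setT (fun x : measurableTypeR R => x : R).
Proof. by move=> _ B mB; rewrite setTI. Qed.

Let idR : {mfun measurableTypeR R >-> R} := HB.pack (fun x : measurableTypeR R => x : R)
  (isMeasurableFun.Build _ _ _ _ _ measurable_idR).

(* [centered_normal v] is a measure on [measurableTypeR R], whose display
   differs from the one of the canonical measurable structure of [R]. *)
Definition gauss v : probability R R := distribution (centered_normal v) idR.

Lemma gauss_neg v : v <= 0 -> gauss v = gauss 0.
Proof. by move=> v0; rewrite /gauss /centered_normal ltxx ltNge v0. Qed.

Lemma ge0_integral_gauss v (f : R -> \bar R) : 0 < v ->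
  measurable_fun setT f -> (forall x, 0 <= f x)%E ->
  (\int[gauss v]_x f x = \int[mu]_x (f x * (gauss_pdf v x)%:E))%E.
Proof.
move=> v0 mf f0; rewrite ge0_integral_distribution//.
by rewrite /centered_normal v0 ge0_integral_normal_prob.
Qed.

Lemma ge0_integral_gauss0 v (f : R -> \bar R) : v <= 0 -> measurable_fun setT f ->
  (forall x, 0 <= f x)%E -> (\int[gauss v]_x f x = f 0%R)%E.
Proof.
move=> v0 mf f0; rewrite ge0_integral_distribution//.
by rewrite /centered_normal ltNge v0 /= integral_dirac//= diracT mul1e.
Qed.

Lemma Rintegral_centered_normal v (f : R -> R) : measurable_fun setT f ->
  (gauss v).-integrable setT (EFin \o f) ->
  has_mean (centered_normal v) f /\ mean (centered_normal v) f = \int[gauss v]_x f x.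
Proof.
move=> mf fi; have mfE : measurable_fun setT (EFin \o f) by exact/measurable_EFinP.
have fi' : (centered_normal v).-integrable setT ((EFin \o f) \o idR).
  apply/integrableP; split; first exact: measurableT_comp mfE measurable_idR.
  have /integrableP[_] := fi; rewrite ge0_integral_distribution//.
  by apply: measurableT_comp.
split=> //; rewrite /mean /Rintegral unlock.
by rewrite (@integral_distribution _ _ _ _ _ (centered_normal v) idR (EFin \o f)).
Qed.

#[local] Opaque gauss.

(** Completing the square turns [expR (t * x)] times the density into a constant times the normal
    density of mean [t * v]. The moments of [gauss v] below are all obtained from this formula. *)
Lemma gauss_mgf v t : 0 <= v ->
  (\int[gauss v]_x (expR (t * x))%:E = (expR (t ^+ 2 * v / 2))%:E)%E.
Proof.
move=> v0.
have me : measurable_fun setT (fun x : R => (expR (t * x))%:E).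
  apply/measurable_EFinP; apply: (measurableT_comp (@measurable_expR R)).
  exact: mulrl_measurable.
move: v0; rewrite le_eqVlt => /predU1P[<-|v0].
  by rewrite ge0_integral_gauss0// mulr0 mulr0 mul0r.
rewrite ge0_integral_gauss//.
transitivity (\int[mu]_x ((expR (t ^+ 2 * v / 2))%:E * (normal_pdf (t * v) (Num.sqrt v) x)%:E))%E.
  apply: eq_integral => x _; rewrite -!EFinM; congr (_%:E).
  rewrite /gauss_pdf !normal_pdf_sqrt// mulrCA [RHS]mulrCA -!expRD; congr (_ * expR _).
  by field; rewrite gt_eqF.
rewrite ge0_integralZl//; last 2 first.
- by apply/measurable_EFinP; exact: measurable_normal_pdf.
- by move=> x _; rewrite lee_fin normal_pdf_ge0.
by rewrite integral_normal_pdf mule1.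
Qed.

(** Bayes' formula for two independent Gaussians of variances [s] and [t]: the second factor on the
    right is the density of the first summand given that the sum is [z]. *)
Lemma gauss_pdf_convolution s t x z : 0 < s -> 0 < t ->
  gauss_pdf t (z - x) * gauss_pdf s x =
  gauss_pdf (s + t) z * normal_pdf (z * s / (s + t)) (Num.sqrt (s * t / (s + t))) x.
Proof.
move=> s0 t0; have st0 : 0 < s + t by exact: addr_gt0.
have q0 : 0 < s * t / (s + t) by rewrite divr_gt0// mulr_gt0.
rewrite /gauss_pdf !normal_pdf_sqrt// mulrACA [RHS]mulrACA -!expRD -!invfM -!sqrtrM; last 2 first.
- by rewrite mulrn_wge0// mulr_ge0 ?pi_ge0// ltW.
- by rewrite mulrn_wge0// mulr_ge0 ?pi_ge0// ltW.
congr ((Num.sqrt _)^-1 * expR _).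
  by field; rewrite gt_eqF.
by field; rewrite !gt_eqF.
Qed.

Lemma ge0_integral_translation x (G : R -> R) : continuous G -> (forall z, 0 <= G z) ->
  (\int[mu]_y (G (x + y))%:E = \int[mu]_z (G z)%:E)%E.
Proof.
move=> cG G0; pose F (y : R^o) : R^o := x + y.
have F'E : F^`()%classic = cst 1.
  apply/funext => y; rewrite /F derive1E deriveD// derive_cst add0r.
  by rewrite derive_id.
rewrite (@increasing_ge0_integration_by_substitutionT _ F G)//.
- by apply: eq_integral => y _; rewrite F'E /= mulr1.
- by move=> a b ab; rewrite /F ltrD2l.
- by rewrite F'E => ?; exact: cvg_cst.
- by rewrite F'E; exact: is_cvg_cst.
- by rewrite F'E; exact: is_cvg_cst.
- exact: cvg_addrl_Ny.
- exact: cvg_addrl.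
Qed.

Lemma continuous_gauss_pdf v : 0 < v -> continuous (gauss_pdf v).
Proof. by move=> v0; apply: continuous_normal_pdf; rewrite gt_eqF// sqrtr_gt0. Qed.

Lemma measurable_add2 (f : R -> R) : measurable_fun setT f ->
  measurable_fun setT (fun w : R * R => f (w.1 + w.2)).
Proof.
move=> mf; apply: measurableT_comp => //.
by apply: measurable_funD; [exact: measurable_fst|exact: measurable_snd].
Qed.

Lemma measurable_ge0_shift_integral t (f : R -> R) : measurable_fun setT f -> (forall x, 0 <= f x) ->
  measurable_fun setT (fun x : R => \int[gauss t]_y (f (x + y))%:E)%E.
Proof.
move=> mf f0; apply: (@measurable_fun_fubini_tonelli_F _ _ _ _ _ (gauss t) (fun w : R * R => (f (w.1 + w.2))%:E)).
  by apply/measurable_EFinP; exact: measurable_add2.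
by move=> w; rewrite lee_fin.
Qed.

(** After a translation and Tonelli's theorem the integrand is that of [gauss_pdf_convolution],
    whose conditional factor integrates to 1. A zero variance has no density and is treated apart,
    as a point mass. *)
Lemma gauss_semigroup_ge0 s t (f : R -> R) : 0 <= s -> 0 <= t -> continuous f -> (forall x, 0 <= f x) ->
  (\int[gauss s]_x \int[gauss t]_y (f (x + y))%:E =
   \int[gauss (s + t)]_z (f z)%:E)%E.
Proof.
move=> s0 t0 cf f0.
have mf : measurable_fun setT f by exact: continuous_measurable_fun.
have mfx x : measurable_fun setT (fun y => f (x + y)).
  by apply: measurableT_comp => //; exact: measurable_funD.
have mfE : measurable_fun setT (EFin \o f) by exact/measurable_EFinP.
have mI := measurable_ge0_shift_integral t mf f0.
have I0 x : (0 <= \int[gauss t]_y (f (x + y))%:E)%E.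
  by apply: integral_ge0 => y _; rewrite lee_fin.
move: t0 mI I0; rewrite le_eqVlt => /predU1P[<-|t0] mI I0.
  rewrite addr0; apply: eq_integral => x _.
  have mx : measurable_fun setT (fun y => (f (x + y))%:E) by exact/measurable_EFinP.
  by rewrite ge0_integral_gauss0 ?addr0// => y; rewrite lee_fin.
move: s0; rewrite le_eqVlt => /predU1P[<-|s0].
  rewrite (add0r t); apply: etrans (ge0_integral_gauss0 (lexx 0) mI I0) _.
  by apply: eq_integral => y _; rewrite add0r.
have st0 : 0 < s + t by exact: addr_gt0.
have shift_pdf x : (\int[mu]_y (f (x + y) * gauss_pdf t y)%:E = \int[mu]_z (f z * gauss_pdf t (z - x))%:E)%E.
  rewrite -(@ge0_integral_translation x (fun z => f z * gauss_pdf t (z - x))).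
  - by apply: eq_integral => y _; rewrite addrAC subrr add0r.
  - move=> z; apply: cvgM; first exact: cf.
    apply: (cvg_comp (fun z => z - x) (gauss_pdf t)); last exact: continuous_gauss_pdf.
    by apply: (@cvgB _ R^o) => //; exact: cvg_cst.
  - by move=> z; rewrite mulr_ge0// gauss_pdf_ge0.
pose k (w : R * R) := f w.2 * gauss_pdf t (w.2 - w.1) * gauss_pdf s w.1.
have mk : measurable_fun setT (EFin \o k).
  apply/measurable_EFinP; apply: measurable_funM.
    apply: measurable_funM; first exact: measurableT_comp mf measurable_snd.
    apply: measurableT_comp; first exact: measurable_gauss_pdf.
    by apply: measurable_funB; [exact: measurable_snd|exact: measurable_fst].
  exact: measurableT_comp (measurable_gauss_pdf s) measurable_fst.
have k0 w : (0 <= (EFin \o k) w)%E by rewrite lee_fin !mulr_ge0// gauss_pdf_ge0.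
transitivity (\int[mu]_x \int[mu]_z (k (x, z))%:E)%E.
  apply: etrans (ge0_integral_gauss s0 mI I0) _.
  apply: eq_integral => x _.
  rewrite ge0_integral_gauss//; last 2 first.
    exact/measurable_EFinP.
    by move=> y; rewrite lee_fin.
  under eq_integral do rewrite -EFinM.
  rewrite shift_pdf -ge0_integralZr//; last 3 first.
  - apply/measurable_EFinP; apply: measurable_funM => //.
    apply: measurableT_comp; first exact: measurable_gauss_pdf.
    exact: measurable_funB.
  - by move=> z _; rewrite lee_fin mulr_ge0// gauss_pdf_ge0.
  - by rewrite lee_fin gauss_pdf_ge0.
have mk' : measurable_fun [set: (measurableTypeR R * measurableTypeR R)%type] (EFin \o k) by exact: mk.
rewrite (@fubini_tonelli _ _ _ _ _ mu mu _ mk' k0).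
rewrite ge0_integral_gauss//.
apply: eq_integral => z _.
transitivity (\int[mu]_x ((f z * gauss_pdf (s + t) z)%:E *
   (normal_pdf (z * s / (s + t)) (Num.sqrt (s * t / (s + t))) x)%:E))%E.
  apply: eq_integral => x _; rewrite -EFinM; congr (_%:E).
  by rewrite /k /= -mulrA gauss_pdf_convolution// mulrA.
rewrite ge0_integralZl//.
- by rewrite integral_normal_pdf mule1 EFinM.
- by apply/measurable_EFinP; exact: measurable_normal_pdf.
- by move=> x _; rewrite lee_fin normal_pdf_ge0.
- by rewrite lee_fin mulr_ge0// gauss_pdf_ge0.
Qed.

Lemma gauss_semigroup s t (f : R -> R) M : 0 <= s -> 0 <= t -> continuous f ->
  (forall x, `|f x| <= M) ->
  \int[gauss s]_x \int[gauss t]_y f (x + y) = \int[gauss (s + t)]_z f z.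
Proof.
move=> s0 t0 cf fM.
have mf : measurable_fun setT f by exact: continuous_measurable_fun.
have mfx x : measurable_fun setT (fun y => f (x + y)).
  by apply: measurableT_comp => //; exact: measurable_funD.
have M0 x : 0 <= f x + M by rewrite -lerBlDr sub0r; have := fM x; rewrite ler_norml => /andP[].
have cfM : continuous (fun x => f x + M).
  by move=> x; apply: cvgD; [exact: cf|exact: cvg_cst].
have fi u x : (gauss u).-integrable setT (EFin \o (fun y => f (x + y))).
  exact: (@bounded_integrable _ _ _ _ _ M).
have fi0 u : (gauss u).-integrable setT (EFin \o f) by exact: (@bounded_integrable _ _ _ _ _ M).
have ci u : (gauss u).-integrable setT (EFin \o cst M).
  exact: (@bounded_integrable _ _ _ _ _ `|M|).
have mI : measurable_fun setT (fun x => \int[gauss t]_y f (x + y)).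
  apply: (@measurable_bounded_fubini1 _ _ _ _ _ (gauss s) (gauss t) (fun w : R * R => f (w.1 + w.2)) M) => //.
  exact: measurable_add2.
have Ii : (gauss s).-integrable setT (EFin \o (fun x => \int[gauss t]_y f (x + y))).
  by apply: (@bounded_integrable _ _ _ _ _ M) => // x; exact: bounded_Rintegral.
have innerE x : (\int[gauss t]_y (f (x + y) + M)%:E = (\int[gauss t]_y f (x + y) + M)%:E)%E.
  rewrite Rintegral_EFin.
    by rewrite (RintegralD measurableT (fi t x) (ci t)) Rintegral_probability_cst.
  exact: (integrableD measurableT (fi t x) (ci t)).
have E1 : (\int[gauss s]_x \int[gauss t]_y (f (x + y) + M)%:E =
    \int[gauss s]_x (\int[gauss t]_y f (x + y) + M)%:E)%E.
  by apply: eq_integral => x _; exact: innerE.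
have E2 : (\int[gauss s]_x (\int[gauss t]_y f (x + y) + M)%:E =
    (\int[gauss s]_x (\int[gauss t]_y f (x + y) + M))%:E)%E.
  apply: Rintegral_EFin; exact: (integrableD measurableT Ii (ci s)).
have E3 : (\int[gauss (s + t)]_z (f z + M)%:E = (\int[gauss (s + t)]_z (f z + M))%:E)%E.
  apply: Rintegral_EFin; exact: (integrableD measurableT (fi0 _) (ci _)).
have : \int[gauss s]_x (\int[gauss t]_y f (x + y) + M) = \int[gauss (s + t)]_z (f z + M).
  apply: EFin_inj; apply: etrans (esym E2) _; apply: etrans (esym E1) _.
  exact: etrans (gauss_semigroup_ge0 s0 t0 cfM M0) E3.
have e1 : \int[gauss s]_x (\int[gauss t]_y f (x + y) + M) = \int[gauss s]_x \int[gauss t]_y f (x + y) + M.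
  by apply: etrans (RintegralD measurableT Ii (ci s)) _; congr (_ + _); exact: Rintegral_probability_cst.
have e2 : \int[gauss (s + t)]_z (f z + M) = \int[gauss (s + t)]_z f z + M.
  by apply: etrans (RintegralD measurableT (fi0 _) (ci _)) _; congr (_ + _); exact: Rintegral_probability_cst.
by move=> e3; apply: (addIr M); exact: etrans (esym e1) (etrans e3 e2).
Qed.

Lemma gauss_exp_integrable v t : 0 <= v ->
  (gauss v).-integrable setT (EFin \o (fun x : R => expR (t * x))).
Proof.
move=> v0; apply/integrableP; split.
  apply/measurable_EFinP; apply: (measurableT_comp (@measurable_expR R)).
  exact: mulrl_measurable.
under eq_integral do rewrite /= ger0_norm ?expR_ge0//.
by rewrite gauss_mgf// ltry.
Qed.

Lemma gauss_mgfR v t : 0 <= v -> \int[gauss v]_x expR (t * x) = expR (t ^+ 2 * v / 2).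
Proof. by move=> v0; rewrite /Rintegral gauss_mgf. Qed.

Lemma expR_abs_le t x : expR `|t * x| <= expR (t * x) + expR (- t * x).
Proof.
have [tx|tx] := leP 0 (t * x); first by rewrite ger0_norm// lerDl expR_ge0.
by rewrite ltr0_norm// mulNr lerDr expR_ge0.
Qed.

Lemma gauss_integrable_dominated v t C (f : R -> R) : 0 <= v -> measurable_fun setT f ->
  (forall x, `|f x| <= C * expR `|t * x|) ->
  (gauss v).-integrable setT (EFin \o f) /\
  \int[gauss v]_x `|f x| <= C * 2 * expR (t ^+ 2 * v / 2).
Proof.
move=> v0 mf fC.
have C0 : 0 <= C.
  by have := le_trans (normr_ge0 _) (fC 0); rewrite mulr0 normr0 expR0 mulr1.
have gi : (gauss v).-integrable setT (EFin \o (fun x => C * (expR (t * x) + expR (- t * x)))).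
  have := integrableZl measurableT C (integrableD measurableT
    (gauss_exp_integrable t v0) (gauss_exp_integrable (- t) v0)).
  by apply: eq_integrable => // x _.
have fg x : `|f x| <= C * (expR (t * x) + expR (- t * x)).
  by apply: le_trans (fC x) _; rewrite ler_wpM2l// expR_abs_le.
have fi : (gauss v).-integrable setT (EFin \o f).
  apply: le_integrable gi => //; first exact/measurable_EFinP.
  by move=> x _ /=; rewrite lee_fin; apply: le_trans (fg x) (ler_norm _).
split=> //; apply: le_trans (_ : \int[gauss v]_x (C * (expR (t * x) + expR (- t * x))) <= _).
  by apply: le_Rintegral => //; exact: integrable_norm.
rewrite RintegralZl//; last first.
  exact: (integrableD measurableT (gauss_exp_integrable t v0) (gauss_exp_integrable (- t) v0)).
rewrite (RintegralD measurableT (gauss_exp_integrable t v0) (gauss_exp_integrable (- t) v0)).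
rewrite !gauss_mgfR// sqrrN [leLHS](_ : _ = C * 2 * expR (t ^+ 2 * v / 2))//; ring.
Qed.

(** The [r]-th power of [u <= r * expR (u / r)]. *)
Lemma powR_le_expR (r u : R) : 0 < r -> 0 <= u -> u `^ r <= r `^ r * expR u.
Proof.
move=> r0 u0.
have ur : u <= r * expR (u / r).
  rewrite -ler_pdivrMl// mulrC; apply: le_trans (expR_ge1Dx _); by rewrite lerDr.
apply: (@le_trans _ _ ((r * expR (u / r)) `^ r)).
  by apply: ge0_ler_powR => //; rewrite ?nnegrE ?(ltW r0)// mulr_ge0 ?expR_ge0// ltW.
by rewrite powRM ?expR_ge0 ?(ltW r0)// -expRM divfK// gt_eqF.
Qed.

(** With [t = 1 / sqrt v] the exponent [t ^ 2 * v / 2] of the moment generating function equals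
    [1 / 2] whatever [v], so the constant is uniform and only the scale [v ^ (r / 2)] remains. *)
Lemma gauss_moment (r : R) : 0 < r -> exists2 C, 0 <= C & forall v, 0 <= v ->
  (gauss v).-integrable setT (EFin \o (fun x : R => `|x| `^ r)) /\
  \int[gauss v]_x (`|x| `^ r) <= C * v `^ (r / 2).
Proof.
move=> r0; exists (r `^ r * 2 * expR 1); first by rewrite !mulr_ge0// ?powR_ge0 ?expR_ge0.
have mr : measurable_fun setT (fun x : R => `|x| `^ r).
  by apply: (measurableT_comp (measurable_powR r)); exact: normr_measurable.
move=> v; rewrite le_eqVlt => /predU1P[<-|v0].
  have z0 : (\int[gauss 0]_x (`|x| `^ r)%:E = 0)%E.
    rewrite ge0_integral_gauss0//; first by rewrite normr0 powR0// gt_eqF.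
    exact/measurable_EFinP.
  split; last by rewrite /Rintegral z0 /= mulr_ge0// ?powR_ge0// !mulr_ge0// ?powR_ge0 ?expR_ge0.
  apply/integrableP; split; first exact/measurable_EFinP.
  by under eq_integral do rewrite /= ger0_norm ?powR_ge0//; rewrite z0 ltry.
have sv0 : 0 < Num.sqrt v by rewrite sqrtr_gt0.
have vr : v `^ (r / 2) = Num.sqrt v `^ r.
  by rewrite -{1}(sqr_sqrtr (ltW v0)) -powR_mulrn ?sqrtr_ge0// -powRrM mulrCA divff ?mulr1.
have [] := @gauss_integrable_dominated v (Num.sqrt v)^-1 (r `^ r * Num.sqrt v `^ r) _ (ltW v0) mr.
  move=> x; rewrite ger0_norm ?powR_ge0// normrM [X in _ * expR (X * _)]ger0_norm ?invr_ge0 ?sqrtr_ge0//.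
  have {1}-> : `|x| = Num.sqrt v * ((Num.sqrt v)^-1 * `|x|) by rewrite mulrA divff ?mul1r// gt_eqF.
  have u0 : 0 <= (Num.sqrt v)^-1 * `|x| by rewrite mulr_ge0// invr_ge0 sqrtr_ge0.
  rewrite powRM ?sqrtr_ge0// [leRHS]mulrAC [leRHS]mulrC ler_wpM2l ?powR_ge0//.
  exact: powR_le_expR.
move=> i1 i2; split=> //.
rewrite (@eq_Rintegral _ _ _ _ _ (fun x => `| `|x| `^ r|)); last first.
  by move=> x _; rewrite (ger0_norm (powR_ge0 _ _)).
apply: le_trans i2 _; rewrite vr exprVn sqr_sqrtr ?(ltW v0)// mulVf ?gt_eqF//.
rewrite [leLHS](_ : _ = r `^ r * 2 * Num.sqrt v `^ r * expR (1 / 2)); last by ring.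
rewrite [leRHS](_ : _ = r `^ r * 2 * Num.sqrt v `^ r * expR 1); last by ring.
by rewrite ler_wpM2l ?mulr_ge0 ?powR_ge0// ler_expR; lra.
Qed.

Lemma expR_sub1_le (u : R) : expR u - 1 <= u * expR u.
Proof.
have := expR_ge1Dx (- u); rewrite expRN => h.
have e0 := expR_gt0 u.
have : (1 + - u) * expR u <= 1 by rewrite -ler_pdivlMr// div1r.
by rewrite mulrDl mul1r mulNr; lra.
Qed.

Lemma expR_second_difference (u : R) :
  `|expR u + expR (- u) - 2 - u ^+ 2| <= `|u| ^+ 3 * expR `|u|.
Proof.
wlog u0 : u / 0 <= u.
  move=> h; have [u0|u0] := leP 0 u; first exact: h.
  have := h (- u); rewrite oppr_ge0 ltW// => /(_ isT).
  by rewrite opprK sqrrN normrN [expR (- u) + _]addrC.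
(* This factorisation reduces the estimate to [u <= expR u - 1 <= u * expR u] for [u >= 0]. *)
have cE : expR u + expR (- u) - 2 = (expR u - 1) ^+ 2 * expR (- u).
  rewrite expRN; field; by rewrite gt_eqF ?expR_gt0.
have h1 : u <= expR u - 1 by have := expR_ge1Dx u; lra.
have h2 := expR_sub1_le u.
have h3 : 1 - u <= expR (- u) by exact: expR_ge1Dx.
have h4 := expR_gt0 (- u).
have h5 : u ^+ 2 <= (expR u - 1) ^+ 2 by rewrite ler_sqr// nnegrE// (le_trans u0).
have h6 : (expR u - 1) ^+ 2 <= (u * expR u) ^+ 2.
  by rewrite ler_sqr ?nnegrE ?mulr_ge0 ?expR_ge0 ?(le_trans u0 h1).
have h7 : (u * expR u) ^+ 2 * expR (- u) = u ^+ 2 * expR u.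
  rewrite expRN; field; by rewrite gt_eqF ?expR_gt0.
have e1 : 1 <= expR u by rewrite -expR0 ler_expR.
rewrite cE (ger0_norm u0) ler_norml; apply/andP; split.
  have : u ^+ 2 * (1 - u) <= (expR u - 1) ^+ 2 * expR (- u).
    apply: le_trans (_ : u ^+ 2 * expR (- u) <= _); first by rewrite ler_wpM2l ?sqr_ge0.
    by rewrite ler_wpM2r ?expR_ge0.
  have : u ^+ 3 * 1 <= u ^+ 3 * expR u by rewrite ler_wpM2l ?exprn_ge0.
  rewrite (_ : u ^+ 2 * (1 - u) = u ^+ 2 - u ^+ 3); last by ring.
  by move: (u ^+ 3) (expR u) => a b; lra.
have : (expR u - 1) ^+ 2 * expR (- u) <= u ^+ 2 * expR u.
  by rewrite -h7 ler_wpM2r ?expR_ge0.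
have : u ^+ 2 * (expR u - 1) <= u ^+ 2 * (u * expR u) by rewrite ler_wpM2l ?sqr_ge0.
by rewrite (_ : u ^+ 3 = u ^+ 2 * u); [lra|ring].
Qed.

Lemma eq0_of_le_small (a C : R) : (forall t : R, 0 < t <= 1 -> `|a| <= t * C) -> a = 0.
Proof.
move=> h; apply/eqP; rewrite -normr_le0; apply/ler_addgt0Pr => e e0; rewrite add0r.
have C0 : 0 <= C by have := le_trans (normr_ge0 a) (h 1 _); rewrite mul1r; apply; rewrite ltr01 lexx.
have C1 : 0 < C + 1 by rewrite ltr_wpDl.
pose t := Num.min 1 (e / (C + 1)).
have t0 : 0 < t by rewrite lt_min ltr01 divr_gt0.
apply: le_trans (h t _) _; first by rewrite t0 ge_min lexx.
apply: (@le_trans _ _ (e / (C + 1) * C)); first by rewrite ler_wpM2r// ge_min lexx orbT.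
by rewrite mulrAC ler_pdivrMr// ler_wpM2l ?(ltW e0)// lerDl.
Qed.

Lemma gauss_integrable_id v : 0 <= v -> (gauss v).-integrable setT (EFin \o (id : R -> R)).
Proof.
move=> v0; apply: (gauss_integrable_dominated (t := 1) (C := 1) v0 _ _).1 => // x.
by rewrite !mul1r; have := expR_ge1Dx `|x|; lra.
Qed.

(** Integrating [1 + u * x <= expR (u * x)] against the moment generating function bounds [u] times
    the mean by [O(u ^ 2)]. Taking both signs of [u] and letting [u] tend to 0 forces the value
    0. *)
Lemma gauss_mean v : 0 <= v -> \int[gauss v]_x x = 0.
Proof.
move=> v0; pose K := v / 2 * expR (v / 2); apply: (@eq0_of_le_small _ K) => t /andP[t0 t1].
have ci u : (gauss u).-integrable setT (EFin \o cst (1 : R)).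
  exact: (@bounded_integrable _ _ _ _ _ `|1|).
have key (u : R) : `|u| = t -> u * \int[gauss v]_x x <= t * (t * K).
  move=> ut; have iu : (gauss v).-integrable setT (EFin \o (fun x : R => u * x)).
    by have := integrableZl measurableT u (gauss_integrable_id v0); apply: eq_integrable.
  have : \int[gauss v]_x (1 + u * x) <= \int[gauss v]_x expR (u * x).
    apply: le_Rintegral => //; first exact: (integrableD measurableT (ci v) iu).
      exact: gauss_exp_integrable.
    by move=> x _; exact: expR_ge1Dx.
  rewrite (RintegralD measurableT (ci v) iu) Rintegral_probability_cst gauss_mgfR//.
  rewrite (RintegralZl u measurableT (gauss_integrable_id v0)) -[u ^+ 2]real_normK ?num_real// ut.
  have := expR_sub1_le (t ^+ 2 * v / 2).
  have : t ^+ 2 * v / 2 * expR (t ^+ 2 * v / 2) <= t ^+ 2 * v / 2 * expR (v / 2).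
    have s0 : 0 <= t ^+ 2 * v / 2 by rewrite divr_ge0// mulr_ge0// sqr_ge0.
    rewrite (ler_wpM2l s0)// ler_expR -mulrA ler_piMl ?divr_ge0//.
    by rewrite expr_le1// ltW.
  rewrite (_ : t ^+ 2 * v / 2 * expR (v / 2) = t * (t * K)); last by rewrite /K; ring.
  lra.
have h1 := key t (gtr0_norm t0).
have := key (- t); rewrite normrN => /(_ (gtr0_norm t0)) h2.
have {}h1 : \int[gauss v]_x x <= t * K by rewrite -(ler_pM2l t0).
have {}h2 : - (\int[gauss v]_x x) <= t * K by move: h2; rewrite mulNr -mulrN ler_pM2l.
by rewrite ler_norml h1 andbT lerNl.
Qed.

Lemma gauss_integrable_sqr v : 0 <= v -> (gauss v).-integrable setT (EFin \o (fun x : R => x ^+ 2)).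
Proof.
move=> v0; apply: (gauss_integrable_dominated (t := 1) (C := 2 `^ 2) v0 _ _).1 => //.
move=> x; rewrite mul1r normrX -powR_mulrn//; exact: powR_le_expR.
Qed.

(** The second difference of the moment generating function at 0 is [t ^ 2] times the second moment
    up to [O(t ^ 3)], while its explicit value has the leading term [t ^ 2 * v]. *)
Lemma gauss_variance v : 0 <= v -> \int[gauss v]_x (x ^+ 2) = v.
Proof.
move=> v0; set W := RHS; apply/eqP; rewrite -subr_eq0; apply/eqP.
have ci u : (gauss u).-integrable setT (EFin \o cst (2 : R)).
  exact: (@bounded_integrable _ _ _ _ _ `|2|).
have [C0 hC0] : exists C0, forall t, 0 < t <= 1 ->
    `|2 * (expR (t ^+ 2 * v / 2) - 1) - t ^+ 2 * \int[gauss v]_x (x ^+ 2)| <= t ^+ 3 * C0.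
  exists (3 `^ 3 * 2 * expR (2 ^+ 2 * v / 2)) => t /andP[t0 t1].
  pose f x : R := expR (t * x) + expR (- t * x) - 2 - t ^+ 2 * x ^+ 2.
  have mf : measurable_fun setT f.
    have mexp u : measurable_fun setT (fun x : R => expR (u * x)).
      by apply: (measurableT_comp (@measurable_expR R)); exact: mulrl_measurable.
    apply: measurable_funB; last by apply: measurable_funM => //; exact: measurable_funX.
    by apply: measurable_funB => //; exact: measurable_funD.
  have i1 := integrableB measurableT (integrableD measurableT
    (gauss_exp_integrable t v0) (gauss_exp_integrable (- t) v0)) (ci v).
  have i2 := integrableZl measurableT (t ^+ 2) (gauss_integrable_sqr v0).
  have fE : \int[gauss v]_x f x =
      2 * (expR (t ^+ 2 * v / 2) - 1) - t ^+ 2 * \int[gauss v]_x (x ^+ 2).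
    rewrite (RintegralB measurableT i1 i2) (RintegralZl _ measurableT (gauss_integrable_sqr v0)).
    rewrite (RintegralB measurableT (integrableD measurableT
      (gauss_exp_integrable t v0) (gauss_exp_integrable (- t) v0)) (ci v)).
    rewrite (RintegralD measurableT (gauss_exp_integrable t v0) (gauss_exp_integrable (- t) v0)).
    by rewrite Rintegral_probability_cst !gauss_mgfR// sqrrN; ring.
  have fb x : `|f x| <= t ^+ 3 * 3 `^ 3 * expR `|2 * x|.
    have := expR_second_difference (t * x); rewrite -mulNr exprMn -/(f x) => /le_trans; apply.
    rewrite normrM (gtr0_norm t0) exprMn normrM (ger0_norm (ler0n R 2)).
    have x3 : `|x| ^+ 3 <= 3 `^ 3 * expR `|x| by rewrite -powR_mulrn// powR_le_expR.
    have etx : expR (t * `|x|) <= expR `|x| by rewrite ler_expR ler_piMl// ltW.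
    have -> : expR (2 * `|x|) = expR `|x| * expR `|x| by rewrite -expRD; congr expR; ring.
    have x30 : 0 <= `|x| ^+ 3 by rewrite exprn_ge0.
    have t30 : 0 <= t ^+ 3 by rewrite exprn_ge0// ltW.
    move: (`|x| ^+ 3) (t ^+ 3) x3 x30 t30 => a b x3 a0 b0.
    rewrite -(mulrA b) -(mulrA b) (ler_wpM2l b0)// mulrA.
    by apply: ler_pM; rewrite ?expR_ge0.
  have [fi fI] := gauss_integrable_dominated v0 mf fb.
  rewrite -fE; apply: le_trans (le_normr_Rintegral measurableT fi) _.
  by apply: le_trans fI _; rewrite !mulrA.
apply: (@eq0_of_le_small _ (C0 + v ^+ 2 / 2 * expR (v / 2))) => t /andP[t0 t1].
have := hC0 t; rewrite t0 t1 => /(_ isT) h.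
set I := \int[gauss v]_x (x ^+ 2) in h *.
pose s := t ^+ 2 * v / 2.
have s0 : 0 <= s by rewrite divr_ge0// mulr_ge0// sqr_ge0.
have h1 : s <= expR s - 1 by have := expR_ge1Dx s; lra.
have h2 := expR_sub1_le s.
have t21 : t ^+ 2 <= 1 by rewrite expr_le1// ltW.
have h3 : expR s <= expR (v / 2).
  by rewrite ler_expR /s -mulrA ler_piMl// divr_ge0.
have h4 : expR s - 1 - s <= s ^+ 2 * expR (v / 2).
  apply: (@le_trans _ _ (s * (expR s - 1))); first by lra.
  rewrite expr2 -mulrA ler_wpM2l//; apply: le_trans h2 _; by rewrite ler_wpM2l.
have h5 : 2 * (s ^+ 2 * expR (v / 2)) <= t ^+ 3 * (v ^+ 2 / 2 * expR (v / 2)).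
  rewrite (_ : 2 * _ = t * (t ^+ 3 * (v ^+ 2 / 2 * expR (v / 2)))); last by rewrite /s; field.
  by rewrite ler_piMl// !mulr_ge0 ?exprn_ge0 ?expR_ge0 ?(ltW t0)// invr_ge0.
have t2 : 0 < t ^+ 2 by rewrite exprn_gt0.
rewrite -(ler_pM2l t2) -[X in X * `|_|]gtr0_norm// -normrM.
rewrite (_ : t ^+ 2 * (t * _) = t ^+ 3 * C0 + t ^+ 3 * (v ^+ 2 / 2 * expR (v / 2))); last by ring.
have e1 : t ^+ 2 * (I - W) = 2 * (expR s - 1 - s) - (2 * (expR s - 1) - t ^+ 2 * I).
  by rewrite /s /W; field.
rewrite e1; apply: le_trans (ler_normB _ _) _; rewrite addrC; apply: lerD => //.
rewrite ger0_norm; last by lra.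
by apply: le_trans h5; rewrite ler_wpM2l.
Qed.

End gaussian.

(** * Lindeberg replacement *)

Section square_integrable.
Context {d : measure_display} {T : measurableType d} {R : realType}.
Variable P : probability T R.
Implicit Types (X Y : T -> R).

Local Notation integrable X := (P.-integrable setT (EFin \o X)).

Lemma integrable_le X Y : measurable_fun setT X -> integrable Y -> (forall w, `|X w| <= Y w) ->
  integrable X.
Proof.
move=> mX iY XY; apply: le_integrable iY => //; first exact/measurable_EFinP.
by move=> w _ /=; rewrite lee_fin; apply: le_trans (XY w) (ler_norm _).
Qed.

Lemma integrable_add X Y : integrable X -> integrable Y -> integrable (fun w => X w + Y w).
Proof. by move=> iX iY; exact: (integrableD measurableT iX iY). Qed.

Lemma integrable_sub X Y : integrable X -> integrable Y -> integrable (fun w => X w - Y w).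
Proof. by move=> iX iY; exact: (integrableB measurableT iX iY). Qed.

Lemma integrable_scale c X : integrable X -> integrable (fun w => c * X w).
Proof. by move=> iX; have := integrableZl measurableT c iX; apply: eq_integrable. Qed.

Lemma integrable_cst (c : R) : integrable (fun=> c).
Proof. exact: (@bounded_integrable _ _ _ _ _ `|c|). Qed.

Lemma integrable_abs X : integrable X -> integrable (fun w => `|X w|).
Proof. exact: integrable_norm. Qed.

Lemma integrable_sqr X : measurable_fun setT X -> integrable (fun w => X w ^+ 2) -> integrable X.
Proof.
move=> mX iX; apply: (@integrable_le _ (fun w => 1 + X w ^+ 2)) => //.
  by apply: integrable_add => //; exact: integrable_cst.
move=> w; rewrite -[X w ^+ 2]real_normK ?num_real//.
by have := sqr_ge0 (`|X w| - 1); have := sqr_ge0 `|X w|; nra.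
Qed.

Lemma integrable_mul X Y : measurable_fun setT X -> measurable_fun setT Y ->
  integrable (fun w => X w ^+ 2) -> integrable (fun w => Y w ^+ 2) -> integrable (fun w => X w * Y w).
Proof.
move=> mX mY iX iY; apply: (@integrable_le _ (fun w => X w ^+ 2 + Y w ^+ 2)).
- exact: measurable_funM.
- exact: integrable_add.
move=> w; rewrite ler_norml.
by have := sqr_ge0 (X w + Y w); have := sqr_ge0 (X w - Y w); have := sqr_ge0 (X w); have := sqr_ge0 (Y w); nra.
Qed.

Lemma Rintegral_abs_le_sqrt X : measurable_fun setT X -> integrable (fun w => X w ^+ 2) ->
  \int[P]_w `|X w| <= Num.sqrt (\int[P]_w (X w ^+ 2)).
Proof.
move=> mX iX2; have iX := integrable_sqr mX iX2; have iaX := integrable_abs iX.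
set m := \int[P]_w `|X w|.
have m0 : 0 <= m by apply: Rintegral_ge0.
rewrite -(ger0_norm m0) -sqrtr_sqr ler_wsqrtr//.
have i1 : integrable (fun w => 2 * m * `|X w|) by exact: integrable_scale.
have i2 : integrable (fun w => 2 * m * `|X w| - m ^+ 2).
  by apply: integrable_sub => //; exact: integrable_cst.
have : \int[P]_w (2 * m * `|X w| - m ^+ 2) <= \int[P]_w (X w ^+ 2).
  apply: le_Rintegral => // w _; rewrite -[X w ^+ 2]real_normK ?num_real//.
  by have := sqr_ge0 (`|X w| - m); nra.
rewrite (RintegralB measurableT i1 (integrable_cst _)) Rintegral_probability_cst.
rewrite (RintegralZl _ measurableT iaX) -/m; nra.
Qed.

(** The product is split into its positive and negative parts, to which the nonnegative form of
    [independent_integral] applies; for fixed [X w] their integrals in the second variable agree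
    because [Y] has mean 0. *)
Lemma independent_mul_eq0 X Y : measurable_fun setT X -> measurable_fun setT Y ->
  integrable (fun w => X w ^+ 2) -> integrable (fun w => Y w ^+ 2) ->
  independent_pair P X Y -> \int[P]_w Y w = 0 -> \int[P]_w (X w * Y w) = 0.
Proof.
move=> mX mY iX2 iY2 XY EY; have iY := integrable_sqr mY iY2.
have iXY := integrable_mul mX mY iX2 iY2.
pose hp (z : R * R) := Num.max (z.1 * z.2) 0.
pose hn (z : R * R) := Num.max (- (z.1 * z.2)) 0.
have m12 : measurable_fun setT (fun z : R * R => z.1 * z.2).
  by apply: measurable_funM; [exact: measurable_fst|exact: measurable_snd].
have mhp : measurable_fun setT (EFin \o hp).
  by apply/measurable_EFinP; apply: measurable_maxr => //; exact: measurable_cst.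
have mhn : measurable_fun setT (EFin \o hn).
  apply/measurable_EFinP; apply: measurable_maxr; last exact: measurable_cst.
  exact: measurableT_comp.
have hp0 z : (0 <= (EFin \o hp) z)%E by rewrite lee_fin le_max lexx orbT.
have hn0 z : (0 <= (EFin \o hn) z)%E by rewrite lee_fin le_max lexx orbT.
have hE z : z.1 * z.2 = hp z - hn z.
  rewrite /hp /hn; have [h|h] := leP 0 (z.1 * z.2).
    by rewrite max_r ?oppr_le0// subr0.
  by rewrite max_l ?oppr_ge0 ?(ltW h)// sub0r opprK.
have mZ : measurable_fun setT (fun w => (X w, Y w)) by exact: measurable_fun_pair.
have hle (h : R * R -> R) : (forall z, `|h z| <= `|z.1 * z.2|) ->
    measurable_fun setT (EFin \o h) -> integrable (fun w => h (X w, Y w)).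
  move=> hh mh; apply: (@integrable_le _ (fun w => `|X w * Y w|)); last by move=> w; exact: hh.
    by apply/measurable_EFinP; exact: (measurableT_comp mh mZ).
  exact: integrable_abs.
have ihp : integrable (fun w => hp (X w, Y w)).
  apply: hle => // z; rewrite /hp; case: (leP (z.1 * z.2) 0) => h; last by [].
  by rewrite normr0.
have ihn : integrable (fun w => hn (X w, Y w)).
  apply: hle => // z; rewrite /hn; case: (leP (- (z.1 * z.2)) 0) => h; last by rewrite normrN.
  by rewrite normr0.
have inner w : (\int[P]_v (EFin \o hp) (X w, Y v) = \int[P]_v (EFin \o hn) (X w, Y v))%E.
  have ixY : integrable (fun v => X w * Y v) by exact: integrable_scale.
  have mxZ : measurable_fun setT (fun v => (X w, Y v)) by exact: measurable_fun_pair.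
  have ip : integrable (fun v => hp (X w, Y v)).
    apply: (@integrable_le _ (fun v => `|X w * Y v|)); last 1 first.
    - move=> v; rewrite /hp; case: (leP _ 0) => h //=; by rewrite normr0.
    - by apply/measurable_EFinP; exact: (measurableT_comp mhp mxZ).
    - exact: integrable_abs.
  have inn : integrable (fun v => hn (X w, Y v)).
    apply: (@integrable_le _ (fun v => `|X w * Y v|)); last 1 first.
    - by move=> v; rewrite /hn; case: (leP _ 0) => h /=; rewrite ?normr0// normrN.
    - by apply/measurable_EFinP; exact: (measurableT_comp mhn mxZ).
    - exact: integrable_abs.
  apply: etrans (Rintegral_EFin ip) _; apply: etrans (esym (Rintegral_EFin inn)); congr (_%:E).
  apply/eqP; rewrite -subr_eq0 -(RintegralB measurableT ip inn).
  under eq_Rintegral do rewrite -hE.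
  by rewrite /= (RintegralZl _ measurableT iY) EY mulr0.
have := independent_integral mX mY XY mhp hp0.
have := independent_integral mX mY XY mhn hn0.
have -> : (\int[P]_w \int[P]_v (EFin \o hn) (X w, Y v) = \int[P]_w \int[P]_v (EFin \o hp) (X w, Y v))%E.
  by apply: eq_integral => w _; rewrite inner.
move=> <- eqhp; have e1 : \int[P]_w hp (X w, Y w) = \int[P]_w hn (X w, Y w).
  exact: (congr1 fine eqhp).
under eq_Rintegral do rewrite (hE (X _, Y _)).
by rewrite (RintegralB measurableT ihp ihn) e1 subrr.
Qed.

End square_integrable.

(** * Gaussian convolution and replacement of independent summands *)

Section lindeberg.
Context {d : measure_display} {T : measurableType d} {R : realType}.
Variable P : probability T R.
Implicit Types (f h : R -> R) (x y : R).

(** The bound [M] ensures integrability and enters no estimate; the error terms are expressed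
    through the Lipschitz constant [K]. *)
Definition bounded_lipschitz (K : R) f : Prop :=
  (exists M, forall x, `|f x| <= M) /\ (forall x y, `|f x - f y| <= K * `|x - y|).

Lemma lipschitz_continuous K f : (forall x y, `|f x - f y| <= K * `|x - y|) -> continuous f.
Proof.
move=> fK x; apply/cvgrPdist_lt => e e0.
have K0 : 0 <= K by have := le_trans (normr_ge0 _) (fK 1 0); rewrite subr0 normr1 mulr1.
have K1 : 0 < K + 1 by rewrite ltr_wpDl.
near=> y; apply: le_lt_trans (fK x y) _.
apply: (@le_lt_trans _ _ ((K + 1) * `|x - y|)); first by rewrite ler_wpM2r// lerDl.
rewrite mulrC -ltr_pdivlMr//; near: y.
by apply: (@cvgr_dist_lt _ _ _ (nbhs x) _ id) => //; rewrite divr_gt0.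
Unshelve. all: by end_near. Qed.

Lemma lipschitz_measurable K f : (forall x y, `|f x - f y| <= K * `|x - y|) -> measurable_fun setT f.
Proof. by move=> fK; apply: continuous_measurable_fun; exact: lipschitz_continuous fK. Qed.

Definition gauss_op v f x : R := \int[gauss v]_y f (x + y).

Lemma bounded_lipschitz_gauss K v f : bounded_lipschitz K f -> bounded_lipschitz K (gauss_op v f).
Proof.
move=> [[M fM] fK]; have mf := lipschitz_measurable fK.
have mfx x : measurable_fun setT (fun y => f (x + y)).
  by apply: measurableT_comp => //; exact: measurable_funD.
have fi x : (gauss v).-integrable setT (EFin \o (fun y => f (x + y))).
  exact: (@bounded_integrable _ _ _ _ _ M).
split; first by exists M => x; exact: bounded_Rintegral.
move=> x x'; apply: ler_dist_Rintegral => // y.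
by apply: le_trans (fK _ _) _; rewrite opprD addrACA subrr addr0.
Qed.

Lemma gauss_op_add K s t f x : 0 <= s -> 0 <= t -> bounded_lipschitz K f ->
  gauss_op s (gauss_op t f) x = gauss_op (s + t) f x.
Proof.
move=> s0 t0 [[M fM] fK]; rewrite /gauss_op.
have cf : continuous (fun y => f (x + y)).
  apply: (@lipschitz_continuous K) => y y'; apply: le_trans (fK _ _) _.
  by rewrite opprD addrACA subrr add0r.
apply: etrans (gauss_semigroup s0 t0 cf (fun y => fM (x + y))).
by apply: eq_Rintegral => y _; apply: eq_Rintegral => z _; rewrite addrA.
Qed.

Lemma gauss_op_near K t f y : 0 <= t -> bounded_lipschitz K f ->
  `|gauss_op t f y - f y| <= K * Num.sqrt t.
Proof.
move=> t0 [[M fM] fL]; have mf := lipschitz_measurable fL.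
have mfx u : measurable_fun setT (fun y => f (u + y)).
  by apply: measurableT_comp => //; exact: measurable_funD.
have K0 : 0 <= K.
  by have := le_trans (normr_ge0 _) (fL 1 0); rewrite subr0 normr1 mulr1.
have ii := gauss_integrable_id t0.
have ci : (gauss t).-integrable setT (EFin \o (fun z : R => `|z|)) by exact: integrable_abs.
have fi : (gauss t).-integrable setT (EFin \o (fun z => f (y + z))).
  exact: (@bounded_integrable _ _ _ _ _ M).
have -> : gauss_op t f y - f y = \int[gauss t]_z (f (y + z) - f y).
  apply/esym; apply: etrans (RintegralB measurableT fi (integrable_cst _ _)) _.
  by congr (_ - _); exact: Rintegral_probability_cst.
apply: (@le_trans _ _ (\int[gauss t]_z (K * `|z|))).
  apply: ler_normr_Rintegral.
  - by apply: integrable_sub => //; exact: integrable_cst.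
  - exact: (@integrable_scale _ _ _ (gauss t) K (fun z => `|z|)).
  - by move=> z; apply: le_trans (fL _ _) _; rewrite addrC addKr.
rewrite (RintegralZl K measurableT ci) ler_wpM2l//.
have := @Rintegral_abs_le_sqrt _ _ _ (gauss t) id (@measurable_id _ _ _) (gauss_integrable_sqr t0).
by rewrite gauss_variance.
Qed.

(** By the semigroup property, the larger variance amounts to an additional independent Gaussian of
    variance [|s - t|], whose effect [gauss_op_near] bounds by its standard deviation. *)
Lemma gauss_op_dist K s t f x : 0 <= s -> 0 <= t -> bounded_lipschitz K f ->
  `|gauss_op s f x - gauss_op t f x| <= K * Num.sqrt `|s - t|.
Proof.
wlog st : s t / s <= t.
  move=> hw s0 t0 fK; have [st|ts] := leP s t; first exact: hw.
  by rewrite distrC [X in Num.sqrt X]distrC; apply: hw => //; exact: ltW.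
move=> s0 t0 fK; have ts0 : 0 <= t - s by rewrite subr_ge0.
rewrite distrC [X in Num.sqrt X]distrC (ger0_norm ts0).
have -> : gauss_op t f x = gauss_op s (gauss_op (t - s) f) x.
  by rewrite (gauss_op_add _ s0 ts0 fK) addrC subrK.
have [[M fM] fL] := fK; have [[M' gM] gL] := bounded_lipschitz_gauss (t - s) fK.
have mf := lipschitz_measurable fL; have mg := lipschitz_measurable gL.
have mfx u : measurable_fun setT (fun y => f (u + y)).
  by apply: measurableT_comp => //; exact: measurable_funD.
have mgx u : measurable_fun setT (fun y => gauss_op (t - s) f (u + y)).
  by apply: measurableT_comp => //; exact: measurable_funD.
apply: ler_dist_Rintegral; [exact: (@bounded_integrable _ _ _ _ _ M')|exact: (@bounded_integrable _ _ _ _ _ M)|].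
by move=> y; exact: gauss_op_near.
Qed.

Section swap.
Context {C : countType} {A : finType}.
Variables (D : A -> T -> C) (u : A -> C -> R).
Hypothesis mD : forall a, discrete_variable (D a).
Hypothesis indD : independent_discrete P D.
Local Notation X := (fun a w => u a (D a w)).

Variables (K : R) (f : R -> R) (v eps : A -> R).
Hypothesis v0 : forall a, 0 <= v a.
Hypothesis fK : bounded_lipschitz K f.
Hypothesis Xeps : forall a x, `|\int[P]_w f (x + X a w) - gauss_op (v a) f x| <= eps a.

(** The summands are replaced one at a time. The bound [Xeps] is uniform in the translation [x], so
    it can be used given the other summands; after an exchange of integrals the induction hypothesis
    is applied to translates of the same [f], and the class of test functions stays fixed. *)
Lemma gauss_swap (s : seq A) x : uniq s ->
  `|\int[P]_w f (x + \sum_(a <- s) X a w) - gauss_op (\sum_(a <- s) v a) f x| <= \sum_(a <- s) eps a.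
Proof.
have [[M fM] fL] := fK; have mf := lipschitz_measurable fL.
elim: s x => [|a s IH] x.
  move=> _; rewrite !big_nil; under eq_Rintegral do rewrite big_nil addr0.
  by rewrite Rintegral_probability_cst distrC; have := gauss_op_near x (lexx 0) fK; rewrite sqrtr0 mulr0.
move=> /= /andP[as' us]; rewrite !big_cons.
pose S w := \sum_(b <- s) X b w; pose V := \sum_(b <- s) v b.
have mX b : measurable_fun setT (X b) by exact: (measurable_fun_discrete (u b) (mD b)).
have mS : measurable_fun setT S by exact: measurable_discrete_sum.
have V0 : 0 <= V by rewrite sumr_ge0.
have SX : independent_pair P S (X a) by exact: independent_discrete_sum.
pose g := gauss_op (v a) f.
have [[M' gM] gL] := bounded_lipschitz_gauss (v a) fK; have mg := lipschitz_measurable gL.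
have mh : measurable_fun setT (fun z : R * R => f (x + z.1 + z.2)).
  apply: measurableT_comp => //; apply: measurable_funD; last exact: measurable_snd.
  by apply: measurable_funD => //; exact: measurable_fst.
have mSX : measurable_fun setT (fun w : T * T => f (x + S w.1 + X a w.2)).
  have m1 : measurable_fun setT (fun w : T * T => S w.1) by exact: measurableT_comp mS measurable_fst.
  have m2 : measurable_fun setT (fun w : T * T => X a w.2) by exact: measurableT_comp (mX a) measurable_snd.
  by apply: measurableT_comp => //; apply: measurable_funD => //; exact: measurable_funD.
have mSg : measurable_fun setT (fun w : T * R => f (x + S w.1 + w.2)).
  have m1 : measurable_fun setT (fun w : T * R => S w.1) by exact: measurableT_comp mS measurable_fst.
  apply: measurableT_comp => //; apply: measurable_funD; last exact: measurable_snd.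
  exact: measurable_funD.
have E1 : \int[P]_w f (x + \sum_(b <- a :: s) X b w) = \int[P]_w \int[P]_w' f (x + S w + X a w').
  rewrite -(independent_bounded_integral mS (mX a) SX mh (fun z => fM _)).
  by apply: eq_Rintegral => w _; rewrite big_cons [X a w + _]addrC addrA.
have E2 : \int[P]_w g (x + S w) = \int[gauss (v a)]_z \int[P]_w f (x + z + S w).
  apply: etrans (bounded_fubini P (gauss (v a)) mSg (fun z => fM _)) _.
  by apply: eq_Rintegral => z _; apply: eq_Rintegral => w _; rewrite /= addrAC.
have D1 : `|\int[P]_w \int[P]_w' f (x + S w + X a w') - \int[P]_w g (x + S w)| <= eps a.
  apply: ler_dist_Rintegral; last by move=> w; exact: Xeps.
    apply: (@bounded_integrable _ _ _ _ _ M).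
      exact: (@measurable_bounded_fubini1 _ _ _ _ _ P P (fun w : T * T => f (x + S w.1 + X a w.2)) M).
    move=> w; apply: bounded_Rintegral => //; apply: measurableT_comp => //.
    exact: measurable_funD.
  apply: (@bounded_integrable _ _ _ _ _ M') => //.
  by apply: measurableT_comp => //; exact: measurable_funD.
have D2 : `|\int[gauss (v a)]_z \int[P]_w f (x + z + S w) - gauss_op (v a + V) f x| <= \sum_(b <- s) eps b.
  rewrite -(gauss_op_add x (v0 a) V0 fK).
  have [[M2 hM] hL] := bounded_lipschitz_gauss V fK; have mh2 := lipschitz_measurable hL.
  apply: ler_dist_Rintegral; last by move=> z; exact: IH.
    apply: (@bounded_integrable _ _ _ _ _ M).
      apply: (@measurable_bounded_fubini2 _ _ _ _ _ P (gauss (v a)) (fun w : T * R => f (x + w.2 + S w.1)) M) => //.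
      by apply: eq_measurable_fun mSg => w _; rewrite addrAC.
    move=> w; apply: bounded_Rintegral => //; apply: measurableT_comp => //.
    exact: measurable_funD.
  have mhx : measurable_fun setT (fun z => gauss_op V f (x + z)).
    by apply: measurableT_comp => //; exact: measurable_funD.
  exact: (bounded_integrable (gauss (v a)) mhx (fun z => hM (x + z))).
rewrite E1; apply: le_trans (ler_distD (\int[P]_w g (x + S w)) _ _) _.
by apply: lerD => //; rewrite E2.
Qed.

End swap.

(* [c1] and [c2] stand for [f' x] and [f'' x / 2]; with [q <= 3] only a [q]-th moment is needed
   in the Lindeberg expansion. *)
Definition taylor_bound (q K : R) f : Prop :=
  forall x, exists c1 c2, forall y, `|f (x + y) - f x - c1 * y - c2 * y ^+ 2| <= K * `|y| `^ q.

Lemma taylor_mean (d' : measure_display) (T' : measurableType d') (Q : probability T' R)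
  (Y : T' -> R) q K M f x c1 c2 v :
  measurable_fun setT f -> (forall y, `|f y| <= M) ->
  measurable_fun setT Y ->
  (forall y, `|f (x + y) - f x - c1 * y - c2 * y ^+ 2| <= K * `|y| `^ q) ->
  Q.-integrable setT (EFin \o (fun w => Y w ^+ 2)) ->
  Q.-integrable setT (EFin \o (fun w => `|Y w| `^ q)) ->
  \int[Q]_w Y w = 0 -> \int[Q]_w (Y w ^+ 2) = v ->
  `|\int[Q]_w f (x + Y w) - (f x + c2 * v)| <= K * \int[Q]_w (`|Y w| `^ q).
Proof.
move=> mf fM mY fc iY2 iYq EY EY2; have iY := integrable_sqr mY iY2.
have ifY : Q.-integrable setT (EFin \o (fun w => f (x + Y w))).
  apply: (@bounded_integrable _ _ _ _ _ M) => //.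
  by apply: measurableT_comp => //; exact: measurable_funD.
have i1 : Q.-integrable setT (EFin \o (fun w => c1 * Y w)) by exact: integrable_scale.
have i2 : Q.-integrable setT (EFin \o (fun w => c2 * Y w ^+ 2)).
  exact: (@integrable_scale _ _ _ Q c2 (fun w => Y w ^+ 2)).
have i0 : Q.-integrable setT (EFin \o (fun w => f (x + Y w) - f x)).
  by apply: integrable_sub => //; exact: integrable_cst.
have i01 : Q.-integrable setT (EFin \o (fun w => f (x + Y w) - f x - c1 * Y w)).
  exact: integrable_sub.
have -> : \int[Q]_w f (x + Y w) - (f x + c2 * v) =
    \int[Q]_w (f (x + Y w) - f x - c1 * Y w - c2 * Y w ^+ 2).
  rewrite (RintegralB measurableT i01 i2) (RintegralB measurableT i0 i1).
  rewrite (RintegralB measurableT ifY (integrable_cst _ _)) Rintegral_probability_cst.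
  rewrite (RintegralZl c1 measurableT iY) (RintegralZl c2 measurableT iY2) EY EY2; ring.
rewrite -(RintegralZl K measurableT iYq); apply: ler_normr_Rintegral => //.
- exact: (@integrable_sub _ _ _ Q _ (fun w => c2 * Y w ^+ 2)).
- exact: (@integrable_scale _ _ _ Q K (fun w => `|Y w| `^ q)).
Qed.

(** Both means are compared with [f x + c2 * v]. The law of [Y] and the Gaussian share their first
    two moments, so the quadratic part of the expansion cancels and only the two remainders are
    left. *)
Lemma taylor_gauss (Y : T -> R) q K1 K Cq f x v : bounded_lipschitz K1 f -> taylor_bound q K f ->
  0 <= v -> (gauss v).-integrable setT (EFin \o (fun x : R => `|x| `^ q)) ->
  \int[gauss v]_x (`|x| `^ q) <= Cq ->
  measurable_fun setT Y ->
  P.-integrable setT (EFin \o (fun w => Y w ^+ 2)) ->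
  P.-integrable setT (EFin \o (fun w => `|Y w| `^ q)) ->
  \int[P]_w Y w = 0 -> \int[P]_w (Y w ^+ 2) = v ->
  `|\int[P]_w f (x + Y w) - gauss_op v f x| <= K * (\int[P]_w (`|Y w| `^ q) + Cq).
Proof.
move=> [[M fM] fL] fT v0 gi gC mY iY2 iYq EY EY2; have mf := lipschitz_measurable fL.
have [c1 [c2 fc]] := fT x.
have K0 : 0 <= K.
  by have := le_trans (normr_ge0 _) (fc 1); rewrite normr1 powR1 mulr1.
have h1 := taylor_mean mf fM mY fc iY2 iYq EY EY2.
have h2 := @taylor_mean _ _ (gauss v) id q K M f x c1 c2 v mf fM (@measurable_id _ _ _) fc
  (gauss_integrable_sqr v0) gi (gauss_mean v0) (gauss_variance v0).
rewrite distrC in h2.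
apply: le_trans (ler_distD (f x + c2 * v) _ _) _; rewrite mulrDr; apply: lerD => //.
by apply: le_trans h2 _; rewrite ler_wpM2l.
Qed.

End lindeberg.

(** * Moments of sums of independent variables *)

Section power_inequalities.
Context {R : realType}.
Implicit Types (r q x y c dl eta : R).

Lemma powR_le r x y : 0 <= r -> 0 <= x -> x <= y -> x `^ r <= y `^ r.
Proof.
move=> r0 x0 xy; apply: ge0_ler_powR => //; rewrite nnegrE//; exact: le_trans xy.
Qed.

Lemma powRB1 r x : 0 < r -> 0 <= x -> x `^ r = x * x `^ (r - 1).
Proof. by move=> r0 x0; rewrite mulr_powRB1. Qed.

(* According as [y] is small compared with [x], [x] small compared with [y], or neither. *)
Lemma powR_normD_le r dl x y : 1 <= r -> 0 < dl -> `|x + y| `^ r <=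
  (1 + dl) `^ r * (`|x| `^ r + `|y| `^ r) + (1 + dl^-1) `^ r / dl * (`|x| `^ (r - 1) * `|y|).
Proof.
move=> r1 dl0; have r0 : 0 < r by apply: lt_le_trans r1.
have d0 : 0 <= 1 + dl by rewrite addr_ge0// ltW.
have di0 : 0 <= 1 + dl^-1 by rewrite addr_ge0// invr_ge0 ltW.
have xyD := ler_normD x y.
have c1 : 0 <= (1 + dl) `^ r := powR_ge0 _ _.
have c2 : 0 <= (1 + dl^-1) `^ r / dl by rewrite divr_ge0 ?powR_ge0// ltW.
have px : 0 <= `|x| `^ r := powR_ge0 _ _.
have py : 0 <= `|y| `^ r := powR_ge0 _ _.
have c3 : 0 <= (1 + dl^-1) `^ r / dl * (`|x| `^ (r - 1) * `|y|).
  by rewrite mulr_ge0// mulr_ge0// powR_ge0.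
have [yx|yx] := leP `|y| (dl * `|x|).
  have : `|x + y| `^ r <= (1 + dl) `^ r * `|x| `^ r.
    rewrite -powRM//; apply: powR_le; [exact: ltW|exact: normr_ge0|].
    by apply: le_trans xyD _; rewrite mulrDl mul1r lerD2l.
  have : 0 <= (1 + dl) `^ r * `|y| `^ r by rewrite mulr_ge0.
  by rewrite mulrDr; lra.
have [xy|xy] := leP `|x| (dl * `|y|).
  have : `|x + y| `^ r <= (1 + dl) `^ r * `|y| `^ r.
    rewrite -powRM//; apply: powR_le; [exact: ltW|exact: normr_ge0|].
    by apply: le_trans xyD _; rewrite mulrDl mul1r addrC lerD2l.
  have : 0 <= (1 + dl) `^ r * `|x| `^ r by rewrite mulr_ge0.
  by rewrite mulrDr; lra.
have h : `|x + y| `^ r <= (1 + dl^-1) `^ r * `|x| `^ r.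
  rewrite -powRM//; apply: powR_le; [exact: ltW|exact: normr_ge0|].
  apply: le_trans xyD _; rewrite mulrDl mul1r lerD2l -[leLHS]mul1r -(mulVf (lt0r_neq0 dl0)).
  by rewrite -mulrA ler_wpM2l ?invr_ge0 ?(ltW dl0)// ltW.
apply: le_trans h _; apply: ler_wpDl; first by rewrite mulr_ge0// addr_ge0.
rewrite -mulrA ler_wpM2l ?powR_ge0// (powRB1 r0 (normr_ge0 x)) mulrCA mulrC.
by rewrite ler_wpM2l ?powR_ge0// ler_pdivlMl// ltW.
Qed.

(** According as [|y| <= dl * |x|] or not, a single term already dominates. The coefficient of
    [|x| ^ r] tends to 1 with [dl], so a contraction constant can be preserved. *)
Lemma powR_normD_le2 r dl x y : 0 <= r -> 0 < dl -> `|x + y| `^ r <=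
  (1 + dl) `^ r * `|x| `^ r + (1 + dl^-1) `^ r * `|y| `^ r.
Proof.
move=> r0 dl0; have di0 : 0 < dl^-1 by rewrite invr_gt0.
have d0 : 0 <= 1 + dl by rewrite addr_ge0// ltW.
have d1 : 0 <= 1 + dl^-1 by rewrite addr_ge0// ltW.
have xyD := ler_normD x y.
rewrite -!powRM//; have [yx|yx] := leP `|y| (dl * `|x|).
  apply: ler_wpDr; first exact: powR_ge0.
  by apply: powR_le => //; apply: le_trans xyD _; rewrite mulrDl mul1r lerD2l.
apply: ler_wpDl; first exact: powR_ge0.
apply: powR_le => //; apply: le_trans xyD _; rewrite mulrDl mul1r addrC lerD2l.
by rewrite ler_pdivlMl// ltW.
Qed.

(** A form of Young's inequality with a free weight, by comparison of [c] with [eta * |x|]. *)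
Lemma powR_interpolation r eta x c : 1 < r -> 0 < eta -> 0 <= c ->
  `|x| `^ (r - 1) * c <= eta * `|x| `^ r + eta `^ (1 - r) * c `^ r.
Proof.
move=> r1 e0 c0; have r0 : 0 < r by apply: lt_trans r1.
rewrite (powRB1 r0 (normr_ge0 x)) (powRB1 r0 c0).
have px := powR_ge0 `|x| (r - 1); have pc := powR_ge0 c (r - 1); have pe := powR_ge0 eta (1 - r).
have [cx|cx] := leP c (eta * `|x|).
  apply: ler_wpDr; first by rewrite !mulr_ge0.
  by rewrite mulrA [leRHS]mulrC ler_wpM2l.
apply: ler_wpDl; first by rewrite !mulr_ge0// ltW.
rewrite mulrC [leRHS]mulrCA ler_wpM2l//.
have -> : 1 - r = - (r - 1) by rewrite opprB.
rewrite powRN ler_pdivlMl ?powR_gt0// -powRM ?(ltW e0)//.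
by apply: powR_le; [rewrite subr_ge0 ltW|rewrite mulr_ge0// ltW|exact: ltW].
Qed.

(** For a positive weight, [x ^ r / a ^ (r - 1) = a * (x / a) ^ r] is the perspective of a convex
    function, hence subadditive in the pair. Division by 0 gives 0, so a zero weight must come with
    a zero term. *)
Lemma powR_sum_div_le r x y (a b : R) : 1 <= r -> 0 <= x -> 0 <= y -> 0 <= a -> 0 <= b ->
  (a = 0 -> x = 0) -> (b = 0 -> y = 0) ->
  (x + y) `^ r / (a + b) `^ (r - 1) <= x `^ r / a `^ (r - 1) + y `^ r / b `^ (r - 1).
Proof.
move=> r1 x0 y0 a0 b0 ax bY; have r0 : 0 < r by apply: lt_le_trans r1.
have [aE|an] := eqVneq a 0.
  by rewrite aE (ax aE) !add0r powR0 ?gt_eqF// mul0r add0r.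
have [bE|bn] := eqVneq b 0.
  by rewrite bE (bY bE) !addr0 (@powR0 _ r) ?gt_eqF// mul0r addr0.
have {an}a0 : 0 < a by rewrite lt_neqAle eq_sym an.
have {bn}b0 : 0 < b by rewrite lt_neqAle eq_sym bn.
have ab0 : 0 < a + b by rewrite addr_gt0.
have E z c : 0 <= z -> 0 < c -> z `^ r / c `^ (r - 1) = c * (z / c) `^ r.
  move=> z0 c0; have h := powRM r z0 (ltW c0).
  have c1 : 0 < c^-1 by rewrite invr_gt0.
  have -> : (z / c) `^ r = z `^ r / c `^ r.
    by rewrite (powRM _ z0 (ltW c1)) -(powR_inv1 (ltW c0)) -powRrM mulN1r powRN.
  rewrite (powRB1 r0 (ltW c0)) mulrCA; congr (_ * _).
  by rewrite invfM mulrA divff ?gt_eqF// mul1r.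
rewrite !E ?addr_ge0//.
have t01 : 0 <= a / (a + b) <= 1.
  by rewrite divr_ge0 ?(ltW a0) ?(ltW ab0)//= ler_pdivrMr// mul1r lerDl ltW.
have [t0 t1] := andP t01.
have xa : (x / a : R) \in `[0, +oo[ by rewrite in_itv /= andbT divr_ge0// ltW.
have yb : (y / b : R) \in `[0, +oo[ by rewrite in_itv /= andbT divr_ge0// ltW.
have := @convex_powR R r r1 (Itv01 t0 t1) (x / a) (y / b).
rewrite !inE => /(_ xa yb).
change ((a / (a + b) * (x / a) + (1 - a / (a + b)) * (y / b)) `^ r <=
  a / (a + b) * (x / a) `^ r + (1 - a / (a + b)) * (y / b) `^ r ->
  (a + b) * ((x + y) / (a + b)) `^ r <= a * (x / a) `^ r + b * (y / b) `^ r).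
have -> : a / (a + b) * (x / a) + (1 - a / (a + b)) * (y / b) = (x + y) / (a + b).
  by field; rewrite !gt_eqF.
move=> /(ler_wpM2l (ltW ab0)) /le_trans; apply.
rewrite le_eqVlt; apply/orP; left; apply/eqP; field; by rewrite gt_eqF.
Qed.

Lemma powR_bigsum_div_le r (I : Type) (s : seq I) (x a : I -> R) : 1 <= r ->
  (forall i, 0 <= x i) -> (forall i, 0 <= a i) -> (forall i, a i = 0 -> x i = 0) ->
  (\sum_(i <- s) x i) `^ r / (\sum_(i <- s) a i) `^ (r - 1) <= \sum_(i <- s) x i `^ r / a i `^ (r - 1).
Proof.
move=> r1 x0 a0 ax; elim: s => [|i s IH].
  by rewrite !big_nil powR0 ?mul0r// gt_eqF// (lt_le_trans _ r1).
rewrite !big_cons; apply: le_trans (powR_sum_div_le r1 (x0 i) _ (a0 i) _ (ax i) _) _.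
- by rewrite sumr_ge0.
- by rewrite sumr_ge0.
- elim: (s) => [|k s' IH']; first by rewrite !big_nil.
  rewrite !big_cons => /eqP; rewrite paddr_eq0 ?sumr_ge0// => /andP[/eqP k0 /eqP s0].
  by rewrite (ax _ k0) (IH' s0) addr0.
- by rewrite lerD2l.
Qed.

Lemma powR_le1D r q x : 0 <= q <= r -> `|x| `^ q <= 1 + `|x| `^ r.
Proof.
move=> /andP[q0 qr]; have [x1|x1] := leP `|x| 1.
  by apply: ler_wpDr; [exact: powR_ge0|by apply: le_trans (powR_le q0 (normr_ge0 x) x1) _; rewrite powR1].
by apply: ler_wpDl => //; apply: ler_powR => //; exact: ltW.
Qed.

End power_inequalities.

(** * Nearly additive bounds for absolute moments *)

Section moment_sums.
Context {d : measure_display} {T : measurableType d} {R : realType}.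
Variable P : probability T R.
Implicit Types (X Y : T -> R) (r eta : R).

Local Notation integrable X := (P.-integrable setT (EFin \o X)).

Lemma measurable_abs_powR r X : measurable_fun setT X -> measurable_fun setT (fun w => `|X w| `^ r).
Proof.
move=> mX; apply: measurableT_comp (measurable_powR r) _.
exact: measurableT_comp (@normr_measurable _ _) mX.
Qed.

Lemma integrable_powR_le r q X : 0 <= q <= r -> measurable_fun setT X ->
  integrable (fun w => `|X w| `^ r) -> integrable (fun w => `|X w| `^ q).
Proof.
move=> qr mX iX; apply: (@integrable_le _ _ _ P _ (fun w => 1 + `|X w| `^ r)).
- exact: measurable_abs_powR.
- by apply: integrable_add => //; exact: integrable_cst.
- by move=> w; rewrite ger0_norm ?powR_ge0//; exact: powR_le1D.
Qed.

Lemma integrable_powR_add r X Y : 0 <= r -> measurable_fun setT X -> measurable_fun setT Y ->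
  integrable (fun w => `|X w| `^ r) -> integrable (fun w => `|Y w| `^ r) ->
  integrable (fun w => `|X w + Y w| `^ r).
Proof.
move=> r0 mX mY iX iY.
apply: (@integrable_le _ _ _ P _ (fun w => (1 + 1) `^ r * `|X w| `^ r + (1 + 1^-1) `^ r * `|Y w| `^ r)).
- by apply: measurable_abs_powR; exact: measurable_funD.
- apply: integrable_add.
    exact: (@integrable_scale _ _ _ P _ (fun w => `|X w| `^ r)).
  exact: (@integrable_scale _ _ _ P _ (fun w => `|Y w| `^ r)).
- by move=> w; rewrite ger0_norm ?powR_ge0//; apply: powR_normD_le2.
Qed.

Lemma independent_powR_mul r X Y : 1 < r -> measurable_fun setT X -> measurable_fun setT Y ->
  independent_pair P X Y ->
  integrable (fun w => `|X w| `^ r) -> integrable (fun w => `|Y w| `^ r) ->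
  integrable (fun w => `|X w| `^ (r - 1) * `|Y w|) /\
  \int[P]_w (`|X w| `^ (r - 1) * `|Y w|) = \int[P]_w (`|X w| `^ (r - 1)) * \int[P]_w `|Y w|.
Proof.
move=> r1 mX mY XY iX iY; have r0 : 0 < r by apply: lt_trans r1.
have maX : measurable_fun setT (fun w => `|X w| `^ (r - 1)) by exact: measurable_abs_powR.
have maY : measurable_fun setT (fun w => `|Y w|) by exact: measurableT_comp (@normr_measurable _ _) mY.
have iX1 : integrable (fun w => `|X w| `^ (r - 1)).
  by apply: integrable_powR_le iX => //; rewrite subr_ge0 (ltW r1)/= gerBl.
have iY1 : integrable (fun w => `|Y w|).
  have : integrable (fun w => `|Y w| `^ 1).
    by apply: integrable_powR_le iY => //; rewrite ler01 ltW.
  by apply: eq_integrable => // w _ /=; rewrite powRr1.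
have iXY : integrable (fun w => `|X w| `^ (r - 1) * `|Y w|).
  apply: (@integrable_le _ _ _ P _ (fun w => `|X w| `^ r + `|Y w| `^ r)).
  - exact: measurable_funM.
  - exact: integrable_add.
  - move=> w; rewrite ger0_norm ?mulr_ge0 ?powR_ge0//.
    have := powR_interpolation (X w) r1 (@ltr01 R) (normr_ge0 (Y w)).
    by rewrite mul1r powR1 mul1r.
split=> //.
pose h (z : R * R) := (`|z.1| `^ (r - 1) * `|z.2|)%:E.
have mh : measurable_fun setT h.
  apply/measurable_EFinP; apply: measurable_funM.
    apply: measurableT_comp (measurable_powR _) _.
    by apply: measurableT_comp (@normr_measurable _ _) _; exact: measurable_fst.
  by apply: measurableT_comp (@normr_measurable _ _) _; exact: measurable_snd.
have h0 z : (0 <= h z)%E by rewrite lee_fin mulr_ge0// powR_ge0.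
have := independent_integral mX mY XY mh h0.
have -> : (\int[P]_w \int[P]_v h (X w, Y v) = \int[P]_w (`|X w| `^ (r - 1) * \int[P]_v `|Y v|)%:E)%E.
  apply: eq_integral => w _.
  have iw : integrable (fun v => `|X w| `^ (r - 1) * `|Y v|).
    exact: (@integrable_scale _ _ _ P _ (fun v => `|Y v|)).
  apply: etrans (Rintegral_EFin iw) _.
  by rewrite (RintegralZl _ measurableT iY1).
move=> /(congr1 fine) h1; apply: etrans h1 _.
exact: (RintegralZr _ measurableT iX1).
Qed.

(** By independence the cross term in [powR_normD_le] becomes a product of lower moments, and
    interpolation trades it for a little of the [r]-th moment of [X] plus a power of [c]. A
    coefficient as close to 1 as desired is what lets the recursion contract. *)
Lemma moment_add r eta : 1 < r -> 0 < eta -> exists2 K, 0 <= K &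
  forall X Y c, measurable_fun setT X -> measurable_fun setT Y -> independent_pair P X Y ->
    integrable (fun w => `|X w| `^ r) -> integrable (fun w => `|Y w| `^ r) ->
    0 <= c -> \int[P]_w `|Y w| <= c ->
    \int[P]_w (`|X w + Y w| `^ r) <=
      (1 + eta) * (\int[P]_w (`|X w| `^ r) + \int[P]_w (`|Y w| `^ r)) + K * c `^ r.
Proof.
move=> r1 e0; have r0 : 0 < r by apply: lt_trans r1.
(* Chosen so that [(1 + dl) ^ r = 1 + eta / 2]; the other half of [eta] pays for the cross term. *)
pose dl := (1 + eta / 2) `^ r^-1 - 1.
have e1 : 1 < 1 + eta / 2 by rewrite ltrDl divr_gt0.
have dl0 : 0 < dl.
  have := @gt0_ltr_powR R r^-1 _ 1 (1 + eta / 2); rewrite powR1 subr_gt0 !nnegrE invr_gt0; apply=> //.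
  by rewrite ltW// (lt_trans _ e1).
have dlE : (1 + dl) `^ r = 1 + eta / 2.
  by rewrite addrC subrK -powRrM mulVf ?gt_eqF// powRr1// ltW// (lt_trans _ e1).
pose K2 := (1 + dl^-1) `^ r / dl.
have K20 : 0 < K2 by rewrite divr_gt0// powR_gt0// addr_gt0// invr_gt0.
(* The weight for which [K2] times the interpolated moment of [X] is exactly [eta / 2] of that
   moment. *)
pose e' := eta / 2 / K2; have e'0 : 0 < e' by apply: divr_gt0 => //; exact: divr_gt0.
exists (K2 * e' `^ (1 - r)); first by rewrite mulr_ge0 ?powR_ge0// ltW.
move=> X Y c mX mY XY iX iY c0 Yc.
have [iXY EXY] := independent_powR_mul r1 mX mY XY iX iY.
have iX1 : integrable (fun w => `|X w| `^ (r - 1)).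
  by apply: integrable_powR_le iX => //; rewrite subr_ge0 (ltW r1)/= gerBl.
have i1 : integrable (fun w => `|X w| `^ r + `|Y w| `^ r) by exact: integrable_add.
have i2 : integrable (fun w => (1 + dl) `^ r * (`|X w| `^ r + `|Y w| `^ r)).
  exact: (@integrable_scale _ _ _ P _ (fun w => `|X w| `^ r + `|Y w| `^ r)).
have i3 : integrable (fun w => K2 * (`|X w| `^ (r - 1) * `|Y w|)).
  exact: (@integrable_scale _ _ _ P _ (fun w => `|X w| `^ (r - 1) * `|Y w|)).
have iS : integrable (fun w => `|X w + Y w| `^ r) by apply: integrable_powR_add => //; exact: ltW.
have s1 : \int[P]_w (`|X w + Y w| `^ r) <=
    (1 + eta / 2) * (\int[P]_w (`|X w| `^ r) + \int[P]_w (`|Y w| `^ r)) +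
    K2 * (\int[P]_w (`|X w| `^ (r - 1)) * \int[P]_w `|Y w|).
  rewrite -EXY -dlE -(RintegralD measurableT iX iY) -(RintegralZl _ measurableT i1).
  rewrite -(RintegralZl _ measurableT iXY) -(RintegralD measurableT i2 i3).
  apply: le_Rintegral => //; first exact: (@integrable_add _ _ _ P).
  by move=> w _; apply: powR_normD_le => //; exact: ltW.
apply: le_trans s1 _.
have s2 : \int[P]_w (`|X w| `^ (r - 1)) * \int[P]_w `|Y w| <= e' * \int[P]_w (`|X w| `^ r) + e' `^ (1 - r) * c `^ r.
  apply: (@le_trans _ _ (\int[P]_w (`|X w| `^ (r - 1)) * c)).
    by rewrite ler_wpM2l//; apply: Rintegral_ge0 => w _; exact: powR_ge0.
  rewrite -(RintegralZr _ measurableT iX1) -(RintegralZl _ measurableT iX).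
  have i4 : integrable (fun w => e' * `|X w| `^ r) by exact: (@integrable_scale _ _ _ P _ (fun w => `|X w| `^ r)).
  rewrite -[e' `^ (1 - r) * c `^ r](Rintegral_probability_cst P).
  rewrite -(RintegralD measurableT i4 (integrable_cst _ _)).
  apply: le_Rintegral => //.
  - by have := @integrable_scale _ _ _ P c _ iX1; apply: eq_integrable => // w _ /=; rewrite mulrC.
  - by apply: integrable_add => //; exact: integrable_cst.
  - by move=> w _; apply: powR_interpolation.
have Y0 : 0 <= \int[P]_w (`|Y w| `^ r) by apply: Rintegral_ge0 => w _; exact: powR_ge0.
have e'E : K2 * e' = eta / 2 by rewrite mulrC divfK// gt_eqF.
have h1 := mulr_ge0 (ltW e0) Y0; have h2 := ler_wpM2l (ltW K20) s2.
apply: le_trans (lerD (lexx _) h2) _.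
set IX := \int[P]_w (`|X w| `^ r); set IY := \int[P]_w (`|Y w| `^ r) in h1 *; set cr := c `^ r.
have -> : K2 * (e' * IX + e' `^ (1 - r) * cr) = eta / 2 * IX + K2 * e' `^ (1 - r) * cr.
  by rewrite -e'E; ring.
by move: h1; rewrite -/IY; move: IX IY cr => IX IY cr h1; rewrite addrA lerD2r; lra.
Qed.

Section discrete_sums.
Context {C : countType} {A : finType}.
Variables (D : A -> T -> C) (u : A -> C -> R).
Hypothesis mD : forall a, discrete_variable (D a).
Hypothesis indD : independent_discrete P D.
Local Notation X := (fun a w => u a (D a w)).

Lemma integrable_discrete_sum r (s : seq A) : 0 < r -> (forall a, integrable (fun w => `|X a w| `^ r)) ->
  integrable (fun w => `|\sum_(a <- s) X a w| `^ r).
Proof.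
move=> r0 iX; elim: s => [|a s IH].
  under eq_fun do rewrite big_nil normr0 powR0 ?gt_eqF//.
  exact: integrable_cst.
under eq_fun do rewrite big_cons.
apply: integrable_powR_add => //; first exact: ltW.
- exact: (measurable_fun_discrete (u a) (mD a)).
- exact: measurable_discrete_sum.
Qed.

Lemma variance_discrete_sum (s : seq A) : uniq s ->
  (forall a, integrable (fun w => X a w ^+ 2)) -> (forall a, \int[P]_w X a w = 0) ->
  integrable (fun w => (\sum_(a <- s) X a w) ^+ 2) /\
  \int[P]_w ((\sum_(a <- s) X a w) ^+ 2) = \sum_(a <- s) \int[P]_w (X a w ^+ 2).
Proof.
move=> us iX EX; have mX b : measurable_fun setT (X b) by exact: (measurable_fun_discrete (u b) (mD b)).
elim: s us => [|a s IH] /= us.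
  rewrite big_nil; under eq_fun do rewrite big_nil expr0n.
  by split; [exact: integrable_cst|rewrite Rintegral_probability_cst].
have [as' us'] := andP us; have [iS ES] := IH us'.
have mS := measurable_discrete_sum mD u s.
have SX := independent_discrete_sum mD indD u us' as'.
have iSX := integrable_mul mS (mX a) iS (iX a).
have E w : (\sum_(b <- a :: s) X b w) ^+ 2 =
    X a w ^+ 2 + 2 * ((\sum_(b <- s) X b w) * X a w) + (\sum_(b <- s) X b w) ^+ 2.
  rewrite big_cons; ring.
have {}E : (fun w => (\sum_(b <- a :: s) X b w) ^+ 2) =
    (fun w => X a w ^+ 2 + 2 * ((\sum_(b <- s) X b w) * X a w) + (\sum_(b <- s) X b w) ^+ 2).
  exact/funext.
rewrite E.
have i1 : integrable (fun w => 2 * ((\sum_(b <- s) X b w) * X a w)).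
  exact: (@integrable_scale _ _ _ P 2 (fun w => (\sum_(b <- s) X b w) * X a w)).
have i2 : integrable (fun w => X a w ^+ 2 + 2 * ((\sum_(b <- s) X b w) * X a w)).
  by apply: integrable_add => //; exact: iX.
split; first exact: (@integrable_add _ _ _ P).
rewrite (RintegralD measurableT i2 iS) (RintegralD measurableT (iX a) i1) (RintegralZl 2 measurableT iSX).
by rewrite (independent_mul_eq0 mS (mX a) iS (iX a) SX (EX a)) mulr0 addr0 ES big_cons.
Qed.

End discrete_sums.

(** [K] is chosen before the variables, so the estimate is uniform along a family indexed by [l]. *)
Lemma moment_discrete_sum (A : finType) r eta : 1 < r -> 0 < eta -> exists2 K, 0 <= K &
  forall (C : countType) (D : A -> T -> C) (u : A -> C -> R) c,
    (forall a, discrete_variable (D a)) -> independent_discrete P D ->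
    (forall a, integrable (fun w => `|u a (D a w)| `^ r)) ->
    0 <= c -> (forall a, \int[P]_w `|u a (D a w)| <= c) ->
    \int[P]_w (`|\sum_a u a (D a w)| `^ r) <=
      (1 + eta) * \sum_a \int[P]_w (`|u a (D a w)| `^ r) + K * c `^ r.
Proof.
move=> r1 eta0; have r0 : 0 < r by apply: lt_trans r1.
suff H (s : seq A) : uniq s -> forall eta, 0 < eta -> exists2 K, 0 <= K &
    forall (C : countType) (D : A -> T -> C) (u : A -> C -> R) c,
    (forall a, discrete_variable (D a)) -> independent_discrete P D ->
    (forall a, integrable (fun w => `|u a (D a w)| `^ r)) ->
    0 <= c -> (forall a, \int[P]_w `|u a (D a w)| <= c) ->
    \int[P]_w (`|\sum_(a <- s) u a (D a w)| `^ r) <=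
      (1 + eta) * \sum_(a <- s) \int[P]_w (`|u a (D a w)| `^ r) + K * c `^ r.
  exact: (H _ (index_enum_uniq A)).
move=> {eta eta0}; elim: s => [|a s IH] /= us eta eta0.
  exists 0 => // C D u c _ _ _ _ _; rewrite mul0r addr0 big_nil mulr0.
  under eq_Rintegral do rewrite big_nil normr0 powR0 ?gt_eqF//.
  by rewrite Rintegral_probability_cst.
have [as' us'] := andP us.
(* Adding one summand multiplies coefficients [1 + e], and [(1 + e) ^ 2 <= 1 + 3 * e <= 1 + eta]
   since [e <= 1]. *)
pose e := Num.min 1 (eta / 3).
have e0 : 0 < e by rewrite lt_min ltr01 divr_gt0.
have e1 : e <= 1 by rewrite ge_min lexx.
have e3 : e <= eta / 3 by rewrite ge_min lexx orbT.
have [K1 K10 H1] := moment_add r1 e0; have [K2 K20 H2] := IH us' e e0.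
exists (K1 + (1 + e) * K2); first by rewrite addr_ge0// mulr_ge0// addr_ge0// ltW.
move=> C D u c mD indD iX c0 Xc.
have mX b : measurable_fun setT (fun w => u b (D b w)) by exact: (measurable_fun_discrete (u b) (mD b)).
have h1 := H1 _ _ c (measurable_discrete_sum mD u s) (mX a) (independent_discrete_sum mD indD u us' as')
  (integrable_discrete_sum mD s r0 iX) (iX a) c0 (Xc a).
have h2 := H2 C D u c mD indD iX c0 Xc.
under eq_Rintegral do rewrite big_cons addrC.
apply: le_trans h1 _; rewrite big_cons.
set S := \int[P]_w _ in h2 *; set Xa := \int[P]_w (`|u a _| `^ r); set SX := \sum_(b <- s) _ in h2 *.
have Xa0 : 0 <= Xa by apply: Rintegral_ge0 => w _; exact: powR_ge0.
have SX0 : 0 <= SX by apply: sumr_ge0 => b _; apply: Rintegral_ge0 => w _; exact: powR_ge0.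
have e1' : 0 <= 1 + e by rewrite addr_ge0// ltW.
have h3 := ler_wpM2l e1' h2.
have h4 : (1 + e) * (1 + e) <= 1 + eta by nra.
have h5 := ler_wpM2r SX0 h4; have h6 := mulr_ge0 (ltW e0) Xa0.
have h7 : e * Xa <= eta * Xa by rewrite ler_wpM2r//; lra.
have -> : (K1 + (1 + e) * K2) * c `^ r = K1 * c `^ r + (1 + e) * (K2 * c `^ r) by ring.
rewrite mulrDr in h3; rewrite mulrDr [leRHS]addrA; lra.
Qed.

End moment_sums.

(** * Central limit theorem for recursive families *)

Section eventually.
Context {R : realType}.

Lemma near_pinftyP (Q : R -> Prop) :
  (\forall l \near +oo_R, Q l) <-> exists2 L, 0 < L & forall l, L <= l -> Q l.
Proof.
split=> [[M [_ MQ]]|[L L0 LQ]].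
  exists (Num.max M 0 + 1); first by rewrite ltr_wpDl// le_max lexx orbT.
  move=> l Ml; apply: MQ; apply: lt_le_trans Ml.
  by rewrite ltr_pwDr// le_max lexx.
by exists L; split; [exact: num_real|move=> l /ltW/LQ].
Qed.

Lemma eventually_shrunk (A : finType) (p : A -> R) (Q : R -> Prop) : (forall a, 0 < p a) ->
  (\forall l \near +oo_R, Q l) -> \forall l \near +oo_R, forall a, Q (l * p a).
Proof.
move=> p0 /near_pinftyP[L L0 LQ]; apply/near_pinftyP.
exists (\sum_a L / p a + L); first by rewrite ltr_wpDl// sumr_ge0// => a _; rewrite divr_ge0 ?ltW.
move=> l Ll a; apply: LQ; rewrite -ler_pdivrMr//; apply: le_trans Ll.
rewrite (bigD1 a)//= -addrA lerDl addr_ge0 ?(ltW L0)// sumr_ge0// => b _.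
by rewrite divr_ge0 ?ltW.
Qed.

End eventually.

(** * Inequalities that relate the values at [l] and at [l * p a] *)

Section linear_recursion.
Context {R : realType} {A : finType}.
Variables (p : A -> R) (rho : R).
Hypotheses (p_gt0 : forall a, 0 < p a) (rho01 : 0 < rho < 1) (p_rho : forall a, p a <= rho).

Lemma sum_powR_lt1 t : \sum_a p a = 1 -> 1 < t -> \sum_a p a `^ t < 1.
Proof.
move=> p1 t1; have /andP[r0 r1] := rho01.
apply: (@le_lt_trans _ _ (rho `^ (t - 1))).
  rewrite -[leRHS]mul1r -[X in X * _]p1 mulr_suml; apply: ler_sum => a _.
  rewrite [leLHS](@powRB1 _ t (p a) (lt_trans ltr01 t1) (ltW (p_gt0 a))) ler_wpM2l ?(ltW (p_gt0 a))//.
  by apply: powR_le; rewrite ?p_rho ?subr_ge0// ltW.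
have := @gt0_ltr_powR R (t - 1) _ rho 1.
by rewrite powR1 subr_gt0 !nnegrE ler01 ltW//; apply.
Qed.

(** Each passage from [l] to [l * p a] multiplies by at most [rho < 1], so the argument falls below
    [L] after a bounded number of steps; the induction is on that number. *)
Lemma shrink_induction (L : R) (Q : R -> Prop) : 0 < L ->
  (forall l, 0 < l -> l <= L -> Q l) ->
  (forall l, L < l -> (forall a, Q (l * p a)) -> Q l) -> forall l, 0 < l -> Q l.
Proof.
move=> L0 Q0 QS; have /andP[r0 r1] := rho01.
suff H n l : 0 < l -> l * rho ^+ n <= L -> Q l.
  move=> l l0; have : (rho ^+ n @[n --> \oo] --> (0 : R))%classic.
    by apply: cvg_expr; rewrite ger0_norm// ltW.
  move=> /cvgrPdist_le/(_ (L / l)); rewrite divr_gt0// => /(_ isT)[n _ /(_ n (leqnn n))] /=.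
  rewrite sub0r normrN ger0_norm ?exprn_ge0 ?(ltW r0)// ler_pdivlMr// mulrC.
  exact: H.
elim: n l => [|n IH] l l0; first by rewrite expr0 mulr1; exact: Q0.
move=> lL; have [/Q0|Ll] := leP l L; first exact.
apply: QS => // a; apply: IH; first by rewrite mulr_gt0.
apply: le_trans lL; rewrite exprS mulrA ler_wpM2r ?exprn_ge0 ?(ltW r0)//.
by rewrite ler_wpM2l// ltW.
Qed.

(** The function [B * l ^ t] is a supersolution once [B] is large, because
    [kap * \sum_a p a ^ t < 1]; local boundedness of [M] provides the initial values. *)
Lemma linear_recursion (M : R -> R) (L kap K t : R) : 0 <= t -> 0 < L -> 0 <= kap -> 0 <= K ->
  kap * \sum_a p a `^ t < 1 ->
  (forall Lam, exists B, forall l, 0 < l -> l <= Lam -> M l <= B) ->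
  (forall l, L <= l -> M l <= kap * \sum_a M (l * p a) + K * l `^ t) ->
  exists2 B, 0 <= B & forall l, L <= l -> M l <= B * l `^ t.
Proof.
move=> t0 L0 k0 K0 k1 Mb Mrec; have /andP[r0 r1] := rho01.
have [B0 MB0] := Mb L.
pose pm := \big[Order.min/1]_a p a.
have pm0 : 0 < pm by apply: lt_bigmin.
have pmp a : pm <= p a by exact: bigmin_le_cond.
pose th := kap * \sum_a p a `^ t.
have th1 : 0 < 1 - th by rewrite subr_gt0.
have th0 : 0 <= th by rewrite mulr_ge0// sumr_ge0// => a _; exact: powR_ge0.
(* For [l > L] the recursion visits arguments as small as [pm * L], so the bound is proved from [L1]
   on, and local boundedness supplies it up to [L]. *)
pose L1 := Num.min L (pm * L).
have L10 : 0 < L1 by rewrite lt_min L0 mulr_gt0.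
(* The first entry covers the initial interval from [L1] to [L], the second gives
   [th * B + K <= B]. *)
pose B := Num.max (`|B0| / L1 `^ t) (K / (1 - th)).
have B0' : 0 <= B by rewrite le_max divr_ge0// powR_ge0.
have BK : th * B + K <= B.
  rewrite addrC -lerBrDr -[X in X - _]mul1r -mulrBl -ler_pdivrMl// mulrC.
  by rewrite le_max lexx orbT.
exists B => // l Ll.
have l0 : 0 < l by apply: lt_le_trans Ll.
suff : L1 <= l -> M l <= B * l `^ t by apply; apply: le_trans Ll; rewrite ge_min lexx.
move: l l0 {Ll}; apply: (shrink_induction L0) => [l l0 lL L1l|l Ll IH _].
  apply: le_trans (MB0 _ l0 lL) _; apply: le_trans (ler_norm _) _.
  rewrite -ler_pdivrMr ?powR_gt0//; apply: (@le_trans _ _ (`|B0| / L1 `^ t)).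
    by rewrite ler_wpM2l// lef_pV2 ?posrE ?powR_gt0//; apply: powR_le => //; exact: ltW.
  by rewrite le_max lexx.
have l0 : 0 < l by apply: lt_trans Ll.
apply: le_trans (Mrec _ (ltW Ll)) _.
apply: (@le_trans _ _ (kap * \sum_a (B * l `^ t * p a `^ t) + K * l `^ t)).
  rewrite lerD2r ler_wpM2l//; apply: ler_sum => a _.
  rewrite -mulrA -powRM ?(ltW l0) ?(ltW (p_gt0 a))//; apply: IH.
  by rewrite ge_min mulrC; apply/orP; right; apply: ler_pM => //; exact: ltW.
by rewrite -mulr_sumr mulrCA -/th [_ * th]mulrC mulrA -mulrDl ler_wpM2r ?powR_ge0.
Qed.

End linear_recursion.

Section equal_laws.
Context {d : measure_display} {T : measurableType d} {R : realType}.
Variable P : probability T R.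
Context {C : countType}.
Variables (D D' : T -> C).
Hypotheses (mD : discrete_variable D) (mD' : discrete_variable D').
Hypothesis law : forall c, P (D @^-1` [set c]) = P (D' @^-1` [set c]).

Lemma ge0_integral_same_law (g : C -> \bar R) : (forall c, 0 <= g c)%E ->
  (\int[P]_w g (D w) = \int[P]_w g (D' w))%E.
Proof.
move=> g0; apply/eqP; rewrite eq_le; apply/andP; split; apply: le_integral_discrete => // c.
  by rewrite law.
by rewrite law.
Qed.

Lemma Rintegral_same_law (g : C -> R) : \int[P]_w g (D w) = \int[P]_w g (D' w).
Proof.
have h1 := ge0_integral_same_law (funepos_ge0 (EFin \o g)).
have h2 := ge0_integral_same_law (funeneg_ge0 (EFin \o g)).
apply: (congr1 fine); change (\int[P]_w ((EFin \o g) \o D) w = \int[P]_w ((EFin \o g) \o D') w)%E.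
rewrite [LHS]integralE [RHS]integralE.
rewrite (funepos_comp _ D) (funepos_comp _ D') (funeneg_comp _ D) (funeneg_comp _ D').
by congr (_ - _)%E.
Qed.

Lemma integrable_same_law (g : C -> R) : P.-integrable setT (EFin \o (fun w => g (D' w))) ->
  P.-integrable setT (EFin \o (fun w => g (D w))).
Proof.
move=> /integrableP[_ h]; apply/integrableP; split.
  by apply/measurable_EFinP; exact: measurable_fun_discrete.
by rewrite (ge0_integral_same_law (g := fun c => `|(g c)%:E|%E)).
Qed.

End equal_laws.

(** * Moment growth and Gaussian contraction along the recursion *)

Section recursive_clt.
Context {d : measure_display} {T : measurableType d} {R : realType}.
Variable P : probability T R.
Context {C : countType} {A : finType}.
Variables (p : A -> R) (rho r : R).
Variables (tau : R -> T -> C) (D : R -> A -> T -> C) (u : R -> C -> R).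
Hypotheses (p_gt0 : forall a, 0 < p a) (p_sum : \sum_a p a = 1).
Hypotheses (rho01 : 0 < rho < 1) (p_rho : forall a, p a <= rho).
Hypothesis r_gt2 : 2 < r.
Hypothesis mtau : forall l, 0 < l -> discrete_variable (tau l).
Hypothesis mD : forall l a, 0 < l -> discrete_variable (D l a).
Hypothesis indD : forall l, 0 < l -> independent_discrete P (D l).
Hypothesis lawD : forall l a c, 0 < l -> P (D l a @^-1` [set c]) = P (tau (l * p a) @^-1` [set c]).

Local Notation integrable X := (P.-integrable setT (EFin \o X)).

Let U l w := u l (tau l w).
Let X l a w := u (l * p a) (D l a w).
Let S l w := \sum_a X l a w.
Let Y l w := U l w - S l w.

Hypothesis U_integrable : forall l, 0 < l -> integrable (fun w => `|U l w| `^ r).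
Hypothesis U_bounded : forall Lam, exists B, forall l, 0 < l -> l <= Lam ->
  \int[P]_w (`|U l w| `^ r) <= B.
Hypothesis U_mean : forall l, 0 < l -> \int[P]_w U l w = 0.
Variable v : R.
Hypothesis U_var : \forall l \near +oo_R, \int[P]_w (U l w ^+ 2) <= v * l.
Hypothesis Y_var : forall e, 0 < e -> \forall l \near +oo_R, \int[P]_w (Y l w ^+ 2) <= e * l.
Variable y : R.
Hypothesis Y_moment : \forall l \near +oo_R, \int[P]_w (`|Y l w| `^ r) <= y * l `^ (r / 2).

Let r_gt0 : 0 < r. Proof. by rewrite (lt_trans _ r_gt2). Qed.
Let r_gt1 : 1 < r. Proof. by rewrite (lt_trans _ r_gt2)// ltr1n. Qed.
Let p_ge0 a : 0 <= p a. Proof. exact: ltW. Qed.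
Let lp_gt0 l a : 0 < l -> 0 < l * p a. Proof. by move=> l0; exact: mulr_gt0. Qed.

Let mU l : 0 < l -> measurable_fun setT (U l).
Proof. by move=> l0; exact: (measurable_fun_discrete (u l) (mtau l0)). Qed.

Let mX l a : 0 < l -> measurable_fun setT (X l a).
Proof. by move=> l0; exact: (measurable_fun_discrete (u (l * p a)) (mD a l0)). Qed.

Let mS l : 0 < l -> measurable_fun setT (S l).
Proof. by move=> l0; apply: measurable_sum => a; exact: mX. Qed.

Let mY l : 0 < l -> measurable_fun setT (Y l).
Proof. by move=> l0; apply: measurable_funB; [exact: mU|exact: mS]. Qed.

Let integral_X l a (g : R -> R) : 0 < l -> \int[P]_w g (X l a w) = \int[P]_w g (U (l * p a) w).
Proof.
move=> l0; apply: (Rintegral_same_law (mD a l0) (mtau (lp_gt0 a l0)) _ (g \o u (l * p a))) => c.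
exact: lawD.
Qed.

Let integrable_X l a (g : R -> R) : 0 < l -> integrable (fun w => g (U (l * p a) w)) ->
  integrable (fun w => g (X l a w)).
Proof.
move=> l0 iU; apply: (integrable_same_law (mD a l0) (mtau (lp_gt0 a l0)) _ (g := g \o u (l * p a))) => //.
by move=> c; exact: lawD.
Qed.

Let sqr_powR (x : R) : x ^+ 2 = `|x| `^ 2.
Proof. by rewrite -[2 in RHS]/(2%:R) powR_mulrn// real_normK// num_real. Qed.

Let integrable_sqr_of (Z : T -> R) : measurable_fun setT Z -> integrable (fun w => `|Z w| `^ r) ->
  integrable (fun w => Z w ^+ 2).
Proof.
move=> mZ iZ; have : integrable (fun w => `|Z w| `^ 2).
  by apply: integrable_powR_le iZ => //; rewrite ler0n ltW.
by apply: eq_integrable => // w _ /=; rewrite -sqr_powR.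
Qed.

Let iX l a : 0 < l -> integrable (fun w => `|X l a w| `^ r).
Proof. by move=> l0; apply: (@integrable_X l a (fun z => `|z| `^ r)) => //; exact/U_integrable/lp_gt0. Qed.

Let iS l : 0 < l -> integrable (fun w => `|S l w| `^ r).
Proof.
move=> l0; apply: (@integrable_discrete_sum _ _ _ P _ _ (D l) (fun a => u (l * p a))) => //.
- by move=> a; exact: mD.
- by move=> a; exact: iX.
Qed.

Let iY l : 0 < l -> integrable (fun w => `|Y l w| `^ r).
Proof.
move=> l0; apply: (@integrable_powR_add _ _ _ P r (U l) (fun w => - S l w)) => //.
- exact: ltW.
- exact: mU.
- by apply: measurableT_comp => //; exact: mS.
- exact: U_integrable.
- by under eq_fun do rewrite normrN; exact: iS.
Qed.

Let U_split l w : U l w = S l w + Y l w.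
Proof. by rewrite /Y addrCA subrr addr0. Qed.

(** The independent branches are combined by [moment_discrete_sum] and the defect [Y] is split off
    by [powR_normD_le2], each with a coefficient near 1. What remains is a linear recursion with
    exponent [r / 2 > 1]. *)
Lemma recursive_moment_growth :
  exists B, \forall l \near +oo_R, \int[P]_w (`|U l w| `^ r) <= B * l `^ (r / 2).
Proof.
pose th := \sum_a p a `^ (r / 2).
have th1 : th < 1.
  by apply: (sum_powR_lt1 p_gt0 rho01 p_rho p_sum); rewrite ltr_pdivlMr// mul1r.
have th0 : 0 <= th by apply: sumr_ge0 => a _; exact: powR_ge0.
(* Small enough for [(1 + e) * (1 + e) * th < 1]; one factor comes from the sum of the branches, the
   other from the separation of [Y]. *)
pose e := (1 - th) / 6; have e0 : 0 < e by rewrite divr_gt0// subr_gt0.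
pose dl := (1 + e) `^ r^-1 - 1.
have dl0 : 0 < dl.
  have := @gt0_ltr_powR R r^-1 _ 1 (1 + e); rewrite powR1 subr_gt0 !nnegrE invr_gt0 ltrDl.
  by apply => //; rewrite addr_ge0// ltW.
have dlE : (1 + dl) `^ r = 1 + e.
  by rewrite addrC subrK -powRrM mulVf ?gt_eqF// powRr1// addr_ge0// ltW.
have [K K0 HK] := moment_discrete_sum P A r_gt1 e0.
have [L L0 HL] : exists2 L, 0 < L & forall l, L <= l ->
    [/\ \int[P]_w (`|Y l w| `^ r) <= y * l `^ (r / 2)
      & forall a, \int[P]_w (U (l * p a) w ^+ 2) <= v * (l * p a)].
  apply/near_pinftyP; have := eventually_shrunk p_gt0 U_var.
  by apply: filterS2 Y_moment => l h1 h2; split.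
pose K' := (1 + e) * (K * `|v| `^ (r / 2)) + (1 + dl^-1) `^ r * `|y|.
have [B B0 HB] : exists2 B, 0 <= B & forall l, L <= l -> \int[P]_w (`|U l w| `^ r) <= B * l `^ (r / 2).
  apply: (@linear_recursion _ _ p rho p_gt0 rho01 p_rho (fun l => \int[P]_w (`|U l w| `^ r)) L ((1 + e) * (1 + e)) K') => //.
  - by rewrite divr_ge0// ltW.
  - by rewrite mulr_ge0// addr_ge0// ltW.
  - by rewrite addr_ge0// mulr_ge0 ?powR_ge0// ?addr_ge0 ?(ltW e0)// mulr_ge0 ?powR_ge0.
  - rewrite -/th; have := ltW e0; rewrite /e; nra.
  move=> l Ll; have l0 : 0 < l by apply: lt_le_trans Ll.
  have [Yl Ul] := HL l Ll.
  pose c := Num.sqrt (`|v| * l).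
  have vl0 : 0 <= `|v| * l by rewrite mulr_ge0// ltW.
  have cE : c `^ r = `|v| `^ (r / 2) * l `^ (r / 2).
    by rewrite /c -powR12_sqrt// -powRrM [2^-1 * r]mulrC powRM// ltW.
  have Xc a : \int[P]_w `|X l a w| <= c.
    rewrite (@integral_X l a Num.norm l0).
    apply: le_trans (Rintegral_abs_le_sqrt (mU (lp_gt0 a l0)) _) _.
      by apply: integrable_sqr_of; [exact: mU (lp_gt0 a l0)|exact/U_integrable/lp_gt0].
    apply: ler_wsqrtr; apply: le_trans (Ul a) _.
    apply: (@le_trans _ _ (`|v| * (l * p a))).
      by rewrite ler_wpM2r ?ler_norm// ltW// lp_gt0.
    rewrite ler_wpM2l// ger_pMr//; apply: le_trans (p_rho a) _; by case/andP: rho01 => _ /ltW.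
  have h1 := HK C (D l) (fun a => u (l * p a)) c (fun a => mD a l0) (indD l0) (fun a => iX a l0) (sqrtr_ge0 _) Xc.
  have i1 : integrable (fun w => (1 + dl) `^ r * `|S l w| `^ r).
    by apply: (@integrable_scale _ _ _ P _ (fun w => `|S l w| `^ r)); exact: iS.
  have i2 : integrable (fun w => (1 + dl^-1) `^ r * `|Y l w| `^ r).
    by apply: (@integrable_scale _ _ _ P _ (fun w => `|Y l w| `^ r)); exact: iY.
  have h2 : \int[P]_w (`|U l w| `^ r) <=
      (1 + e) * \int[P]_w (`|S l w| `^ r) + (1 + dl^-1) `^ r * \int[P]_w (`|Y l w| `^ r).
    rewrite -dlE -(RintegralZl _ measurableT (iS l0)) -(RintegralZl _ measurableT (iY l0)).
    rewrite -(RintegralD measurableT i1 i2).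
    apply: le_Rintegral => //; first exact: U_integrable.
      exact: (@integrable_add _ _ _ P).
    by move=> w _; rewrite U_split; apply: powR_normD_le2 => //; exact: ltW.
  apply: le_trans h2 _.
  have {}h1 : \int[P]_w (`|S l w| `^ r) <=
      (1 + e) * \sum_a \int[P]_w (`|U (l * p a) w| `^ r) + K * (`|v| `^ (r / 2) * l `^ (r / 2)).
    rewrite -cE; apply: le_trans h1 _; rewrite lerD2r ler_wpM2l ?addr_ge0 ?(ltW e0)//.
    by apply: ler_sum => a _; rewrite (@integral_X l a (fun z => `|z| `^ r) l0).
  have h3 : \int[P]_w (`|Y l w| `^ r) <= `|y| * l `^ (r / 2).
    by apply: le_trans Yl _; rewrite ler_wpM2r ?powR_ge0// ler_norm.
  have e1 : 0 <= 1 + e by rewrite addr_ge0// ltW.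
  have h4 := ler_wpM2l e1 h1; have h5 := ler_wpM2l (powR_ge0 (1 + dl^-1) r) h3.
  apply: le_trans (lerD h4 h5) _; rewrite /K' le_eqVlt; apply/orP; left; apply/eqP.
  set s1 := \sum_a _; set z1 := `|v| `^ _; set z2 := l `^ _; set z3 := (1 + dl^-1) `^ _.
  by move: s1 z1 z2 z3 => s1 z1 z2 z3; ring.
by exists B; apply/near_pinftyP; exists L.
Qed.

Let q := Num.min r 3.

Let q_gt2 : 2 < q. Proof. by rewrite lt_min r_gt2 ltr_nat. Qed.
Let q_le : 0 <= q <= r.
Proof. by rewrite ge_min lexx/= andbT ltW// (lt_trans _ q_gt2). Qed.

Let V l := \int[P]_w (U l w ^+ 2).

Let V_ge0 l : 0 <= V l. Proof. by apply: Rintegral_ge0 => w _; exact: sqr_ge0. Qed.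

Let theta := \sum_a p a `^ (q / 2).
Let theta_lt1 : theta < 1.
Proof. by apply: (sum_powR_lt1 p_gt0 rho01 p_rho p_sum); rewrite ltr_pdivlMr// mul1r. Qed.
Let theta_ge0 : 0 <= theta.
Proof. by apply: sumr_ge0 => a _; exact: powR_ge0. Qed.

(** The bound is uniform in the test function and in the translation [x], as [gauss_swap] demands.
    The constant [c] is the one to be contracted, whereas [e] will be arbitrary at each step. *)
Let claim (c e : R) := exists2 L, 0 < L & forall l, L <= l -> forall K1 K f x,
  bounded_lipschitz K1 f -> taylor_bound q K f ->
  `|\int[P]_w f (x + U l w) - gauss_op (V l) f x| <= e * K1 * Num.sqrt l + c * l `^ (q / 2) * K.

Let lipschitz_ge0 K1 f : @bounded_lipschitz R K1 f -> 0 <= K1.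
Proof. by move=> [_ fL]; have := le_trans (normr_ge0 _) (fL 1 0); rewrite subr0 normr1 mulr1. Qed.

Let taylor_ge0 K f : @taylor_bound R q K f -> 0 <= K.
Proof.
move=> /(_ 0)[c1 [c2 /(_ 1) fc]]; have := le_trans (normr_ge0 _) fc.
by rewrite normr1 powR1 mulr1.
Qed.

(** The inequality [powR_le1D] applied to [U l / sqrt l], so that both terms on its right have the
    scale [l ^ (q / 2)]. *)
Let moment_q : exists B, \forall l \near +oo_R, \int[P]_w (`|U l w| `^ q) <= B * l `^ (q / 2).
Proof.
have [B HB] := recursive_moment_growth.
exists (1 + B); apply/near_pinftyP; move/near_pinftyP: HB => [L L0 HL]; exists L => // l Ll.
have l0 : 0 < l by apply: lt_le_trans Ll.
have /andP[q0 qr] := q_le.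
have iq : integrable (fun w => `|U l w| `^ q) by apply: integrable_powR_le (U_integrable l0) => //; exact: mU.
have ir := U_integrable l0.
have i1 : integrable (fun w => l `^ ((q - r) / 2) * `|U l w| `^ r).
  exact: (@integrable_scale _ _ _ P _ (fun w => `|U l w| `^ r)).
have -> : (1 + B) * l `^ (q / 2) = l `^ (q / 2) + l `^ ((q - r) / 2) * (B * l `^ (r / 2)).
  by rewrite mulrDl mul1r mulrCA -powRD ?(gt_eqF l0) ?implybT// -mulrDl subrK.
apply: (@le_trans _ _ (l `^ (q / 2) + l `^ ((q - r) / 2) * \int[P]_w (`|U l w| `^ r))); last first.
  by rewrite lerD2l ler_wpM2l ?powR_ge0//; exact: HL.
rewrite -(RintegralZl _ measurableT ir) -[X in X + _](Rintegral_probability_cst P).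
rewrite -(RintegralD measurableT (integrable_cst _ _) i1).
apply: le_Rintegral => //; first by apply: integrable_add => //; exact: integrable_cst.
move=> w _; have sl : 0 < Num.sqrt l by rewrite sqrtr_gt0.
have h := powR_le1D (U l w / Num.sqrt l) q_le.
have lq t : (Num.sqrt l) `^ t = l `^ (t / 2) by rewrite -powR12_sqrt ?(ltW l0)// -powRrM [2^-1 * t]mulrC.
have E t : `|U l w| `^ t = l `^ (t / 2) * `|U l w / Num.sqrt l| `^ t.
  by rewrite -lq -powRM ?(ltW sl)// normrM normfV (gtr0_norm sl) mulrC divfK// gt_eqF.
rewrite (E q) (E r) mulrA -powRD ?(gt_eqF l0) ?implybT// -mulrDl subrK.
by rewrite -[X in X + _]mulr1 -mulrDr ler_wpM2l ?powR_ge0.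
Qed.

(** The starting point of the iteration: the direct Taylor comparison, with the [q]-th moments of
    [U l] and of the Gaussian both of order [l ^ (q / 2)]. *)
Let claim0 : exists2 c, 0 <= c & forall e, 0 <= e -> claim c e.
Proof.
have [B HB] := moment_q; have /andP[q0 qr] := q_le.
have q_gt0 : 0 < q by apply: lt_trans q_gt2.
have [Cg Cg0 gm] := gauss_moment q_gt0.
have [L L0 HL] : exists2 L, 0 < L & forall l, L <= l ->
    \int[P]_w (`|U l w| `^ q) <= B * l `^ (q / 2) /\ V l <= v * l.
  by apply/near_pinftyP; apply: filterS2 HB U_var => l h1 h2; split.
exists (`|B| + Cg * `|v| `^ (q / 2)); first by rewrite addr_ge0// mulr_ge0// powR_ge0.
move=> e e0; exists L => // l Ll K1 K f x fK fT.
have l0 : 0 < l by apply: lt_le_trans Ll.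
have [Uq Vl] := HL l Ll; have [gi gC] := gm _ (V_ge0 l).
have iq : integrable (fun w => `|U l w| `^ q) by apply: integrable_powR_le (U_integrable l0) => //; exact: mU.
have i2 : integrable (fun w => U l w ^+ 2).
  by apply: integrable_sqr_of; [exact: mU|exact: U_integrable].
apply: le_trans (taylor_gauss x fK fT (V_ge0 l) gi gC (mU l0) i2 iq (U_mean l0) erefl) _.
apply: ler_wpDl; first by rewrite !mulr_ge0 ?sqrtr_ge0// (lipschitz_ge0 fK).
rewrite mulrC ler_wpM2r ?(taylor_ge0 fT)// mulrDl; apply: lerD.
  by apply: le_trans Uq _; rewrite ler_wpM2r ?powR_ge0// ler_norm.
rewrite -mulrA ler_wpM2l// -powRM ?(ltW l0)//; apply: powR_le => //; first by rewrite divr_ge0.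
by apply: le_trans Vl _; rewrite ler_wpM2r ?(ltW l0)// ler_norm.
Qed.

Let iY2 l : 0 < l -> integrable (fun w => Y l w ^+ 2).
Proof. by move=> l0; apply: integrable_sqr_of; [exact: mY|exact: iY]. Qed.

Let VX l a : 0 < l -> \int[P]_w (X l a w ^+ 2) = V (l * p a).
Proof. by move=> l0; exact: (@integral_X l a (fun z => z ^+ 2)). Qed.

Let S_variance l : 0 < l -> integrable (fun w => S l w ^+ 2) /\
  \int[P]_w (S l w ^+ 2) = \sum_a V (l * p a).
Proof.
move=> l0; have iX2 a : integrable (fun w => X l a w ^+ 2).
  by apply: integrable_sqr_of; [exact: mX|exact: iX].
have EX a : \int[P]_w X l a w = 0.
  by rewrite (@integral_X l a id l0); exact/U_mean/lp_gt0.
have [h1 h2] := @variance_discrete_sum _ _ _ P C A (D l) (fun a => u (l * p a)) (fun a => mD a l0) (indD l0) _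
  (index_enum_uniq A) iX2 EX.
by split=> //; apply: etrans h2 _; apply: eq_bigr => a _; exact: VX.
Qed.

(** Swapping the branches yields a Gaussian of variance [\sum_a V (l * p a)], not [V l]. The mixed
    term of the square of [S + Y] is split with weights [dl] and [1 / dl]: the first part is small
    because [S] has variance [O(l)], the second because [Y] has second moment [o(l)]. *)
Let variance_defect e : 0 < e ->
  \forall l \near +oo_R, `|\sum_a V (l * p a) - V l| <= e * l.
Proof.
move=> e0.
pose dl := e / 3 / (1 + `|v|); have v1 : 0 < 1 + `|v| by rewrite ltr_wpDr.
have dl0 : 0 < dl by apply: divr_gt0 => //; exact: divr_gt0.
pose e2 := e / 3 / (1 + dl^-1); have d1 : 0 < 1 + dl^-1 by rewrite addr_gt0// invr_gt0.
have e20 : 0 < e2 by apply: divr_gt0 => //; exact: divr_gt0.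
apply/near_pinftyP.
have [L L0 HL] : exists2 L, 0 < L & forall l, L <= l ->
    \int[P]_w (Y l w ^+ 2) <= e2 * l /\ forall a, V (l * p a) <= v * (l * p a).
  apply/near_pinftyP; have := eventually_shrunk p_gt0 U_var.
  by apply: filterS2 (Y_var e20) => l h1 h2; split.
exists L => // l Ll; have l0 : 0 < l by apply: lt_le_trans Ll.
have [Yl Vl] := HL l Ll; have [iS2 ES2] := S_variance l0.
have iU2 : integrable (fun w => U l w ^+ 2).
  by apply: integrable_sqr_of; [exact: mU|exact: U_integrable].
have iY2l := iY2 l0.
have i1 : integrable (fun w => dl * S l w ^+ 2) by exact: (@integrable_scale _ _ _ P _ (fun w => S l w ^+ 2)).
have i2 : integrable (fun w => (1 + dl^-1) * Y l w ^+ 2).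
  exact: (@integrable_scale _ _ _ P _ (fun w => Y l w ^+ 2)).
have s1 : `|\sum_a V (l * p a) - V l| <= dl * \sum_a V (l * p a) + (1 + dl^-1) * \int[P]_w (Y l w ^+ 2).
  rewrite -ES2 /V -(RintegralB measurableT iS2 iU2) -(RintegralZl _ measurableT iS2).
  rewrite -(RintegralZl _ measurableT iY2l) -(RintegralD measurableT i1 i2).
  apply: ler_normr_Rintegral.
  - exact: (@integrable_sub _ _ _ P (fun w => S l w ^+ 2) (fun w => U l w ^+ 2)).
  - exact: (@integrable_add _ _ _ P (fun w => dl * S l w ^+ 2)).
  move=> w; rewrite U_split; move: (S l w) (Y l w) => s z.
  have h1 := sqr_ge0 (dl * s + z); have h2 := sqr_ge0 (dl * s - z).
  have dv : dl * dl^-1 = 1 by rewrite divff// gt_eqF.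
  rewrite ler_norml -[X in X <= _]mul1r -[X in _ && (X <= _)]mul1r -!dv.
  have di : 0 <= dl^-1 by rewrite invr_ge0 ltW.
  have e1 : dl^-1 * (dl * s + z) ^+ 2 = dl * dl^-1 * (dl * s ^+ 2) + 2 * (dl * dl^-1) * (s * z) + dl^-1 * z ^+ 2 by ring.
  have e1' : dl^-1 * (dl * s - z) ^+ 2 = dl * dl^-1 * (dl * s ^+ 2) - 2 * (dl * dl^-1) * (s * z) + dl^-1 * z ^+ 2 by ring.
  have h3 := mulr_ge0 di h1; have h4 := mulr_ge0 di h2.
  rewrite dv ?mul1r ?mulr1 in e1 e1' h3 h4 *; rewrite e1 in h3; rewrite e1' in h4.
  by have := sqr_ge0 z; nra.
have s2 : \sum_a V (l * p a) <= (1 + `|v|) * l.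
  apply: (@le_trans _ _ (\sum_a (`|v| * l) * p a)).
    apply: ler_sum => a _; apply: le_trans (Vl a) _; rewrite -mulrA ler_wpM2r ?ler_norm//.
    by rewrite ltW// lp_gt0.
  by rewrite -mulr_sumr p_sum mulr1 ler_wpM2r ?(ltW l0)// lerDr.
have h1 : dl * \sum_a V (l * p a) <= e / 3 * l.
  apply: le_trans (ler_wpM2l (ltW dl0) s2) _; rewrite mulrA /dl divfK ?gt_eqF//.
have h2 : (1 + dl^-1) * \int[P]_w (Y l w ^+ 2) <= e / 3 * l.
  by apply: le_trans (ler_wpM2l (ltW d1) Yl) _; rewrite mulrA [_ * e2]mulrC /e2 divfK ?gt_eqF.
apply: le_trans s1 _; have := mulr_gt0 e0 l0; lra.
Qed.

(** The Taylor errors of the branches add up to the factor [theta]. Three contributions share the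
    Lipschitz term: the branches, the defect [Y], and the variance mismatch, each held below
    [e / 3]. *)
Let claimS c : 0 <= c -> (forall e, 0 < e -> claim c e) -> forall e, 0 < e -> claim (c * theta) e.
Proof.
move=> c0 IH e e0.
pose sp := \sum_a Num.sqrt (p a); have sp0 : 0 <= sp by apply: sumr_ge0 => a _; exact: sqrtr_ge0.
have sp1 : 0 < 1 + sp by rewrite ltr_wpDr.
(* The Lipschitz errors of the branches add up to [e1 * sp] times [K1 * sqrt l]; dividing in advance
   absorbs [sp], which is no contraction. *)
pose e1 := e / 3 / (1 + sp); have e3 : 0 < e / 3 by apply: divr_gt0.
have e10 : 0 < e1 by apply: divr_gt0.
(* A square, because the defect and the variance mismatch enter through square roots of quantities
   at most [e2 * l]. *)
pose e2 := (e / 3) ^+ 2; have e20 : 0 < e2 by apply: exprn_gt0.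
have HC : \forall l \near +oo_R, forall K1 K f x, bounded_lipschitz K1 f -> taylor_bound q K f ->
  `|\int[P]_w f (x + U l w) - gauss_op (V l) f x| <= e1 * K1 * Num.sqrt l + c * l `^ (q / 2) * K.
  exact/near_pinftyP/IH.
have [L L0 HL] : exists2 L, 0 < L & forall l, L <= l ->
    [/\ \int[P]_w (Y l w ^+ 2) <= e2 * l, `|\sum_a V (l * p a) - V l| <= e2 * l
    & forall a K1 K f x, bounded_lipschitz K1 f -> taylor_bound q K f ->
      `|\int[P]_w f (x + U (l * p a) w) - gauss_op (V (l * p a)) f x| <=
      e1 * K1 * Num.sqrt (l * p a) + c * (l * p a) `^ (q / 2) * K].
  apply/near_pinftyP; have := eventually_shrunk p_gt0 HC.
  by apply: filterS3 (Y_var e20) (variance_defect e20) => l h1 h2 h3; split.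
exists L => // l Ll K1 K f x fK fT; have l0 : 0 < l by apply: lt_le_trans Ll.
have [Yl Vl Xl] := HL l Ll.
have [[M fM] fL] := fK; have mf := lipschitz_measurable fL; have K10 := lipschitz_ge0 fK.
have mfx (z : R) : measurable_fun setT (fun t : R => f (z + t)).
  by apply: measurableT_comp => //; exact: measurable_funD.
pose eps a := e1 * K1 * Num.sqrt (l * p a) + c * (l * p a) `^ (q / 2) * K.
have Xeps a z : `|\int[P]_w f (z + u (l * p a) (D l a w)) - gauss_op (V (l * p a)) f z| <= eps a.
  apply: le_trans (Xl a K1 K f z fK fT).
  by rewrite (@integral_X l a (fun t => f (z + t)) l0).
have h1 := @gauss_swap _ _ _ P C A (D l) (fun a => u (l * p a)) (fun a => mD a l0) (indD l0) K1 f
  (fun a => V (l * p a)) eps (fun a => V_ge0 (l * p a)) fK Xeps _ x (index_enum_uniq A).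
have seps : \sum_a eps a = e1 * sp * (K1 * Num.sqrt l) + c * theta * l `^ (q / 2) * K.
  rewrite big_split/=; congr (_ + _).
    rewrite /sp mulr_sumr mulr_suml; apply: eq_bigr => a _.
    by rewrite sqrtrM ?(ltW l0)//; ring.
  rewrite /theta mulr_sumr !mulr_suml; apply: eq_bigr => a _.
  by rewrite powRM ?(ltW l0)//; ring.
have h2 : `|\int[P]_w f (x + U l w) - \int[P]_w f (x + S l w)| <= e / 3 * (K1 * Num.sqrt l).
  have iYa : integrable (fun w => `|Y l w|).
    by apply: integrable_abs; apply: integrable_sqr (mY l0) (iY2 l0).
  have if1 : integrable (fun w => f (x + U l w)).
    by apply: (@bounded_integrable _ _ _ _ _ M) => //; apply: measurableT_comp (mfx x) _; exact: mU.
  have if2 : integrable (fun w => f (x + S l w)).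
    by apply: (@bounded_integrable _ _ _ _ _ M) => //; apply: measurableT_comp (mfx x) _; exact: mS.
  rewrite -(RintegralB measurableT if1 if2).
  apply: (@le_trans _ _ (\int[P]_w (K1 * `|Y l w|))).
    apply: ler_normr_Rintegral.
    - exact: (@integrable_sub _ _ _ P (fun w => f (x + U l w)) (fun w => f (x + S l w))).
    - exact: (@integrable_scale _ _ _ P _ (fun w => `|Y l w|)).
    - by move=> w; apply: le_trans (fL _ _) _; rewrite opprD addrACA subrr add0r.
  rewrite (RintegralZl _ measurableT iYa) mulrCA ler_wpM2l//.
  apply: le_trans (Rintegral_abs_le_sqrt (mY l0) (iY2 l0)) _.
  apply: le_trans (ler_wsqrtr Yl) _.
  by rewrite sqrtrM ?(ltW e20)// /e2 sqrtr_sqr gtr0_norm.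
have h3 : `|gauss_op (\sum_a V (l * p a)) f x - gauss_op (V l) f x| <= e / 3 * (K1 * Num.sqrt l).
  have sV : 0 <= \sum_a V (l * p a) by apply: sumr_ge0.
  apply: le_trans (gauss_op_dist x sV (V_ge0 l) fK) _; rewrite mulrCA ler_wpM2l//.
  apply: le_trans (ler_wsqrtr Vl) _.
  by rewrite sqrtrM ?(ltW e20)// /e2 sqrtr_sqr gtr0_norm.
apply: le_trans (ler_distD (\int[P]_w f (x + S l w)) _ _) _.
have h4 := ler_distD (gauss_op (\sum_a V (l * p a)) f x) (\int[P]_w f (x + S l w)) (gauss_op (V l) f x).
have h5 : e1 * sp * (K1 * Num.sqrt l) <= e / 3 * (K1 * Num.sqrt l).
  rewrite ler_wpM2r ?mulr_ge0 ?sqrtr_ge0//.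
  apply: (@le_trans _ _ (e1 * (1 + sp))); first by rewrite ler_wpM2l ?(ltW e10)// lerDr.
  by rewrite /e1 divfK// gt_eqF.
rewrite seps in h1.
have -> : e * K1 * Num.sqrt l = e / 3 * (K1 * Num.sqrt l) + e / 3 * (K1 * Num.sqrt l) + e / 3 * (K1 * Num.sqrt l).
  by field.
have h6 := le_trans h4 (lerD h1 h3).
apply: le_trans (lerD h2 h6) _; move: h5.
set a1 := e1 * sp * _; set a2 := e / 3 * _; set a3 := c * theta * _ * _.
have -> : a2 + (a1 + a3 + a2) = a1 + (a2 + a2 + a3) by ring.
have -> : a2 + a2 + a2 + a3 = a2 + (a2 + a2 + a3) by ring.
by rewrite lerD2r.
Qed.

(** A fixed number [n] of steps with [c * theta ^+ n <= e] suffices; only afterwards is [l] taken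
    large, so the accumulation of thresholds is harmless. *)
Lemma recursive_clt e : 0 < e -> \forall l \near +oo_R, forall K1 K f x,
  bounded_lipschitz K1 f -> taylor_bound q K f ->
  `|\int[P]_w f (x + U l w) - gauss_op (V l) f x| <= e * (K1 * Num.sqrt l + K * l `^ (q / 2)).
Proof.
move=> e0; have [c c0 H0] := claim0.
have H n e' : 0 < e' -> claim (c * theta ^+ n) e'.
  elim: n e' => [|n IH] e' e'0; first by rewrite expr0 mulr1; apply: H0; exact: ltW.
  by rewrite exprSr mulrA; apply: claimS => //; rewrite mulr_ge0// exprn_ge0.
have [n cn] : exists n, c * theta ^+ n <= e.
  have : (theta ^+ n @[n --> \oo] --> (0 : R))%classic by apply: cvg_expr; rewrite ger0_norm.
  move=> /cvgrPdist_le/(_ (e / (c + 1))); rewrite divr_gt0 ?ltr_wpDl// => /(_ isT)[n _ /(_ n (leqnn n))] /=.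
  rewrite sub0r normrN ger0_norm ?exprn_ge0// ler_pdivlMr ?ltr_wpDl// => h; exists n.
  by apply: le_trans h; rewrite mulrC ler_wpM2l ?exprn_ge0// lerDl.
have [L L0 HL] := H n e e0; apply/near_pinftyP; exists L => // l Ll K1 K f x fK fT.
apply: le_trans (HL l Ll K1 K f x fK fT) _; rewrite mulrDr mulrA lerD2l.
rewrite [K * _]mulrC mulrA ler_wpM2r ?(taylor_ge0 fT)//.
by rewrite ler_wpM2r ?powR_ge0.
Qed.

End recursive_clt.

(** * Smooth approximation *)

Section smoothing.
Context {R : realType}.
Implicit Types (f g : R -> R) (x y : R).
Local Notation mu := (@lebesgue_measure R).

Definition supported_in (rho : R) f : Prop := forall x, rho <= `|x| -> f x = 0.

Lemma MVT_global f (df : R -> R) a b : (forall x, is_derive x (1 : R) f (df x)) -> a <= b ->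
  exists2 c, a <= c <= b & f b - f a = df c * (b - a).
Proof.
move=> fdf ab.
have cf : {within `[a, b], continuous f}.
  apply: continuous_subspaceT => x; apply: differentiable_continuous.
  by apply/derivable1_diffP; have := fdf x => -[].
have [c] := @MVT_segment R f df a b ab (fun x _ => fdf x) cf.
by rewrite in_itv /= => cab ->; exists c.
Qed.

Lemma is_derive_continuous f (df : R -> R) : (forall x, is_derive x (1 : R) f (df x)) -> continuous f.
Proof.
move=> fdf x; apply: differentiable_continuous.
by apply/derivable1_diffP; have := fdf x => -[].
Qed.

Lemma derivative_bound_power f df K k : f 0 = 0 -> (forall x, is_derive x (1 : R) f (df x)) ->
  (forall x, `|df x| <= K * `|x| ^+ k) -> forall x, `|f x| <= K * `|x| ^+ k.+1.
Proof.
move=> f0 fdf dfK x.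
have K0 : 0 <= K by have := le_trans (normr_ge0 _) (dfK 1); rewrite normr1 expr1n mulr1.
suff [c cx fE] : exists2 c, `|c| <= `|x| & f x = df c * x.
  rewrite fE normrM exprSr mulrA; apply: ler_wpM2r => //.
  by apply: le_trans (dfK c) _; rewrite ler_wpM2l// lerXn2r// nnegrE.
have [x0|x0] := leP 0 x.
  have [c /andP[c0 cx]] := MVT_global fdf x0; rewrite f0 !subr0 => ->.
  by exists c => //; rewrite !ger0_norm.
have [c /andP[cx c0]] := MVT_global fdf (ltW x0); rewrite f0 !sub0r => h.
exists c; first by rewrite !ler0_norm ?lerN2// ltW.
by apply: oppr_inj; rewrite h mulrN.
Qed.

Lemma continuous_supported_bounded rho f : 0 <= rho -> continuous f -> supported_in rho f ->
  exists M, forall x, `|f x| <= M.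
Proof.
move=> r0 cf sf; have rr : - rho <= rho by lra.
have cn : {within `[- rho, rho], continuous (fun x => `|f x|)}.
  by apply: continuous_subspaceT => x; apply: cvg_norm; exact: cf.
have [c _ cmax] := EVT_max rr cn.
exists `|f c| => x; have [xr|xr] := leP `|x| rho.
  by apply: cmax; rewrite in_itv /= -ler_norml.
by rewrite sf ?normr0// ltW.
Qed.

Lemma continuous_supported_uniform rho f e : continuous f -> supported_in rho f -> 0 < e ->
  exists2 dl, 0 < dl & forall x y, `|x - y| <= dl -> `|f x - f y| <= e.
Proof.
move=> cf sf e0.
have /compact_near_coveringP h := @segment_compact R (- (rho + 1)) (rho + 1).
have := h R (nbhs 0^'+) (fun dl x => forall y, `|x - y| <= dl -> `|f x - f y| <= e) _.
case.
  move=> x _; have /cvgrPdist_le/(_ (e / 2)) := cf x.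
  rewrite divr_gt0// => /(_ isT) /nbhs_ballP[eta /= eta0 he].
  have eta2 : 0 < eta / 2 by rewrite divr_gt0.
  exists (ball x (eta / 2), [set t | t < eta / 2]); first split.
  - exact: nbhsx_ballx.
  - exact: nbhs_right_lt.
  move=> [x' t] [/= xx' te] y x'y.
  have h1 : `|f x - f x'| <= e / 2.
    by apply: he; apply: le_ball xx'; rewrite ler_pdivrMr// ler_peMr// ?ler1n// ltW.
  have h2 : `|f x - f y| <= e / 2.
    apply: he; rewrite /ball /= in xx' *; apply: le_lt_trans (ler_distD x' _ _) _.
    by rewrite (splitr eta); apply: ltrD => //; apply: le_lt_trans te.
  rewrite (splitr e); apply: le_trans (ler_distD (f x) _ _) _.
  by rewrite lerD// distrC.
move=> /= M /= M0 hM.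
pose dl := Num.min 1 (M / 2); have dl0 : 0 < dl by rewrite lt_min ltr01 divr_gt0.
exists dl => // x y xy.
have [xr|xr] := leP `|x| (rho + 1).
  apply: (hM dl) => //; last by rewrite /= in_itv /= -ler_norml.
  rewrite /= sub0r normrN gtr0_norm//; apply: (@le_lt_trans _ _ (M / 2)).
    by rewrite ge_min lexx orbT.
  by rewrite ltr_pdivrMr// ltr_pMr// ltr1n.
have xy1 : `|x - y| <= 1 by apply: le_trans xy _; rewrite ge_min lexx.
rewrite (sf x); last by apply: ltW; lra.
rewrite (sf y) ?subrr ?normr0 ?(ltW e0)//.
have := ler_distD y x 0; rewrite !subr0 => h1; lra.
Qed.

(** Compact support makes [f] integrable on the whole line, so the integral from minus infinity is
    an antiderivative at all points at once. *)
Lemma antiderivative rho f : 0 <= rho -> continuous f -> supported_in rho f ->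
  exists H, forall x, is_derive x (1 : R) H (f x).
Proof.
move=> r0 cf sf.
have iT : mu.-integrable setT (EFin \o f).
  have mf : measurable_fun setT (EFin \o f) by apply/measurable_EFinP; exact: continuous_measurable_fun.
  have ic : mu.-integrable (`[- rho, rho] : set R) (EFin \o f).
    apply: continuous_compact_integrable; first exact: segment_compact.
    exact: continuous_subspaceT.
  have E : (\int[mu]_x `|(EFin \o f) x| = \int[mu]_(x in `[(- rho)%R, rho]) `|(EFin \o f) x|)%E.
    rewrite [RHS]integral_mkcond; apply: eq_integral => x _; rewrite patchE; case: ifPn => [//|/negP xr].
    rewrite /= sf ?normr0//; rewrite leNgt; apply/negP => xr'; apply: xr.
    by rewrite inE /= in_itv /= -ler_norml ltW.
  have /integrableP[_ h] := ic.
  by apply/integrableP; split; [exact: mf|rewrite E; exact: h].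
exists (fun x => \int[mu]_(t in `]-oo, x]) f t)%R => x.
have iu : mu.-integrable [set` Interval -oo%O (BRight (x + 1))] (EFin \o f).
  by apply: integrableS iT => //; exact: measurable_itv.
have xu : x < x + 1 by rewrite ltrDl.
have [] := @continuous_FTC1 R f -oo%O x (x + 1) xu iu (ltNyr _) (cf x).
move=> h1 h2; apply: (DeriveDef h1).
by rewrite -derive1E.
Qed.

(* [g x] is the mean of [f] over [[x, x + dl]]. *)
Lemma forward_mean rho dl f : 0 <= rho -> 0 < dl -> continuous f -> supported_in rho f ->
  exists g, [/\ continuous g, supported_in (rho + dl) g,
    forall x, is_derive x (1 : R) g ((f (x + dl) - f x) / dl) &
    forall x, exists2 xi, x <= xi <= x + dl & g x = f xi].
Proof.
move=> r0 d0 cf sf; have [H HD] := antiderivative r0 cf sf.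
pose g x := (H (x + dl) - H x) / dl.
have gm x : exists2 xi, x <= xi <= x + dl & g x = f xi.
  have xd : x <= x + dl by rewrite lerDl ltW.
  have [xi xixd h] := MVT_global HD xd.
  by exists xi => //; rewrite /g h addrAC subrr add0r mulfK ?gt_eqF.
have gD x : is_derive x (1 : R) g ((f (x + dl) - f x) / dl).
  have h1 : is_derive x (1 : R) (fun x => H (x + dl)) (f (x + dl)).
    have h2 : is_derive x (1 : R) (fun x : R => x + dl) 1.
      by rewrite -[1 in X in is_derive _ _ _ X]addr0; apply: is_deriveD.
    by have := @is_derive1_comp R H (fun x => x + dl) x _ _ (HD (x + dl)) h2; rewrite mulr1.
  have h3 := is_deriveB h1 (HD x).
  have h4 := @is_deriveZ R R^o R^o _ dl^-1 x 1 _ h3.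
  by move: h4; rewrite /GRing.scale /= mulrC /g; under [X in _ -> is_derive _ _ X _]eq_fun do rewrite mulrC.
exists g; split=> //.
- exact: is_derive_continuous gD.
- move=> x xr; have [xi /andP[x1 x2] ->] := gm x; apply: sf.
  have [x0|x0] := leP 0 x.
    rewrite ger0_norm in xr; last by [].
    by rewrite ger0_norm; lra.
  rewrite ler0_norm in xr; last exact: ltW.
  by rewrite ler0_norm; lra.
Qed.

(** The derivative of a forward mean is a difference quotient of the averaged function, so each
    averaging gains one order of smoothness. After three of them the second derivative is Lipschitz,
    and every bound depends only on the supremum of [f] and on [dl]. *)
Lemma smooth_approximation q rho f e : 2 < q -> q <= 3 -> 0 <= rho -> continuous f -> supported_in rho f ->
  0 < e -> exists h K1 K, [/\ bounded_lipschitz K1 h, taylor_bound q K h & forall x, `|f x - h x| <= e].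
Proof.
move=> q2 q3 r0 cf sf e0.
have [M fM] := continuous_supported_bounded r0 cf sf.
have M0 : 0 <= M := le_trans (normr_ge0 _) (fM 0).
have [eta eta0 unif] := continuous_supported_uniform cf sf e0.
(* Three averagings move the argument by at most [3 * dl = eta], the modulus of continuity of [f]
   for [e]. *)
pose dl := eta / 3; have d0 : 0 < dl by rewrite divr_gt0.
have [f1 [cf1 sf1 D1 m1]] := forward_mean r0 d0 cf sf.
have r1 : 0 <= rho + dl by rewrite addr_ge0// ltW.
have [f2 [cf2 sf2 D2 m2]] := forward_mean r1 d0 cf1 sf1.
have r2 : 0 <= rho + dl + dl by rewrite addr_ge0// ltW.
have [f3 [cf3 sf3 D3 m3]] := forward_mean r2 d0 cf2 sf2.
have f1M x : `|f1 x| <= M by have [xi _ ->] := m1 x.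
have f2M x : `|f2 x| <= M by have [xi _ ->] := m2 x.
have f3M x : `|f3 x| <= M by have [xi _ ->] := m3 x.
pose L := 2 * M / dl; have L0 : 0 <= L by rewrite divr_ge0 ?mulr_ge0// ltW.
have quo (u : R -> R) x B : (forall x, `|u x| <= B) -> `|(u (x + dl) - u x) / dl| <= 2 * B / dl.
  move=> uB; rewrite normrM normfV (gtr0_norm d0) ler_wpM2r ?invr_ge0 ?(ltW d0)//.
  by apply: le_trans (ler_normB _ _) _; have := uB x; have := uB (x + dl); lra.
have lip (u du : R -> R) B : (forall x, is_derive x (1 : R) u (du x)) -> (forall x, `|du x| <= B) ->
    forall x y, `|u x - u y| <= B * `|x - y|.
  move=> uD duB x y; wlog xy : x y / y <= x.
    move=> hw; have [xy|xy] := leP y x; first exact: hw.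
    by rewrite distrC [X in B * X]distrC; apply: hw; exact: ltW.
  have [c _ ->] := MVT_global uD xy; rewrite normrM; exact: ler_wpM2r.
have lip1 := lip f1 _ L D1 (fun x => quo f x M fM).
have lip2 := lip f2 _ L D2 (fun x => quo f1 x M f1M).
have lip3 := lip f3 _ L D3 (fun x => quo f2 x M f2M).
pose d2 x := (f1 (x + dl) - f1 x) / dl.
pose d3 x := (f2 (x + dl) - f2 x) / dl.
have shift (u : R -> R) du x : (forall x, is_derive x (1 : R) u (du x)) ->
    forall y, is_derive y (1 : R) (fun y => u (x + y)) (du (x + y)).
  move=> uD y; have h2 : is_derive y (1 : R) (fun y : R => x + y) 1.
    by rewrite -[1 in X in is_derive _ _ _ X]add0r; apply: is_deriveD.
  by have := @is_derive1_comp R u (fun y => x + y) y _ _ (uD (x + y)) h2; rewrite mulr1.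
have dX (c : R) y : is_derive y (1 : R) (fun y : R => c * y) c.
  have := @is_deriveZ R R^o R^o id c y 1 1 _; rewrite /GRing.scale /= mulr1; exact.
have dX2 (c : R) y : is_derive y (1 : R) (fun y : R => c * y ^+ 2) (2 * c * y).
  have := is_deriveM (dX c y) (is_derive_id y (1 : R)).
  rewrite /GRing.scale /= mulr1 => h.
  have -> : (fun y => c * y ^+ 2) = ((fun y => c * y) * id) by apply/funext => t; rewrite /= expr2 mulrA.
  by have -> : 2 * c * y = c * y + y * c by ring.
have dC (c : R) y : is_derive y (1 : R) (fun=> c) 0 by exact: is_derive_cst.
pose K2 := 2 * L / dl; have K20 : 0 <= K2 by apply: divr_ge0; [exact: mulr_ge0|exact: ltW].
have d2lip x y : `|d2 (x + y) - d2 x| <= K2 * `|y|.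
  have -> : d2 (x + y) - d2 x = ((f1 (x + y + dl) - f1 (x + dl)) - (f1 (x + y) - f1 x)) / dl.
    by rewrite /d2; field; rewrite gt_eqF.
  rewrite normrM normfV (gtr0_norm d0) /K2 [leRHS]mulrAC ler_wpM2r ?invr_ge0 ?(ltW d0)//.
  apply: le_trans (ler_normB _ _) _.
  have := lip1 (x + y + dl) (x + dl); have := lip1 (x + y) x.
  rewrite opprD addrACA subrr addr0 [x + y - x]addrAC subrr add0r; lra.
have T2 x y : `|f2 (x + y) - f2 x - d2 x * y| <= K2 * `|y| ^+ 2.
  apply: (@derivative_bound_power (fun y => f2 (x + y) - f2 x - d2 x * y) (fun y => d2 (x + y) - d2 x)).
  - by rewrite addr0 subrr mulr0 subr0.
  - move=> z; have := is_deriveB (is_deriveB (shift f2 d2 x D2 z) (dC (f2 x) z)) (dX (d2 x) z).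
    by rewrite subr0.
  - by move=> z; rewrite expr1; exact: d2lip.
(* Half the second derivative of [f3], since [d3] is its derivative and [d2] that of [f2]. *)
pose c2 x := (d2 (x + dl) - d2 x) / dl / 2.
pose K3 := 2 * K2 / dl; have K30 : 0 <= K3 by apply: divr_ge0; [exact: mulr_ge0|exact: ltW].
have T3 x y : `|f3 (x + y) - f3 x - d3 x * y - c2 x * y ^+ 2| <= K3 * `|y| ^+ 3.
  apply: (@derivative_bound_power (fun y => f3 (x + y) - f3 x - d3 x * y - c2 x * y ^+ 2)
    (fun y => d3 (x + y) - d3 x - 2 * c2 x * y)).
  - by rewrite addr0 subrr mulr0 subr0 expr0n mulr0 subr0.
  - move=> z; have := is_deriveB (is_deriveB (is_deriveB (shift f3 d3 x D3 z) (dC (f3 x) z)) (dX (d3 x) z)) (dX2 (c2 x) z).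
    by rewrite subr0.
  - move=> z.
    have -> : d3 (x + z) - d3 x - 2 * c2 x * z =
        ((f2 (x + dl + z) - f2 (x + dl) - d2 (x + dl) * z) - (f2 (x + z) - f2 x - d2 x * z)) / dl.
      by rewrite /d3 /c2 [x + z + dl]addrAC; field; rewrite gt_eqF.
    rewrite normrM normfV (gtr0_norm d0) /K3 [leRHS]mulrAC ler_wpM2r ?invr_ge0 ?(ltW d0)//.
    apply: le_trans (ler_normB _ _) _.
    by have := T2 (x + dl) z; have := T2 x z; lra.
exists f3, L, (K3 + 2 * M + L + K2); split.
- by split; [exists M|].
- move=> x; exists (d3 x), (c2 x) => y.
  have py : 0 <= `|y| `^ q := powR_ge0 _ _.
  (* For [|y| <= 1] the cubic remainder suffices since [q <= 3]; for larger [|y|] each term of the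
     remainder is bounded separately by a multiple of [|y| ^ q], since [q > 2]. *)
  have [y1|y1] := leP `|y| 1.
    apply: le_trans (T3 x y) _; apply: (@le_trans _ _ (K3 * `|y| `^ q)); last first.
      by rewrite ler_wpM2r//; lra.
    rewrite ler_wpM2l// -powR_mulrn//.
    have [->|yn] := eqVneq `|y| 0; first by rewrite !powR0 ?gt_eqF//; lra.
    have y0 : 0 < `|y| by rewrite lt_neqAle eq_sym yn normr_ge0.
    have -> : (3 : R) = q + (3 - q) by rewrite addrC subrK.
    rewrite powRD ?(gt_eqF y0) ?implybT// ler_piMr//.
    by apply: le_trans (powR_le _ _ y1) _; rewrite ?powR1// subr_ge0.
  have pq (t : R) : 0 <= t <= q -> `|y| `^ t <= `|y| `^ q.
    by move=> /andP[t0 tq]; exact: (ler_powR (ltW y1)).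
  have p0 : 1 <= `|y| `^ q by have := pq 0; rewrite powRr0; apply; lra.
  have p1 : `|y| <= `|y| `^ q by have := pq 1; rewrite powRr1//; apply; lra.
  have p2 : `|y| ^+ 2 <= `|y| `^ q by rewrite -powR_mulrn//; apply: pq; lra.
  have b3 := quo f2 x M f2M.
  have b2 : `|c2 x| <= K2.
    have h := quo d2 x L (fun x => quo f1 x M f1M).
    rewrite /c2 normrM [X in _ * X](@gtr0_norm R 2^-1) ?invr_gt0// ler_pdivrMr//.
    by apply: le_trans h _; rewrite -/K2 ler_peMr// ler1n.
  have h : `|f3 (x + y) - f3 x - d3 x * y - c2 x * y ^+ 2| <= 2 * M + `|d3 x| * `|y| + `|c2 x| * `|y| ^+ 2.
    apply: le_trans (ler_normB _ _) _; rewrite normrM normrX lerD2r.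
    apply: le_trans (ler_normB _ _) _; rewrite normrM lerD2r.
    apply: le_trans (ler_normB _ _) _; by have := f3M x; have := f3M (x + y); lra.
  apply: le_trans h _; rewrite !mulrDl.
  have h1 : 2 * M <= 2 * M * `|y| `^ q by rewrite ler_peMr// mulr_ge0.
  have h2 : `|d3 x| * `|y| <= L * `|y| `^ q by apply: ler_pM.
  have h3 : `|c2 x| * `|y| ^+ 2 <= K2 * `|y| `^ q by apply: ler_pM => //; rewrite exprn_ge0.
  have h4 : 0 <= K3 * `|y| `^ q by rewrite mulr_ge0.
  lra.
- move=> x; have [x3 x3h ->] := m3 x; have [x2 x2h ->] := m2 x3; have [x1 x1h ->] := m1 x2.
  have [xx3 x3x] := andP x3h; have [xx2 x2x] := andP x2h; have [xx1 x1x] := andP x1h.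
  apply: unif; have -> : eta = 3 * dl by rewrite /dl mulrC divfK.
  by rewrite ler_norml; apply/andP; split; lra.
Qed.

End smoothing.

(** * From smooth to continuous test functions *)

Section gauss_scaling.
Context {R : realType}.
Local Notation mu := (@lebesgue_measure R).

Lemma ge0_integral_dilation c (G : R -> R) : 0 < c -> continuous G -> (forall z, 0 <= G z) ->
  (\int[mu]_z (G z)%:E = \int[mu]_y (G (c * y) * c)%:E)%E.
Proof.
move=> c0 cG G0; pose F (y : R^o) : R^o := c * y.
have DF y : is_derive y (1 : R) F c.
  have := @is_deriveZ R R^o R^o id c y 1 1 _; rewrite /GRing.scale /= mulr1; exact.
have F'E : F^`()%classic = cst c.
  by apply/funext => y; rewrite derive1E; have := DF y => -[].
rewrite (@increasing_ge0_integration_by_substitutionT _ F G)//.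
- by apply: eq_integral => y _; rewrite F'E.
- by move=> a b ab; rewrite /F ltr_pM2l.
- by rewrite F'E => ?; exact: cvg_cst.
- by rewrite F'E; exact: is_cvg_cst.
- by rewrite F'E; exact: is_cvg_cst.
- by apply: gt0_cvgMrNy => //; exact: cvg_id.
- by apply: gt0_cvgMry => //; exact: cvg_id.
Qed.

Lemma gauss_pdf_dilation c v y : 0 < c -> 0 < v ->
  gauss_pdf (c ^+ 2 * v) (c * y) * c = gauss_pdf v y :> R.
Proof.
move=> c0 v0; have cv0 : 0 < c ^+ 2 * v by rewrite mulr_gt0// exprn_gt0.
rewrite /gauss_pdf !normal_pdf_sqrt// !subr0 mulrAC; congr (_ * _); last first.
  by congr expR; field; rewrite !gt_eqF.
have -> : c ^+ 2 * v * pi *+ 2 = c ^+ 2 * (v * pi *+ 2) by rewrite mulrnAr mulrA.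
rewrite sqrtrM ?exprn_ge0 ?(ltW c0)//.
by rewrite sqrtr_sqr gtr0_norm// invfM mulrAC mulVf ?gt_eqF// mul1r.
Qed.

Lemma ge0_gauss_scale c v (f : R -> R) : 0 < c -> 0 <= v -> continuous f -> (forall x, 0 <= f x) ->
  (\int[gauss (c ^+ 2 * v)]_x (f x)%:E = \int[gauss v]_y (f (c * y))%:E)%E.
Proof.
move=> c0 + cf f0; have mf : measurable_fun setT f by exact: continuous_measurable_fun.
have mfE : measurable_fun setT (EFin \o f) by exact/measurable_EFinP.
have mcf : measurable_fun setT (fun y => (f (c * y))%:E).
  by apply: measurableT_comp mfE _; exact: mulrl_measurable.
rewrite le_eqVlt => /predU1P[<-|v0].
  rewrite mulr0; apply: etrans (ge0_integral_gauss0 (lexx 0) mfE _) _; first by move=> x; rewrite lee_fin.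
  apply/esym; apply: etrans (ge0_integral_gauss0 (lexx 0) mcf _) _; first by move=> x; rewrite lee_fin.
  by rewrite /= mulr0.
have cv0 : 0 < c ^+ 2 * v by rewrite mulr_gt0// exprn_gt0.
apply: etrans (ge0_integral_gauss cv0 mfE _) _; first by move=> x; rewrite lee_fin.
apply/esym; apply: etrans (ge0_integral_gauss v0 mcf _) _; first by move=> x; rewrite lee_fin.
have cG : continuous (fun z => f z * gauss_pdf (c ^+ 2 * v) z).
  by move=> z; apply: cvgM; [exact: cf|exact: continuous_gauss_pdf].
apply/esym; apply: etrans (ge0_integral_dilation c0 cG _) _.
  by move=> z; rewrite mulr_ge0// gauss_pdf_ge0.
by apply: eq_integral => y _; rewrite -mulrA gauss_pdf_dilation.
Qed.

Lemma gauss_op0 v (f : R -> R) : gauss_op v f 0 = \int[gauss v]_y f y.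
Proof. by apply: eq_Rintegral => y _; rewrite add0r. Qed.

Lemma gauss_scale c v (f : R -> R) M : 0 < c -> 0 <= v -> continuous f -> (forall x, `|f x| <= M) ->
  \int[gauss (c ^+ 2 * v)]_x f x = \int[gauss v]_y f (c * y).
Proof.
move=> c0 v0 cf fM; have mf : measurable_fun setT f by exact: continuous_measurable_fun.
have mcf : measurable_fun setT (fun y => f (c * y)).
  by apply: measurableT_comp mf _; exact: mulrl_measurable.
have M0 x : 0 <= f x + M by rewrite -lerBlDr sub0r; have := fM x; rewrite ler_norml => /andP[].
have cfM : continuous (fun x => f x + M) by move=> x; apply: cvgD; [exact: cf|exact: cvg_cst].
have i1 w : (gauss w).-integrable setT (EFin \o f) by exact: (bounded_integrable (gauss w) mf fM).
have i2 w : (gauss w).-integrable setT (EFin \o (fun y => f (c * y))).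
  exact: (bounded_integrable (gauss w) mcf (fun y => fM (c * y))).
have ic w : (gauss w).-integrable setT (EFin \o (fun=> M)) by exact: integrable_cst.
have h := ge0_gauss_scale c0 v0 cfM M0.
have e1 w : \int[gauss w]_x (f x + M) = \int[gauss w]_x f x + M.
  by apply: etrans (RintegralD measurableT (i1 w) (ic w)) _; congr (_ + _); exact: Rintegral_probability_cst.
have e2 w : \int[gauss w]_x (f (c * x) + M) = \int[gauss w]_x f (c * x) + M.
  by apply: etrans (RintegralD measurableT (i2 w) (ic w)) _; congr (_ + _); exact: Rintegral_probability_cst.
apply: (addIr M); apply: etrans (esym (e1 _)) _; apply: etrans _ (e2 _).
exact: congr1 h.
Qed.

End gauss_scaling.

Section class_approximation.
Context {R : realType}.

Lemma cutoff (rho : R) : exists chi : R -> R, [/\ continuous chi, forall x, 0 <= chi x <= 1,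
  forall x, `|x| <= rho -> chi x = 1 & forall x, rho + 1 <= `|x| -> chi x = 0].
Proof.
exists (fun x => Num.max 0 (Num.min 1 (rho + 1 - `|x|))); split.
- move=> x; apply: (@lipschitz_continuous _ 1) => {}x y; rewrite mul1r.
  apply: le_trans (ler_dist_dist x y).
  move: `|x| `|y| => u w; rewrite ler_norml.
  have := ler_norm (u - w); have := ler_norm (- (u - w)); rewrite normrN => a1 a2.
  by case: (leP 1 (rho + 1 - u)) => ?; case: (leP 1 (rho + 1 - w)) => ?;
    case: (leP 0 (rho + 1 - u)) => ?; case: (leP 0 (rho + 1 - w)) => ?;
    rewrite ?(max_r (@ler01 R)); apply/andP; split; lra.
- by move=> x; case: (leP 1 (rho + 1 - `|x|)) => ?; case: (leP 0 (rho + 1 - `|x|)) => ?; rewrite ?(max_r (@ler01 R)); apply/andP; split; lra.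
- by move=> x xr; case: (leP 1 (rho + 1 - `|x|)) => ?; case: (leP 0 (rho + 1 - `|x|)) => ?; rewrite ?(max_r (@ler01 R)); lra.
- by move=> x xr; case: (leP 1 (rho + 1 - `|x|)) => ?; case: (leP 0 (rho + 1 - `|x|)) => ?; rewrite ?(max_r (@ler01 R)); lra.
Qed.

(** Where [|x|] is large, the strictly lower growth exponent [s < r] makes [g] itself negligible
    against [e * (1 + |x| ^ r)], so [g] may be cut off before it is smoothed. *)
Lemma continuous_growth_approximation (q r s B e : R) (g : R -> R) : 2 < q -> q <= 3 -> 0 <= s -> s < r ->
  continuous g -> (forall x, `|g x| <= B * (1 + `|x| `^ s)) -> 0 < e ->
  exists h K1 K, [/\ bounded_lipschitz K1 h, taylor_bound q K h &
    forall x, `|g x - h x| <= e * (1 + `|x| `^ r)].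
Proof.
move=> q2 q3 s0 sr cg gB e0.
have B0 : 0 <= B.
  have := le_trans (normr_ge0 _) (gB 0); rewrite pmulr_lge0// ltr_pwDl//; exact: powR_ge0.
have rs0 : 0 < r - s by rewrite subr_gt0.
(* From the radius [rho] on, [|x| ^ (r - s) >= t], hence [2 * B <= e / 2 * |x| ^ (r - s)]. *)
pose t := 4 * B / e + 1.
have t0 : 0 <= 4 * B / e by rewrite divr_ge0 ?mulr_ge0// ltW.
have t1 : 0 < t by rewrite ltr_wpDl.
pose rho := Num.max 1 (t `^ (r - s)^-1).
have rho1 : 1 <= rho by rewrite le_max lexx.
have tail x : rho <= `|x| -> `|g x| <= e / 2 * (1 + `|x| `^ r).
  move=> xr; have x1 : 1 <= `|x| by apply: le_trans xr.
  have x0 : 0 < `|x| by apply: lt_le_trans x1.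
  apply: le_trans (gB x) _.
  have p1 : 1 <= `|x| `^ s by rewrite -[X in X <= _](powRr0 `|x|); apply: ler_powR.
  have h1 : t <= `|x| `^ (r - s).
    have -> : t = (t `^ (r - s)^-1) `^ (r - s).
      by rewrite -powRrM mulVf ?gt_eqF// powRr1// ltW.
    apply: powR_le; [exact: ltW|exact: powR_ge0|].
    by apply: le_trans xr; rewrite le_max lexx orbT.
  have -> : `|x| `^ r = `|x| `^ s * `|x| `^ (r - s).
    by rewrite -powRD ?(gt_eqF x0) ?implybT// addrC subrK.
  have h2 : 2 * B <= e / 2 * `|x| `^ (r - s).
    have : e / 2 * t <= e / 2 * `|x| `^ (r - s) by rewrite ler_wpM2l// divr_ge0// ltW.
    apply: le_trans; rewrite /t mulrDr; have -> : e / 2 * (4 * B / e) = 2 * B by field; rewrite gt_eqF.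
    by rewrite mulr1 lerDl divr_ge0// ltW.
  have h3 := ler_wpM2r (powR_ge0 `|x| s) h2.
  have h4 : B * (1 + `|x| `^ s) <= 2 * B * `|x| `^ s by have := ler_wpM2l B0 p1; lra.
  apply: le_trans h4 _; apply: le_trans h3 _; rewrite mulrDr mulrAC -mulrA lerDr.
  by rewrite mulr1 divr_ge0// ltW.
have [chi [cchi chi01 chi1 chi0]] := cutoff rho.
pose g0 x := g x * chi x.
have cg0 : continuous g0 by move=> x; apply: cvgM; [exact: cg|exact: cchi].
have sg0 : supported_in (rho + 1) g0.
  move=> x xr; by rewrite /g0 chi0// mulr0.
have e2 : 0 < e / 2 by rewrite divr_gt0.
have rho0 : 0 <= rho + 1 by lra.
have [h [K1 [K [hK hT gh]]]] := smooth_approximation q2 q3 rho0 cg0 sg0 e2.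
exists h, K1, K; split=> // x.
have xr0 : 0 <= `|x| `^ r := powR_ge0 _ _.
have gg0 : `|g x - g0 x| <= e / 2 * (1 + `|x| `^ r).
  have [xr|xr] := leP rho `|x|.
    apply: le_trans (tail x xr); rewrite /g0 -[X in X - _]mulr1 -mulrBr normrM.
    have /andP[c0 c1] := chi01 x; rewrite ler_piMr// ger0_norm ?subr_ge0//; lra.
  by rewrite /g0 chi1 ?mulr1 ?subrr ?normr0 ?mulr_ge0 ?addr_ge0 ?(ltW e0)// ltW.
apply: le_trans (ler_distD (g0 x) _ _) _.
apply: le_trans (lerD gg0 (gh x)) _; nra.
Qed.

End class_approximation.

(** * Normal approximation of the normalised variables *)

Section transfer.
Context {d : measure_display} {T : measurableType d} {R : realType}.
Variable P : probability T R.
Variables (q r v : R) (U : R -> T -> R) (V : R -> R).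
Hypotheses (q_gt2 : 2 < q) (q_le3 : q <= 3) (q_le : q <= r).
Hypothesis V_ge0 : forall l, 0 <= V l.
Hypothesis V_le : \forall l \near +oo_R, V l <= v * l.
Hypothesis clt : forall e, 0 < e -> \forall l \near +oo_R, forall K1 K f x,
  bounded_lipschitz K1 f -> taylor_bound q K f ->
  `|\int[P]_w f (x + U l w) - gauss_op (V l) f x| <= e * (K1 * Num.sqrt l + K * l `^ (q / 2)).
Hypothesis mU : forall l, 0 < l -> measurable_fun setT (U l).
Hypothesis U_integrable : forall l, 0 < l -> P.-integrable setT (EFin \o (fun w => `|U l w| `^ r)).
Variable B : R.
Hypothesis U_moment : \forall l \near +oo_R, \int[P]_w (`|U l w| `^ r) <= B * l `^ (r / 2).

Variables (c dl v' : R -> R) (k : R).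
Hypothesis c_gt0 : \forall l \near +oo_R, 0 < c l.
Hypothesis c_le : \forall l \near +oo_R, c l <= k.
Hypothesis dl_small : forall e, 0 < e -> \forall l \near +oo_R, `|dl l| <= e.
Hypothesis v'_close : forall e, 0 < e -> \forall l \near +oo_R, `|(c l) ^+ 2 * (V l / l) - v' l| <= e.

(** One affine form for all the normalisations: [c] changes the scale from [sqrt l] to another
    standard deviation, and [dl] accounts for a centring other than the mean. *)
Let W l w := c l * (U l w / Num.sqrt l) + dl l.
(** The approximate variance [v'] may be negative, where [centered_normal] is the point mass; its
    positive part gives the same law and can be used with the Gaussian estimates. *)
Let vp l := Num.max (v' l) 0.

Let vp_ge0 l : 0 <= vp l. Proof. by rewrite le_max lexx orbT. Qed.

Let gauss_vp l : gauss (v' l) = gauss (vp l) :> probability R R.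
Proof. by rewrite /vp; have [h|h] := leP (v' l) 0; first exact: gauss_neg. Qed.

Let r_gt0 : 0 < r. Proof. by apply: lt_le_trans q_le; apply: lt_trans q_gt2. Qed.

Let mW l : 0 < l -> measurable_fun setT (W l).
Proof.
move=> l0; apply: measurable_funD => //; apply: measurable_funM => //.
by apply: measurable_funM => //; exact: mU.
Qed.

Let vp_close e : 0 < e -> \forall l \near +oo_R, `|(c l) ^+ 2 * (V l / l) - vp l| <= e.
Proof.
move=> e0; apply: filterS2 (v'_close e0) (nbhs_pinfty_gt (num_real 0)) => l h l0.
have a0 : 0 <= (c l) ^+ 2 * (V l / l) by rewrite mulr_ge0 ?sqr_ge0// divr_ge0 ?V_ge0// ltW.
move: h; rewrite /vp; have [h|h] := leP (v' l) 0; last by [].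
by rewrite subr0 !ger0_norm//; lra.
Qed.

Let W_moment : exists M, \forall l \near +oo_R,
  [/\ P.-integrable setT (EFin \o (fun w => `|W l w| `^ r)), \int[P]_w (`|W l w| `^ r) <= M,
   (gauss (vp l)).-integrable setT (EFin \o (fun x : R => `|x| `^ r)) & \int[gauss (vp l)]_x (`|x| `^ r) <= M].
Proof.
have [Cg Cg0 gm] := gauss_moment r_gt0.
pose M1 := (1 + 1) `^ r * (k `^ r * `|B|) + (1 + 1^-1) `^ r * 1.
pose M2 := Cg * (k ^+ 2 * `|v| + 1) `^ (r / 2).
exists (Num.max M1 M2).
have hd := dl_small ltr01; have hv := vp_close ltr01.
have h0 := nbhs_pinfty_gt (num_real (0 : R)).
have hA : \forall l \near +oo_R, [/\ 0 < c l, c l <= k & `|dl l| <= 1].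
  by apply: filterS3 c_gt0 c_le hd => l; split.
have hB : \forall l \near +oo_R, [/\ `|(c l) ^+ 2 * (V l / l) - vp l| <= 1, 0 < l & V l <= v * l].
  by apply: filterS3 hv h0 V_le => l; split.
apply: filterS3 hA hB U_moment => l [c0 ck d1] [vp1 l0 Vl] Ul.
have sl : 0 < Num.sqrt l by rewrite sqrtr_gt0.
pose s := c l / Num.sqrt l; have s0 : 0 < s by rewrite divr_gt0.
have WE w : W l w = s * U l w + dl l by rewrite /W /s mulrA mulrAC.
have iU := U_integrable l0.
have msU : measurable_fun setT (fun w => s * U l w) by apply: measurable_funM => //; exact: mU.
have sUE w : `|s * U l w| `^ r = s `^ r * `|U l w| `^ r.
  by rewrite normrM (gtr0_norm s0) powRM// ltW.
have isU : P.-integrable setT (EFin \o (fun w => `|s * U l w| `^ r)).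
  by under eq_fun do rewrite sUE; exact: (@integrable_scale _ _ _ P _ (fun w => `|U l w| `^ r)).
have idl : P.-integrable setT (EFin \o (fun=> `|dl l| `^ r)) by exact: integrable_cst.
have iW : P.-integrable setT (EFin \o (fun w => `|W l w| `^ r)).
  under eq_fun do rewrite WE; apply: (@integrable_powR_add _ _ _ P r (fun w => s * U l w) (fun=> dl l)) => //.
  exact: ltW.
have [ig gC] := gm _ (vp_ge0 l).
have k0 : 0 <= k by apply: le_trans ck; exact: ltW.
have slr : (Num.sqrt l) `^ r = l `^ (r / 2) by rewrite -powR12_sqrt ?(ltW l0)// -powRrM [2^-1 * r]mulrC.
split=> //.
  rewrite le_max; apply/orP; left.
  have i1 : P.-integrable setT (EFin \o (fun w => (1 + 1) `^ r * `|s * U l w| `^ r)).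
    exact: (@integrable_scale _ _ _ P _ (fun w => `|s * U l w| `^ r)).
  apply: (@le_trans _ _ (\int[P]_w ((1 + 1) `^ r * `|s * U l w| `^ r + (1 + 1^-1) `^ r * `|dl l| `^ r))).
    apply: le_Rintegral => //.
      by apply: integrable_add => //; exact: integrable_cst.
    by move=> w _; rewrite WE; apply: powR_normD_le2 => //; exact: ltW.
  rewrite (RintegralD measurableT i1 (integrable_cst _ _)) Rintegral_probability_cst.
  rewrite (RintegralZl _ measurableT isU); apply: lerD; last first.
    rewrite ler_wpM2l ?powR_ge0//; apply: le_trans (powR_le (ltW r_gt0) (normr_ge0 _) d1) _.
    by rewrite powR1.
  rewrite ler_wpM2l ?powR_ge0//.
  have -> : \int[P]_w (`|s * U l w| `^ r) = s `^ r * \int[P]_w (`|U l w| `^ r).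
    by under eq_Rintegral do rewrite sUE; rewrite (RintegralZl _ measurableT iU).
  apply: (@le_trans _ _ (s `^ r * (`|B| * l `^ (r / 2)))).
    rewrite ler_wpM2l ?powR_ge0//; apply: le_trans Ul _.
    by rewrite ler_wpM2r ?powR_ge0// ler_norm.
  rewrite -slr mulrCA -powRM ?(ltW s0) ?(ltW sl)// /s divfK ?gt_eqF// mulrC.
  by rewrite ler_wpM2r//; apply: powR_le => //; exact: ltW.
rewrite le_max; apply/orP; right; apply: le_trans gC _; rewrite ler_wpM2l//.
apply: powR_le => //; first by rewrite divr_ge0// ltW.
have cV : (c l) ^+ 2 * (V l / l) <= k ^+ 2 * `|v|.
  apply: ler_pM; rewrite ?sqr_ge0 ?divr_ge0 ?V_ge0 ?(ltW l0)//.
    by rewrite lerXn2r// nnegrE// ltW.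
  by rewrite ler_pdivrMr//; apply: le_trans Vl _; rewrite ler_wpM2r ?ler_norm// ltW.
by have := ler_norm (- ((c l) ^+ 2 * (V l / l) - vp l)); rewrite normrN; lra.
Qed.

(** For [f y = h (s * y)] with [s * sqrt l = c l], the constants of [f] turn the bound in [clt] into
    [K1 * c l + K * c l ^ q], which stays bounded in [l]. The shift [dl] and the variance error are
    absorbed by the Lipschitz constant of [h]. *)
Lemma class_transfer K1 K h e : bounded_lipschitz K1 h -> taylor_bound q K h -> 0 < e ->
  \forall l \near +oo_R, `|\int[P]_w h (W l w) - \int[gauss (v' l)]_x h x| <= e.
Proof.
move=> hK hT e0; have [[M hM] hL] := hK; have mh := lipschitz_measurable hL.
have K10 : 0 <= K1 by have := le_trans (normr_ge0 _) (hL 1 0); rewrite subr0 normr1 mulr1.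
have K0 : 0 <= K.
  by have [c1 [c2 /(_ 1) fc]] := hT 0; have := le_trans (normr_ge0 _) fc; rewrite normr1 powR1 mulr1.
have e3 : 0 < e / 3 by rewrite divr_gt0.
pose D := K1 * `|k| + K * `|k| `^ q + 1.
have D0 : 0 < D by rewrite ltr_wpDl// addr_ge0// mulr_ge0// powR_ge0.
pose e1 := e / 3 / D; have e10 : 0 < e1 by apply: divr_gt0.
pose e2 := e / 3 / (K1 + 1); have K11 : 0 < K1 + 1 by rewrite ltr_wpDl.
have e20 : 0 < e2 by apply: divr_gt0.
have e2K : K1 * e2 <= e / 3.
  apply: (@le_trans _ _ ((K1 + 1) * e2)); first by rewrite ler_wpM2r ?(ltW e20)// lerDl.
  by rewrite mulrC /e2 divfK// gt_eqF.
have e22 : 0 < e2 ^+ 2 by apply: exprn_gt0.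
have hA : \forall l \near +oo_R, [/\ 0 < c l, c l <= k & `|dl l| <= e2].
  by apply: filterS3 c_gt0 c_le (dl_small e20) => l; split.
apply: filterS3 hA (filterI (vp_close e22) (nbhs_pinfty_gt (num_real (0 : R)))) (clt e10).
move=> l [c0 ck d1] [vpl l0] cltl; rewrite gauss_vp.
have sl : 0 < Num.sqrt l by rewrite sqrtr_gt0.
have [s [s0 sE]] : exists s, 0 < s /\ s * Num.sqrt l = c l.
  by exists (c l / Num.sqrt l); rewrite divfK ?gt_eqF// divr_gt0.
have WE w : W l w = s * U l w + dl l by rewrite /W -sE -mulrA [Num.sqrt l * _]mulrC divfK// gt_eqF.
have msU : measurable_fun setT (fun w => s * U l w) by exact: (measurableT_comp (mulrl_measurable s) (mU l0)).
pose f y := h (s * y).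
have fK : bounded_lipschitz (K1 * s) f.
  split; first by exists M => x; exact: hM.
  by move=> x y; apply: le_trans (hL _ _) _; rewrite -mulrBr normrM (gtr0_norm s0) mulrA.
have fT : taylor_bound q (K * s `^ q) f.
  move=> x; have [c1 [c2 hc]] := hT (s * x); exists (c1 * s), (c2 * s ^+ 2) => y.
  have := hc (s * y); rewrite -mulrDr normrM (gtr0_norm s0) powRM ?(ltW s0)// exprMn !mulrA; exact.
have h1 := cltl _ _ f 0 fK fT.
have s2V : s ^+ 2 * V l = (c l) ^+ 2 * (V l / l).
  by rewrite -sE exprMn sqr_sqrtr ?(ltW l0)//; field; rewrite gt_eqF.
have sq : s `^ q * l `^ (q / 2) = c l `^ q.
  have -> : l `^ (q / 2) = Num.sqrt l `^ q by rewrite -powR12_sqrt ?(ltW l0)// -powRrM [2^-1 * q]mulrC.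
  by rewrite -powRM ?(ltW s0) ?(ltW sl)// sE.
have b1 : e1 * (K1 * s * Num.sqrt l + K * s `^ q * l `^ (q / 2)) <= e / 3.
  have -> : K1 * s * Num.sqrt l + K * s `^ q * l `^ (q / 2) = K1 * c l + K * c l `^ q.
    by rewrite -sq -sE; ring.
  apply: (@le_trans _ _ (e1 * D)); last by rewrite /e1 divfK// gt_eqF.
  have ck' : c l <= `|k| by apply: le_trans ck (ler_norm _).
  rewrite ler_wpM2l ?(ltW e10)//; apply: ler_wpDr => //; apply: lerD; first exact: ler_wpM2l.
  by apply: ler_wpM2l => //; apply: powR_le => //; [exact: ltW (lt_trans _ q_gt2)|exact: ltW].
have g1 : gauss_op (V l) f 0 = gauss_op (s ^+ 2 * V l) h 0.
  apply: etrans (gauss_op0 (V l) f) _; apply: etrans _ (esym (gauss_op0 _ h)).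
  exact: esym (gauss_scale s0 (V_ge0 l) (lipschitz_continuous hL) hM).
have g2 : \int[gauss (vp l)]_x h x = gauss_op (vp l) h 0.
  exact: esym (gauss_op0 _ h).
have sV0 : 0 <= s ^+ 2 * V l by rewrite mulr_ge0 ?sqr_ge0.
have h2 : `|gauss_op (s ^+ 2 * V l) h 0 - gauss_op (vp l) h 0| <= e / 3.
  apply: le_trans (gauss_op_dist 0 sV0 (vp_ge0 l) hK) _; apply: le_trans e2K.
  rewrite s2V; apply: (ler_wpM2l K10); apply: le_trans (ler_wsqrtr vpl) _.
  by rewrite sqrtr_sqr gtr0_norm.
have i1 : P.-integrable setT (EFin \o (fun w => h (W l w))).
  exact: (bounded_integrable P (measurableT_comp mh (mW l0)) (fun w => hM (W l w))).
have i2 : P.-integrable setT (EFin \o (fun w => h (s * U l w))).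
  exact: (bounded_integrable P (measurableT_comp mh msU) (fun w => hM (s * U l w))).
have h3 : `|\int[P]_w h (W l w) - \int[P]_w h (s * U l w)| <= e / 3.
  apply: (ler_dist_Rintegral i1 i2) => w; apply: le_trans (hL _ _) _; apply: le_trans e2K.
  by rewrite WE addrAC subrr add0r; apply: (ler_wpM2l K10).
have h1' : `|\int[P]_w h (s * U l w) - gauss_op (s ^+ 2 * V l) h 0| <= e / 3.
  apply: le_trans b1; apply: le_trans h1; rewrite g1.
  have -> : \int[P]_w f (0 + U l w) = \int[P]_w h (s * U l w) by apply: eq_Rintegral => w _; rewrite add0r.
  exact: lexx.
rewrite g2; have -> : e = e / 3 + (e / 3 + e / 3) by field.
apply: le_trans (ler_distD (\int[P]_w h (s * U l w)) _ _) (lerD h3 _).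
exact: le_trans (ler_distD (gauss_op (s ^+ 2 * V l) h 0) _ _) (lerD h1' h2).
Qed.

(** The error [e1 * (1 + |x| ^ r)] made in replacing [g] by a smooth [h] is controlled under both
    laws by their uniformly bounded [r]-th moments. This is why the growth exponent must stay
    strictly below [r]. *)
Lemma continuous_transfer (g : R -> R) C s : continuous g -> 0 <= s -> s < r ->
  (forall x, `|g x| <= C * (1 + `|x| `^ s)) ->
  (\forall l \near +oo_R, P.-integrable setT (EFin \o (fun w => g (W l w))) /\
    (gauss (v' l)).-integrable setT (EFin \o g)) /\
  forall e, 0 < e -> \forall l \near +oo_R, `|\int[P]_w g (W l w) - \int[gauss (v' l)]_x g x| <= e.
Proof.
move=> cg s0 sr gC; have mg : measurable_fun setT g by exact: continuous_measurable_fun.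
have [M HM] := W_moment.
have C0 : 0 <= C.
  by have := le_trans (normr_ge0 _) (gC 0); rewrite pmulr_lge0// ltr_pwDl//; exact: powR_ge0.
have dom (d' : measure_display) (T' : measurableType d') (Q : probability T' R) (Z : T' -> R) :
    measurable_fun setT Z -> Q.-integrable setT (EFin \o (fun w => `|Z w| `^ r)) ->
    Q.-integrable setT (EFin \o (fun w => g (Z w))).
  move=> mZ iZ; apply: (@integrable_le _ _ _ Q _ (fun w => C * (2 + `|Z w| `^ r))).
  - exact: measurableT_comp mg mZ.
  - by apply: integrable_scale; apply: integrable_add => //; exact: integrable_cst.
  - move=> w; apply: le_trans (gC _) _; rewrite ler_wpM2l//.
    have := @powR_le1D R r s (Z w); rewrite s0 (ltW sr) => /(_ isT); lra.
have HI : \forall l \near +oo_R, P.-integrable setT (EFin \o (fun w => g (W l w))) /\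
    (gauss (v' l)).-integrable setT (EFin \o g).
  apply: filterS2 HM (nbhs_pinfty_gt (num_real (0 : R))) => l [iW _ iG _] l0.
  split; first by apply: dom => //; exact: mW.
  by rewrite gauss_vp; apply: (dom _ _ (gauss (vp l)) id).
split=> // e e0.
have M1 : 0 < `|M| + 1 by rewrite ltr_wpDl.
pose e1 := e / 3 / (`|M| + 1); have e3 : 0 < e / 3 by rewrite divr_gt0.
have e10 : 0 < e1 by apply: divr_gt0.
have [h [K1 [K [hK hT gh]]]] := continuous_growth_approximation q_gt2 q_le3 s0 sr cg gC e10.
have [[Mh hM] hL] := hK; have mh := lipschitz_measurable hL.
apply: filterS3 HM (filterI HI (nbhs_pinfty_gt (num_real (0 : R)))) (class_transfer hK hT e3).
move=> l [iW WM iG GM] [[i1 i2] l0]; rewrite gauss_vp => hl.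
rewrite gauss_vp in i2.
have bound (d' : measure_display) (T' : measurableType d') (Q : probability T' R) (Z : T' -> R) :
    measurable_fun setT Z -> Q.-integrable setT (EFin \o (fun w => `|Z w| `^ r)) ->
    Q.-integrable setT (EFin \o (fun w => g (Z w))) -> \int[Q]_w (`|Z w| `^ r) <= M ->
    `|\int[Q]_w g (Z w) - \int[Q]_w h (Z w)| <= e / 3.
  move=> mZ iZ ig ZM.
  have ih : Q.-integrable setT (EFin \o (fun w => h (Z w))).
    exact: (bounded_integrable Q (measurableT_comp mh mZ) (fun w => hM (Z w))).
  have i3 : Q.-integrable setT (EFin \o (fun w => 1 + `|Z w| `^ r)).
    by apply: integrable_add => //; exact: integrable_cst.
  rewrite -(RintegralB measurableT ig ih).
  apply: (@le_trans _ _ (\int[Q]_w (e1 * (1 + `|Z w| `^ r)))).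
    apply: ler_normr_Rintegral.
    - exact: (@integrable_sub _ _ _ Q (fun w => g (Z w)) (fun w => h (Z w))).
    - exact: (@integrable_scale _ _ _ Q _ (fun w => 1 + `|Z w| `^ r)).
    - by move=> w; exact: gh.
  rewrite (RintegralZl _ measurableT i3) (RintegralD measurableT (integrable_cst _ _) iZ).
  rewrite Rintegral_probability_cst.
  apply: (@le_trans _ _ (e1 * (`|M| + 1))); last by rewrite /e1 divfK// gt_eqF.
  by rewrite ler_wpM2l ?(ltW e10)// addrC lerD2r; apply: le_trans ZM (ler_norm _).
have b1 := bound _ _ P (W l) (mW l0) iW i1 WM.
have b2 := bound _ _ (gauss (vp l)) id (@measurable_id _ _ _) iG i2 GM.
have -> : e = e / 3 + (e / 3 + e / 3) by field.
rewrite distrC in b2.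
apply: le_trans (ler_distD (\int[P]_w h (W l w)) _ _) (lerD b1 _).
exact: le_trans (ler_distD (\int[gauss (vp l)]_x h x) _ _) (lerD hl b2).
Qed.

End transfer.

(** * Moments of additive functionals on random tries *)

Section random_trie_family.
Context {d : measure_display} {T : measurableType d} {R : realType}.
Variable P : probability T R.
Context {A : finType}.
Variables (p : A -> R) (Xi : nat -> T -> nat -> A) (N : R -> T -> nat).
Hypotheses (A_gt1 : (1 < #|A|)%N) (p_gt0 : forall a, 0 < p a) (p_sum : \sum_a p a = 1).
Hypothesis Xi_iid : iid_strings P p Xi.
Hypothesis N_poisson : forall l, 0 < l -> poisson_distributed P l (N l).
Hypothesis N_independent : forall l, 0 < l -> independent_of_strings P Xi (N l).
Local Notation C := (nat * {fset (seq A)})%type.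

Let a0 : A.
Proof.
case: (pickP (fun _ : A => true)) => [x _|h]; first exact: x.
by exfalso; move: A_gt1; rewrite (eq_card0 h).
Qed.

Definition random_sized_trie l w : C := sized_trie (strings Xi (N l w) w).
Definition random_sized_branch l a w : C := sized_trie (branch (strings Xi (N l w) w) a).

Local Notation tau := random_sized_trie.
Local Notation D := random_sized_branch.

Lemma discrete_random_trie l : 0 < l -> discrete_variable (tau l).
Proof.
by move=> l0 c; exact: (measurable_random_trie Xi_iid a0 (N_poisson l0) [set c]).
Qed.

Lemma measurable_branch_event l a (B : set C) : 0 < l -> measurable (D l a @^-1` B).
Proof.
move=> l0; have := measurable_random_branches Xi_iid a0 (N_poisson l0) (fun b => if b == a then B else setT).
congr (measurable _); apply/seteqP; split=> w /= h; last by move=> b; case: eqP => [->|].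
by have := h a; rewrite eqxx.
Qed.

Lemma discrete_random_branch l a : 0 < l -> discrete_variable (D l a).
Proof. by move=> l0 c; exact: measurable_branch_event. Qed.

Lemma random_branches_law l (B : A -> set C) : 0 < l ->
  P [set w | forall a, B a (D l a w)] = (\prod_a P (tau (l * p a) @^-1` B a))%E.
Proof.
move=> l0.
rewrite (random_branches_prob A_gt1 p_gt0 p_sum Xi_iid a0 l0 (N_poisson l0) (N_independent l0)).
apply: eq_bigr => a _; have la : 0 < l * p a by rewrite mulr_gt0.
by rewrite -(random_trie_prob Xi_iid a0 (N_poisson la) (N_independent la)).
Qed.

Lemma random_branch_law l a (B : set C) : 0 < l ->
  P (D l a @^-1` B) = P (tau (l * p a) @^-1` B).
Proof.
move=> l0; have := random_branches_law (fun b => if b == a then B else setT) l0.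
rewrite (bigD1 a)//= eqxx big1 ?mule1.
  move=> <-; congr (P _); apply/seteqP; split=> w /= h; last by have := h a; rewrite eqxx.
  by move=> b; case: eqP => [->|].
by move=> b /negbTE ->; rewrite preimage_setT probability_setT.
Qed.

Lemma independent_random_branches l : 0 < l -> independent_discrete P (D l).
Proof.
move=> l0 B; apply: etrans (random_branches_law B l0) _.
by apply: eq_bigr => a _; rewrite random_branch_law.
Qed.

(** Given the number of strings, the law of the trie does not depend on the intensity, so the two
    atoms at [c] differ only through the Poisson weights of [c.1]. *)
Lemma le_integral_random_trie (l L : R) (g g' : C -> R) : 0 < l -> 0 < L ->
  (forall c, 0 <= g c) -> (forall c, 0 <= g' c) ->
  (forall c, g c * poisson_pmf l c.1 <= g' c * poisson_pmf L c.1) ->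
  (\int[P]_w (g (tau l w))%:E <= \int[P]_w (g' (tau L w))%:E)%E.
Proof.
move=> l0 L0 g0 g'0 gg'.
apply: (le_integral_discrete (g := fun c => (g c)%:E) (g' := fun c => (g' c)%:E)) => [||c|c|c].
- exact: discrete_random_trie.
- exact: discrete_random_trie.
- by rewrite lee_fin.
- by rewrite lee_fin.
have tp0 n : 0 <= trie_prob P Xi n [set c] by have /andP[] := trie_prob01 Xi_iid a0 n [set c].
rewrite (random_trie_prob Xi_iid a0 (N_poisson l0) (N_independent l0) [set c]).
rewrite (random_trie_prob Xi_iid a0 (N_poisson L0) (N_independent L0) [set c]).
rewrite -!nneseriesZl//; last 2 first.
- by move=> n _; rewrite lee_fin mulr_ge0// poisson_pmf_ge0.
- by move=> n _; rewrite lee_fin mulr_ge0// poisson_pmf_ge0.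
apply: lee_nneseries => n _.
  by move=> _; rewrite -EFinM lee_fin !mulr_ge0// poisson_pmf_ge0.
rewrite -!EFinM lee_fin; have [->|nc] := eqVneq n c.1.
  by rewrite !mulrA ler_wpM2r.
rewrite [trie_prob P Xi n [set c]](_ : _ = 0) ?mulr0//.
rewrite /trie_prob (_ : [set w | _] = set0) ?measure0//.
apply/seteqP; split=> // w /= cE; move: nc; rewrite -cE /sized_trie /= size_strings eqxx//.
Qed.

Lemma random_strings_separatedS l : 0 < l ->
  {ae P, forall w, exists L, separated L.+1 (strings Xi (N l w) w)}.
Proof.
move=> l0; have := random_strings_separated A_gt1 p_gt0 p_sum Xi_iid a0 (N_poisson l0) (N_independent l0).
by apply: filterS => w [L sL]; exists L; exact: separatedS.
Qed.

End random_trie_family.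

Section split.
Context {R : realType} {A : finType}.
Variable phi : {fset (seq A)} -> R.

(** The toll for which the recursion holds for every number of strings. A single string yields the
    one-leaf trie in its branch as well, so the toll of the leaf is already counted there and the
    root must contribute 0. *)
Definition branching_toll (c : nat * {fset (seq A)}) : R := if (1 < c.1)%N then phi c.2 else 0.

Lemma additive_functional_split L (s : seq (nat -> A)) : separated L.+1 s ->
  additive_functional phi (trie s) =
  branching_toll (sized_trie s) + \sum_a additive_functional phi (trie (branch s a)).
Proof.
move=> sL; rewrite /branching_toll /sized_trie /=; case: ltnP => s1.
  exact: additive_functional_branch s1 sL.
rewrite add0r; case: s s1 {sL} => [|x [|//]] _.
  by rewrite trie_nil additive_functional0 big1// => a _; rewrite trie_nil additive_functional0.
rewrite trie1 (bigD1 (x 0%N))//= big1 ?addr0.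
  by rewrite /branch /= eqxx /= trie1.
by move=> a; rewrite /branch /= eq_sym => /negbTE -> /=; rewrite trie_nil additive_functional0.
Qed.

End split.

(** * Local boundedness of the moments of the functional *)

Section base_moments.
Context {d : measure_display} {T : measurableType d} {R : realType}.
Variable P : probability T R.
Context {A : finType}.
Variables (p : A -> R) (Xi : nat -> T -> nat -> A) (N : R -> T -> nat).
Hypotheses (A_gt1 : (1 < #|A|)%N) (p_gt0 : forall a, 0 < p a) (p_sum : \sum_a p a = 1).
Hypothesis Xi_iid : iid_strings P p Xi.
Hypothesis N_poisson : forall l, 0 < l -> poisson_distributed P l (N l).
Hypothesis N_independent : forall l, 0 < l -> independent_of_strings P Xi (N l).
Variables (phi : {fset (seq A)} -> R) (r : R).
Hypothesis r_gt2 : 2 < r.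
Local Notation C := (nat * {fset (seq A)})%type.
Local Notation tau := (random_sized_trie Xi N).
Local Notation D := (random_sized_branch Xi N).
Local Notation Phi := (additive_functional phi).
Hypothesis phi_moment : \forall l \near +oo_R,
  P.-integrable setT (EFin \o (fun w => `|phi (tau l w).2| `^ r)).

Let r_gt0 : 0 < r. Proof. by rewrite (lt_trans _ r_gt2). Qed.
Let r_gt1 : 1 < r. Proof. by rewrite (lt_trans _ r_gt2)// ltr1n. Qed.

Local Notation chi := (phi [fset [::]]%fset).

(* Weighting by [n^(1-r)] makes the [r]-th power of the functional subadditive under the splitting
   of the trie at the root, by Jensen's inequality ([powR_bigsum_div_le]). *)
Let Z (c : C) : R := if (1 < c.1)%N then `|Phi c.2| `^ r / c.1%:R `^ (r - 1) else 0.
(** Truncation in height allows an induction on [h] with finite integrals; [Zh h] increases to [Z],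
    so a bound uniform in [h] passes to the limit. *)
Let Zh h (c : C) : R := if lower h c.2 then Z c else 0.
(** Pays for the branches that contain a single string, which [Z] ignores: there are at most [c.1]
    of them, each contributing a power of the toll of a leaf. *)
Let size2 (c : C) : R := if (1 < c.1)%N then c.1%:R else 0.

Let Z_ge0 c : 0 <= Z c.
Proof. by rewrite /Z; case: ifP => // _; rewrite divr_ge0// powR_ge0. Qed.
Let Zh_ge0 h c : 0 <= Zh h c.
Proof. by rewrite /Zh; case: ifP. Qed.
Let size2_ge0 c : 0 <= size2 c.
Proof. by rewrite /size2; case: ifP. Qed.

(** The toll is separated with coefficients depending on [e] and loses its weight, which is at least
    1. The sum over the branches is then distributed by [powR_bigsum_div_le] with the branch sizes
    as weights. *)
Let Z_step e L h (s : seq (nat -> A)) : 0 < e -> separated L.+1 s ->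
  Zh h.+1 (sized_trie s) <= (1 + e^-1) `^ r * `|branching_toll phi (sized_trie s)| `^ r
    + (1 + e) `^ r * `|chi| `^ r * size2 (sized_trie s)
    + (1 + e) `^ r * \sum_a Zh h (sized_trie (branch s a)).
Proof.
move=> e0 sL.
have c1 : 0 <= (1 + e^-1) `^ r := powR_ge0 _ _.
have c2 : 0 <= (1 + e) `^ r := powR_ge0 _ _.
have cx : 0 <= `|chi| `^ r := powR_ge0 _ _.
have cb : 0 <= `|branching_toll phi (sized_trie s)| `^ r := powR_ge0 _ _.
have S0 : 0 <= \sum_a Zh h (sized_trie (branch s a)) by apply: sumr_ge0.
have [hs|hs] := boolP ((1 < size s)%N && lower h.+1 (trie s)); last first.
  rewrite [leLHS](_ : _ = 0).
    by rewrite !addr_ge0// !mulr_ge0.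
  by move: hs; rewrite /Zh /Z /=; case: ltnP => //= _; case: ifP.
have /andP[s1 hl] := hs.
rewrite /Zh /= hl /Z /= s1 /size2 /= s1.
have n1 : 1 <= (size s)%:R `^ (r - 1) :> R.
  have := @powR_le R (r - 1) 1 (size s)%:R; rewrite powR1; apply=> //.
    by rewrite subr_ge0 ltW.
  by rewrite ler1n ltnW.
have n0 : 0 < (size s)%:R `^ (r - 1) :> R by apply: lt_le_trans n1.
pose x a := `|Phi (trie (branch s a))|; pose m a : R := (size (branch s a))%:R.
have xm a : m a = 0 -> x a = 0.
  move=> /eqP; rewrite /m pnatr_eq0 size_eq0 => /eqP sa0.
  by rewrite /x sa0 trie_nil additive_functional0 normr0.
have jensen := @powR_bigsum_div_le R r A (index_enum A) x m (ltW r_gt1)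
  (fun a => normr_ge0 _) (fun a => ler0n _ _) xm.
have msum : \sum_a m a = (size s)%:R by rewrite /m -natr_sum branch_size.
rewrite msum in jensen.
have Ssplit := additive_functional_split phi sL.
have h1 : `|Phi (trie s)| `^ r <= (1 + e^-1) `^ r * `|branching_toll phi (sized_trie s)| `^ r +
    (1 + e) `^ r * (\sum_a x a) `^ r.
  rewrite Ssplit addrC.
  apply: le_trans (powR_normD_le2 _ _ (ltW r_gt0) e0) _; rewrite addrC lerD2l ler_wpM2l//.
  by apply: powR_le; [exact: ltW|exact: normr_ge0|exact: ler_norm_sum].
have h3 a : x a `^ r / m a `^ (r - 1) <= Zh h (sized_trie (branch s a)) + `|chi| `^ r * m a.
  rewrite /Zh /= (lower_branch a s1 sL hl) /Z /= /x /m.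
  case: (branch s a) => [|z [|z' s']].
  - by rewrite trie_nil additive_functional0 normr0 powR0 ?gt_eqF// mul0r mulr0 addr0.
  - by rewrite trie1 additive_functional1 /= powR1 divr1 mulr1 add0r.
  - by rewrite /= lerDl mulr_ge0.
have h4 : (\sum_a x a) `^ r / (size s)%:R `^ (r - 1) <=
    \sum_a Zh h (sized_trie (branch s a)) + `|chi| `^ r * (size s)%:R.
  apply: le_trans jensen _; rewrite -msum mulr_sumr -big_split /=; apply: ler_sum => a _.
  exact: h3.
have h5 : `|Phi (trie s)| `^ r / (size s)%:R `^ (r - 1) <=
    (1 + e^-1) `^ r * `|branching_toll phi (sized_trie s)| `^ r +
    (1 + e) `^ r * ((\sum_a x a) `^ r / (size s)%:R `^ (r - 1)).
  rewrite ler_pdivrMr//; apply: le_trans h1 _; rewrite mulrDl -[(1 + e) `^ r * _ * _]mulrA divfK ?gt_eqF// lerD2r.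
  by rewrite ler_peMr// mulr_ge0.
apply: le_trans h5 _; rewrite -addrA lerD2l -mulrA -mulrDr ler_wpM2l// [leRHS]addrC.
exact: h4.
Qed.

Let mtau l : 0 < l -> discrete_variable (tau l).
Proof. exact: (discrete_random_trie A_gt1 Xi_iid N_poisson). Qed.
Let mD l a : 0 < l -> discrete_variable (D l a).
Proof. by move=> l0; exact: (discrete_random_branch A_gt1 Xi_iid N_poisson a l0). Qed.

Let E l (g : C -> R) : \bar R := (\int[P]_w (g (tau l w))%:E)%E.

Let mg l (g : C -> R) : 0 < l -> measurable_fun setT (fun w => (g (tau l w))%:E).
Proof.
move=> l0; apply/measurable_EFinP.
exact: (measurable_fun_discrete g (mtau l0)).
Qed.

Let integral_branch l a (g : C -> R) : 0 < l -> (forall c, 0 <= g c) ->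
  (\int[P]_w (g (D l a w))%:E = E (l * p a) g)%E.
Proof.
move=> l0 g0; have la : 0 < l * p a by rewrite mulr_gt0.
apply: (ge0_integral_same_law (mD a l0) (mtau la) _ (g := fun c => (g c)%:E)).
  by move=> c; apply: (random_branch_law A_gt1 p_gt0 p_sum Xi_iid N_poisson N_independent a [set c] l0).
by move=> c; rewrite lee_fin.
Qed.

Let poisson_pmfE (l : R) n : 0 < l -> poisson_pmf l n = l ^+ n / n`!%:R * expR (- l).
Proof. by move=> l0; rewrite /poisson_pmf l0. Qed.

(** Two strings or more have probability [O(l ^ 2)], and the ratio of Poisson weights shows it term
    by term. The exponent 2, larger than 1, is what will make the recursion contract down to
    [l = 0]. *)
Let domination2 (l L : R) n : 0 < l -> l <= L -> (1 < n)%N ->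
  poisson_pmf l n <= expR L * (l / L) ^+ 2 * poisson_pmf L n.
Proof.
move=> l0 lL n1; have L0 : 0 < L by apply: lt_le_trans lL.
rewrite !poisson_pmfE//; have -> : expR L * (l / L) ^+ 2 * (L ^+ n / n`!%:R * expR (- L)) =
    (l / L) ^+ 2 * L ^+ n / n`!%:R * (expR L * expR (- L)) by ring.
rewrite -expRD subrr expR0 mulr1 -mulrA -[leRHS]mulrA.
have f0 : 0 < n`!%:R^-1 :> R by rewrite invr_gt0 ltr0n fact_gt0.
have h1 : l ^+ n <= (l / L) ^+ 2 * L ^+ n.
  rewrite -(subnK n1) !exprD expr_div_n mulrA mulrAC divfK ?expf_neq0 ?gt_eqF//.
  by rewrite [leRHS]mulrC ler_wpM2r ?exprn_ge0 ?(ltW l0)// lerXn2r// nnegrE ltW.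
have h2 : expR (- l) <= 1 by rewrite -expR0 ler_expR oppr_le0 ltW.
have h3 : 0 <= l ^+ n / n`!%:R by rewrite mulr_ge0 ?exprn_ge0 ?ltW.
rewrite mulrA; apply: (@le_trans _ _ (l ^+ n / n`!%:R)); first by rewrite ler_piMr.
by rewrite [leRHS]mulrA; apply: ler_wpM2r h1; exact: ltW.
Qed.

(** Exponential tilting: an exponential weight on the number of strings is traded for the larger
    intensity [expR 1 * l]. *)
Let exp_shift (l : R) n : 0 < l ->
  expR n%:R * poisson_pmf l n = expR (expR 1 * l - l) * poisson_pmf (expR 1 * l) n.
Proof.
move=> l0; have el0 : 0 < expR 1 * l by rewrite mulr_gt0// expR_gt0.
have -> : expR n%:R = expR 1 ^+ n :> R by rewrite -expRM_natl mulr1.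
rewrite !poisson_pmfE// exprMn.
have -> : expR (expR 1 * l - l) * (expR 1 ^+ n * l ^+ n / n`!%:R * expR (- (expR 1 * l))) =
  expR 1 ^+ n * (l ^+ n / n`!%:R) * (expR (expR 1 * l - l) * expR (- (expR 1 * l))) by ring.
by rewrite -expRD addrAC subrr add0r mulrA.
Qed.

Let phi_bound (L : R) : exists2 M, 0 <= M & forall l, 0 < l -> l <= L ->
  (E l (fun c => (`|branching_toll phi c| `^ r)%R) <= (M * l ^+ 2)%:E)%E.
Proof.
have [L1 [L10 LL1 iphi]] : exists L1, [/\ 0 < L1, L <= L1 &
    P.-integrable setT (EFin \o (fun w => `|phi (tau L1 w).2| `^ r))].
  have [L2 L20 h] := (near_pinftyP _).1 phi_moment.
  exists (Num.max L L2); split; [by rewrite lt_max L20 orbT|by rewrite le_max lexx|].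
  by apply: h; rewrite le_max lexx orbT.
pose I := \int[P]_w (`|phi (tau L1 w).2| `^ r).
have I0 : 0 <= I by apply: Rintegral_ge0 => w _; exact: powR_ge0.
exists (expR L1 / L1 ^+ 2 * I).
  by rewrite mulr_ge0// divr_ge0 ?expR_ge0// exprn_ge0// ltW.
move=> l l0 lL; have lL1 := le_trans lL LL1.
have k0 : 0 <= expR L1 * (l / L1) ^+ 2 by rewrite mulr_ge0 ?expR_ge0// exprn_ge0// divr_ge0 ?ltW.
have := @le_integral_random_trie _ _ _ P A p Xi N A_gt1 Xi_iid N_poisson N_independent l L1
  (fun c => `|branching_toll phi c| `^ r) (fun c => expR L1 * (l / L1) ^+ 2 * `|phi c.2| `^ r) l0 L10.
have h1 c : 0 <= `|branching_toll phi c| `^ r by exact: powR_ge0.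
have h2 (c : C) : 0 <= expR L1 * (l / L1) ^+ 2 * `|phi c.2| `^ r by rewrite mulr_ge0 ?powR_ge0.
move=> /(_ h1 h2) h3; apply: le_trans (h3 _) _.
  move=> c; rewrite /branching_toll; case: ifP => [c1|_]; last first.
    by rewrite normr0 powR0 ?gt_eqF// mul0r mulr_ge0// poisson_pmf_ge0.
  rewrite mulrC mulrAC ler_wpM2r ?powR_ge0//; exact: domination2.
have i2 : P.-integrable setT (EFin \o (fun w => expR L1 * (l / L1) ^+ 2 * `|phi (tau L1 w).2| `^ r)).
  exact: (@integrable_scale _ _ _ P _ (fun w => `|phi (tau L1 w).2| `^ r)).
apply: le_trans (_ : _ <= (\int[P]_w (expR L1 * (l / L1) ^+ 2 * `|phi (tau L1 w).2| `^ r))%:E)%E _.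
  by rewrite -Rintegral_EFin.
rewrite lee_fin (RintegralZl _ measurableT iphi) -/I le_eqVlt; apply/orP; left; apply/eqP.
by rewrite expr_div_n; ring.
Qed.

Let size_bound (L : R) : exists2 M, 0 <= M & forall l, 0 < l -> l <= L -> (E l size2 <= (M * l ^+ 2)%:E)%E.
Proof.
pose L1 := Num.max L 1; have L10 : 0 < L1 by rewrite lt_max ltr01 orbT.
have eL0 : 0 < expR 1 * L1 by rewrite mulr_gt0// expR_gt0.
exists (expR L1 / L1 ^+ 2 * expR (expR 1 * L1 - L1)).
  by rewrite mulr_ge0 ?expR_ge0// divr_ge0 ?expR_ge0// exprn_ge0// ltW.
move=> l l0 lL; have lL1 : l <= L1 by rewrite le_max lL.
pose k := expR L1 * (l / L1) ^+ 2 * expR (expR 1 * L1 - L1).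
have k1 : 0 <= expR L1 * (l / L1) ^+ 2 by rewrite mulr_ge0 ?expR_ge0// exprn_ge0// divr_ge0 ?ltW.
have k0 : 0 <= k by rewrite mulr_ge0 ?expR_ge0.
have := @le_integral_random_trie _ _ _ P A p Xi N A_gt1 Xi_iid N_poisson N_independent l (expR 1 * L1)
  size2 (fun=> k) l0 eL0 size2_ge0 (fun=> k0).
move=> h; apply: le_trans (h _) _.
  move=> c; rewrite /size2; case: ifP => [c1|_]; last by rewrite mul0r mulr_ge0// poisson_pmf_ge0.
  rewrite /k -mulrA -exp_shift//.
  apply: (@le_trans _ _ (c.1%:R * (expR L1 * (l / L1) ^+ 2 * poisson_pmf L1 c.1))).
    by rewrite ler_wpM2l//; exact: domination2.
  rewrite mulrCA ler_wpM2l// ler_wpM2r ?poisson_pmf_ge0//.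
  by apply: le_trans (expR_ge1Dx _); rewrite lerDr.
rewrite (Rintegral_EFin (integrable_cst P k)) Rintegral_probability_cst lee_fin /k.
by rewrite le_eqVlt; apply/orP; left; apply/eqP; rewrite expr_div_n; ring.
Qed.

(** By induction on [h]: the toll and the single-string branches cost at most [K * l ^ 2], and the
    branches inherit [(l * p a) ^ 2], whose sum carries the factor [th < 1]. The value of [M] solves
    [M = K + (1 + eta) * th * M]. *)
Let Zh_bound (L : R) : exists2 M, 0 <= M & forall h l, 0 < l -> l <= L ->
  (E l (Zh h) <= (M * l ^+ 2)%:E)%E.
Proof.
have [rho rho01 p_rho] := max_letter A_gt1 p_gt0 p_sum.
pose th := \sum_a p a `^ 2.
have th1 : th < 1 by apply: (sum_powR_lt1 p_gt0 rho01 p_rho p_sum); rewrite ltr1n.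
have th0 : 0 <= th by apply: sumr_ge0 => a _; exact: powR_ge0.
(* With this choice [(1 + eta) * th < 1]; next, [e] is taken with [(1 + e) ^ r = 1 + eta]. *)
pose eta := (1 - th) / 2; have eta0 : 0 < eta by rewrite divr_gt0// subr_gt0.
pose e := (1 + eta) `^ r^-1 - 1.
have e0 : 0 < e.
  have := @gt0_ltr_powR R r^-1 _ 1 (1 + eta); rewrite powR1 subr_gt0 !nnegrE invr_gt0 ltrDl.
  by apply => //; rewrite addr_ge0// ltW.
have eE : (1 + e) `^ r = 1 + eta.
  by rewrite addrC subrK -powRrM mulVf ?gt_eqF// powRr1// addr_ge0// ltW.
have [M1 M10 H1] := phi_bound L; have [M2 M20 H2] := size_bound L.
pose k1 := (1 + e^-1) `^ r; pose k2 := (1 + e) `^ r * `|chi| `^ r.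
have k10 : 0 <= k1 := powR_ge0 _ _.
have k20 : 0 <= k2 by rewrite mulr_ge0 ?powR_ge0.
pose K := k1 * M1 + k2 * M2; have K0 : 0 <= K by rewrite addr_ge0// mulr_ge0.
have kap1 : 0 < 1 - (1 + eta) * th by rewrite /eta; nra.
pose M := K / (1 - (1 + eta) * th); have M0 : 0 <= M by rewrite divr_ge0// ltW.
exists M => //; elim=> [|h IH] l l0 lL.
  (* At height 0 the truncated quantity vanishes: two or more separated strings give a trie with a
     root, and strings never separated give [fset0], where the functional is 0. *)
  apply: (@le_trans _ _ 0%E); last by rewrite lee_fin mulr_ge0// sqr_ge0.
  rewrite /E (_ : (fun w => _) = cst 0%E) ?integral0//.
  apply/funext => w; rewrite /Zh; case: ifPn => // hl; congr (_%:E).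
  rewrite /Z; case: ifPn => // n1; move: hl n1; rewrite /random_sized_trie /sized_trie /=.
  set s := strings _ _ _ => hl s1; have [[L' sL]|ns] := pselect (exists L', separated L' s).
    by rewrite (lower0 s1 sL) in hl.
  rewrite trie_not_separated ?additive_functional0 ?normr0 ?powR0 ?gt_eqF ?mul0r//.
  by move=> L'; apply/negP => sL; apply: ns; exists L'.
pose F w := k1 * `|branching_toll phi (tau l w)| `^ r + k2 * size2 (tau l w)
    + (1 + eta) * \sum_a Zh h (D l a w).
have hae : {ae P, forall w, setT w -> ((Zh h.+1 (tau l w))%:E <= (F w)%:E)%E}.
  have := random_strings_separatedS A_gt1 p_gt0 p_sum Xi_iid N_poisson N_independent l0.
  apply: filterS => w [L' sL] _; rewrite lee_fin; have := @Z_step e L' h _ e0 sL.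
  by rewrite /F /k1 /k2 -eE.
have mZb a : measurable_fun setT (fun w => (Zh h (D l a w))%:E).
  by apply/measurable_EFinP; exact: (measurable_fun_discrete (Zh h) (mD a l0)).
have mS : measurable_fun setT (fun w => ((1 + eta) * \sum_a Zh h (D l a w))%:E).
  apply/measurable_EFinP; apply: measurable_funM => //; apply: measurable_sum => a.
  exact: (measurable_fun_discrete (Zh h) (mD a l0)).
have m1 : measurable_fun setT (fun w => (k1 * `|branching_toll phi (tau l w)| `^ r)%:E).
  exact: (mg (fun c => k1 * `|branching_toll phi c| `^ r) l0).
have m2 : measurable_fun setT (fun w => (k2 * size2 (tau l w))%:E).
  exact: (mg (fun c => k2 * size2 c) l0).
have S0 w : 0 <= \sum_a Zh h (D l a w) by apply: sumr_ge0.
have eta1 : 0 <= 1 + eta by rewrite addr_ge0// ltW.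
have step : (E l (Zh h.+1) <= k1%:E * E l (fun c => (`|branching_toll phi c| `^ r)%R) + k2%:E * E l size2
    + (1 + eta)%:E * \sum_a E (l * p a) (Zh h))%E.
  apply: le_trans (ae_ge0_le_integral _ _ _ _ _ hae) _ => //.
  - by move=> w _; rewrite lee_fin.
  - exact: mg.
  - by move=> w _; rewrite lee_fin !addr_ge0// mulr_ge0// powR_ge0.
  - have := emeasurable_funD (emeasurable_funD m1 m2) mS; apply: eq_measurable_fun => w _.
    by rewrite -!EFinD.
  rewrite /F; under eq_integral do rewrite 2!EFinD.
  rewrite ge0_integralD//; last 3 first.
  - by move=> w _; rewrite -EFinD lee_fin addr_ge0// mulr_ge0// powR_ge0.
  - exact: emeasurable_funD.
  - by move=> w _; rewrite lee_fin mulr_ge0.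
  rewrite ge0_integralD//; last 2 first.
  - by move=> w _; rewrite lee_fin mulr_ge0// powR_ge0.
  - by move=> w _; rewrite lee_fin mulr_ge0.
  apply: leeD; [apply: leeD|].
  - under eq_integral do rewrite EFinM.
    rewrite ge0_integralZl//.
    + exact: (mg (fun c => `|branching_toll phi c| `^ r) l0).
  - by under eq_integral do rewrite EFinM; rewrite ge0_integralZl//; [exact: mg|move=> w _; rewrite lee_fin].
  - under eq_integral do rewrite EFinM -sumEFin.
    rewrite ge0_integralZl//; last 2 first.
    + by apply: emeasurable_sum => a.
    + by move=> w _; apply: sume_ge0 => a _; rewrite lee_fin.
    have Zb0 a w : setT w -> (0 <= (Zh h (D l a w))%:E)%E by move=> _; rewrite lee_fin.
    rewrite (ge0_integral_sum P measurableT mZb Zb0).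
    apply: lee_wpmul2l; first by rewrite lee_fin.
    by apply: lee_sum => a _; rewrite (integral_branch a l0 (Zh_ge0 h)); exact: lexx.
apply: le_trans step _.
apply: (@le_trans _ _ (k1%:E * (M1 * l ^+ 2)%:E + k2%:E * (M2 * l ^+ 2)%:E +
    (1 + eta)%:E * \sum_a (M * (l * p a) ^+ 2)%:E)%E).
  apply: leeD; [apply: leeD|].
  - by apply: lee_wpmul2l; [rewrite lee_fin|exact: H1].
  - by apply: lee_wpmul2l; [rewrite lee_fin|exact: H2].
  - apply: lee_wpmul2l; first by rewrite lee_fin.
    apply: lee_sum => a _; apply: IH; first by rewrite mulr_gt0.
    apply: le_trans lL; rewrite ger_pMr//; apply: le_trans (p_rho a) _.
    by case/andP: rho01 => _ /ltW.
rewrite sumEFin -!EFinM -!EFinD lee_fin.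
have -> : \sum_a M * (l * p a) ^+ 2 = M * l ^+ 2 * th.
  rewrite /th mulr_sumr; apply: eq_bigr => a _.
  by rewrite exprMn mulrA -[p a ^+ 2](powR_mulrn 2 (ltW (p_gt0 a))).
have -> : k1 * (M1 * l ^+ 2) + k2 * (M2 * l ^+ 2) + (1 + eta) * (M * l ^+ 2 * th) =
    (K + M * ((1 + eta) * th)) * l ^+ 2 by rewrite /K; ring.
rewrite ler_wpM2r ?sqr_ge0// -lerBrDr -[X in X - _]mulr1 -mulrBr /M divfK ?gt_eqF//.
Qed.

Let Z_bound (L : R) : exists2 M, 0 <= M & forall l, 0 < l -> l <= L ->
  (E l Z <= (M * l ^+ 2)%:E)%E.
Proof.
have [M M0 HM] := Zh_bound L; exists M => // l l0 lL.
have cvgZ c : (Zh h c)%:E @[h --> \oo] --> (Z c)%:E.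
  have [h0 hc] := lower_ex c.2; apply: cvg_near_cst; exists h0 => // h /= h0h.
  by rewrite /Zh (lowerW h0h hc).
have nd w : setT w -> {homo (fun h => (Zh h (tau l w))%:E) : n m / (n <= m)%N >-> (n <= m)%E}.
  move=> _ n m nm; rewrite lee_fin /Zh; case: ifPn => [hn|_]; last by case: ifP.
  by rewrite (lowerW nm hn).
have Zh0 h w : setT w -> (0 <= (Zh h (tau l w))%:E)%E by move=> _; rewrite lee_fin.
have cvgE := @cvg_monotone_convergence _ _ _ P setT measurableT (fun h w => (Zh h (tau l w))%:E)
  (fun h => mg (Zh h) l0) Zh0 nd.
have -> : E l Z = (\int[P]_w (limn (fun h => (Zh h (tau l w))%:E)))%E.
  by apply: eq_integral => w _; apply/esym/cvg_lim => //; exact: cvgZ.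
by apply: (cvge_le (F := \oo) _ cvgE) => //; apply: nearW => h; exact: HM.
Qed.

(** The weight in [Z] is removed by bounding [n ^ (r - 1)] by a multiple of [expR n] and tilting,
    which is why [Z_bound] is used up to [expR 1 * L]. Fewer than two strings contribute at most the
    [r]-th power of the toll of a leaf. *)
Lemma functional_moment_bounded (L : R) : exists B, forall l, 0 < l -> l <= L ->
  P.-integrable setT (EFin \o (fun w => `|Phi (tau l w).2| `^ r)) /\
  \int[P]_w (`|Phi (tau l w).2| `^ r) <= B.
Proof.
have e1 : 0 < expR 1 :> R := expR_gt0 1.
have [M M0 HM] := Z_bound (expR 1 * L).
have r10 : 0 < r - 1 by rewrite subr_gt0.
pose k l := expR (expR 1 * l - l) * (r - 1) `^ (r - 1).
pose B := expR ((expR 1 - 1) * L) * (r - 1) `^ (r - 1) * (M * (expR 1 * L) ^+ 2) + `|chi| `^ r.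
exists B => l l0 lL; have el0 : 0 < expR 1 * l by rewrite mulr_gt0.
have k0 : 0 <= k l by rewrite mulr_ge0 ?expR_ge0 ?powR_ge0.
pose F1 (c : C) := if (1 < c.1)%N then `|Phi c.2| `^ r else 0.
have F10 c : 0 <= F1 c by rewrite /F1; case: ifP => // _; exact: powR_ge0.
have PF w : `|Phi (tau l w).2| `^ r <= F1 (tau l w) + `|chi| `^ r.
  have c0 : 0 <= `|chi| `^ r := powR_ge0 _ _.
  rewrite /F1 /random_sized_trie /sized_trie /=; case: (strings Xi (N l w) w) => [|x [|x' s]].
  - by rewrite trie_nil additive_functional0 normr0 powR0 ?gt_eqF//= add0r.
  - by rewrite trie1 additive_functional1 /= add0r.
  - by rewrite /= lerDl.
have EF1 : (E l F1 <= (k l * (M * (expR 1 * l) ^+ 2))%:E)%E.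
  have h1 c : 0 <= k l * Z c by rewrite mulr_ge0.
  have := @le_integral_random_trie _ _ _ P A p Xi N A_gt1 Xi_iid N_poisson N_independent l (expR 1 * l)
    F1 (fun c => k l * Z c) l0 el0 F10 h1.
  move=> h; apply: le_trans (h _) _.
    move=> c; rewrite /F1 /Z; case: ifPn => [c1|_]; last by rewrite mulr0 !mul0r.
    have n0 : 0 < c.1%:R `^ (r - 1) :> R by rewrite powR_gt0// ltr0n ltnW.
    have n1 := powR_le_expR r10 (ler0n R c.1).
    set f := `|Phi c.2| `^ r; have f0 : 0 <= f := powR_ge0 _ _.
    have q0 : 0 <= f / c.1%:R `^ (r - 1) by rewrite divr_ge0// ltW.
    have -> : k l * (f / c.1%:R `^ (r - 1)) * poisson_pmf (expR 1 * l) c.1 =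
        f / c.1%:R `^ (r - 1) * ((r - 1) `^ (r - 1) * (expR (expR 1 * l - l) * poisson_pmf (expR 1 * l) c.1)).
      by rewrite /k; ring.
    rewrite -exp_shift// mulrA.
    have -> : f * poisson_pmf l c.1 = f / c.1%:R `^ (r - 1) * (c.1%:R `^ (r - 1) * poisson_pmf l c.1).
      by rewrite mulrA divfK ?gt_eqF.
    by rewrite -[leRHS]mulrA ler_wpM2l// mulrA ler_wpM2r ?poisson_pmf_ge0.
  under eq_integral do rewrite EFinM.
  rewrite ge0_integralZl//; last 2 first.
  - exact: mg.
  - by move=> w _; rewrite lee_fin.
  rewrite [leRHS]EFinM; apply: lee_wpmul2l; first by rewrite lee_fin.
  by apply: HM => //; rewrite ler_pM2l.
have E1 : (\int[P]_w (`|Phi (tau l w).2| `^ r)%:E <= (k l * (M * (expR 1 * l) ^+ 2) + `|chi| `^ r)%:E)%E.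
  apply: (@le_trans _ _ (\int[P]_w ((F1 (tau l w))%:E + (`|chi| `^ r)%:E))%E).
    apply: ge0_le_integral => //.
    - exact: (mg (fun c => `|Phi c.2| `^ r) l0).
    - by apply: emeasurable_funD; [exact: mg|exact: measurable_cst].
    - by move=> w _; rewrite -EFinD lee_fin.
  rewrite ge0_integralD//; [|by move=> w _; rewrite lee_fin|exact: mg].
  by rewrite (Rintegral_EFin (integrable_cst P (`|chi| `^ r))) Rintegral_probability_cst [leRHS]EFinD; apply: leeD EF1 (lexx _).
have iPhi : P.-integrable setT (EFin \o (fun w => `|Phi (tau l w).2| `^ r)).
  apply/integrableP; split; first exact: (mg (fun c => `|Phi c.2| `^ r) l0).
  apply: le_lt_trans (ltry (k l * (M * (expR 1 * l) ^+ 2) + `|chi| `^ r)).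
  apply: le_trans E1; rewrite (eq_integral (fun w => (`|Phi (tau l w).2| `^ r)%:E)) ?lexx//.
  by move=> w _; rewrite /= ger0_norm ?powR_ge0.
split=> //; rewrite -lee_fin -Rintegral_EFin//; apply: le_trans E1 _; rewrite lee_fin /B lerD2r.
apply: ler_pM => //; first by rewrite mulr_ge0 ?sqr_ge0.
  rewrite /k ler_wpM2r ?powR_ge0// ler_expR -[X in _ - X]mul1r -mulrBl ler_wpM2l//.
rewrite ler_wpM2l// lerXn2r ?nnegrE ?mulr_ge0 ?(ltW e1) ?(ltW l0)//.
  by rewrite (le_trans (ltW l0)).
by rewrite ler_wpM2l// ltW.
Qed.

End base_moments.

(** * Normal approximation of additive functionals *)

Section means.
Context {d : measure_display} {T : measurableType d} {R : realType}.
Variable P : probability T R.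

Lemma mean_Rintegral (X : T -> R) : mean P X = \int[P]_w X w.
Proof. by rewrite /mean unlock. Qed.

Lemma var_Rintegral (X : T -> R) : var P X = \int[P]_w ((X w - \int[P]_v X v) ^+ 2).
Proof.
rewrite /var /variance covariance.unlock expectation.unlock; apply: eq_Rintegral => w _.
by rewrite expr2.
Qed.

Lemma le_Rintegral_ae (X Y : T -> R) : measurable_fun setT X ->
  P.-integrable setT (EFin \o X) -> P.-integrable setT (EFin \o Y) ->
  (forall w, 0 <= X w) -> (forall w, 0 <= Y w) ->
  {ae P, forall w, X w <= Y w} -> \int[P]_w X w <= \int[P]_w Y w.
Proof.
move=> mX iX iY X0 Y0 XY; rewrite -lee_fin -!Rintegral_EFin//.
have [/measurable_EFinP mY _] := integrableP _ _ _ iY.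
apply: (ae_ge0_le_integral measurableT) => //.
- by move=> w _; rewrite lee_fin.
- exact/measurable_EFinP.
- by move=> w _; rewrite lee_fin.
- exact/measurable_EFinP.
- by apply: filterS XY => w h _; rewrite lee_fin.
Qed.

Lemma eq_Rintegral_ae (X Y : T -> R) : measurable_fun setT X -> measurable_fun setT Y ->
  {ae P, forall w, X w = Y w} -> \int[P]_w X w = \int[P]_w Y w.
Proof.
move=> mX mY XY; apply: (congr1 fine); apply: ae_eq_integral => //.
- exact/measurable_EFinP.
- exact/measurable_EFinP.
- by apply: filterS XY => w h _; rewrite h.
Qed.

Lemma Rintegral_bigsum (I : Type) (s : seq I) (X : I -> T -> R) :
  (forall i, P.-integrable setT (EFin \o X i)) ->
  \int[P]_w (\sum_(i <- s) X i w) = \sum_(i <- s) \int[P]_w X i w /\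
  P.-integrable setT (EFin \o (fun w => \sum_(i <- s) X i w)).
Proof.
move=> iX; elim: s => [|i s [IH iS]].
  rewrite (_ : (fun w => _) = fun=> 0); last by apply/funext => w; rewrite big_nil.
  by rewrite big_nil Rintegral_probability_cst; split=> //; exact: integrable_cst.
rewrite (_ : (fun w => _) = fun w => X i w + \sum_(j <- s) X j w); last first.
  by apply/funext => w; rewrite big_cons.
split; last exact: (@integrable_add _ _ _ P).
by rewrite (RintegralD measurableT (iX i) iS) IH big_cons.
Qed.

End means.

Lemma continuous_abs_powR (R : realType) (s : R) : 0 < s -> continuous (fun x : R => `|x| `^ s).
Proof.
move=> s0 x; have [->|x0] := eqVneq x 0; last first.
  have nx0 : 0 < `|x| by rewrite normr_gt0.
  have D := @is_derive1_powR R s `|x| nx0.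
  apply: (@continuous_comp _ _ _ (fun x : R => `|x|) (fun z : R => z `^ s)); first exact: norm_continuous.
  by apply: differentiable_continuous; apply/derivable1_diffP; case: D.
apply/cvgrPdist_le => e e0; rewrite normr0 powR0 ?gt_eqF//.
near=> t; rewrite sub0r normrN ger0_norm ?powR_ge0//.
have -> : e = (e `^ s^-1) `^ s by rewrite -powRrM mulVf ?gt_eqF// powRr1// ltW.
apply: powR_le; [exact: ltW|exact: normr_ge0|].
near: t; apply: (@cvgr0_norm_le _ _ _ (nbhs (0 : R)) _ id); first exact: cvg_id.
by rewrite powR_gt0.
Unshelve. all: by end_near. Qed.

(** * The centred functional as a recursive family *)

Section trie_clt.
Context {d : measure_display} {T : measurableType d} {R : realType}.
Variable P : probability T R.
Context {A : finType}.
Variables (p : A -> R) (Xi : nat -> T -> nat -> A) (N : R -> T -> nat).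
Hypotheses (A_gt1 : (1 < #|A|)%N) (p_gt0 : forall a, 0 < p a) (p_sum : \sum_a p a = 1).
Hypothesis Xi_iid : iid_strings P p Xi.
Hypothesis N_poisson : forall l, 0 < l -> poisson_distributed P l (N l).
Hypothesis N_independent : forall l, 0 < l -> independent_of_strings P Xi (N l).
Variables (phi : {fset (seq A)} -> R) (r : R).
Hypothesis phi_toll : toll_function phi.
Hypothesis r_gt2 : 2 < r.
Local Notation C := (nat * {fset (seq A)})%type.
Local Notation tau := (random_sized_trie Xi N).
Local Notation D := (random_sized_branch Xi N).
Local Notation Phi := (additive_functional phi).
Local Notation chi := (phi [fset [::]]%fset).
Local Notation integrable X := (P.-integrable setT (EFin \o X)).

Let m l := \int[P]_w Phi (tau l w).2.
Let ephi l := \int[P]_w phi (tau l w).2.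
Let dphi l w := phi (tau l w).2 - ephi l.

Hypothesis phi_integrable : \forall l \near +oo_R, integrable (fun w => `|dphi l w| `^ r).
Variable y : R.
Hypothesis phi_moment : \forall l \near +oo_R, \int[P]_w (`|dphi l w| `^ r) <= y * l `^ (r / 2).
Hypothesis phi_var : forall e, 0 < e -> \forall l \near +oo_R, \int[P]_w (dphi l w ^+ 2) <= e * l.
Variable v : R.
Hypothesis Phi_var : \forall l \near +oo_R, \int[P]_w ((Phi (tau l w).2 - m l) ^+ 2) <= v * l.

Let r_gt0 : 0 < r. Proof. by rewrite (lt_trans _ r_gt2). Qed.
Let r_ge0 : 0 <= r. Proof. exact: ltW. Qed.
Let r_ge1 : 1 <= r. Proof. by rewrite ltW// (lt_trans _ r_gt2)// ltr1n. Qed.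

Let u l (c : C) := Phi c.2 - m l.
Definition centered_functional l w := u l (tau l w).
Local Notation U := centered_functional.
Let Y l w := U l w - \sum_a u (l * p a) (D l a w).

Let mtau l : 0 < l -> discrete_variable (tau l).
Proof. exact: (discrete_random_trie A_gt1 Xi_iid N_poisson). Qed.
Let mD l a : 0 < l -> discrete_variable (D l a).
Proof. by move=> l0; exact: (discrete_random_branch A_gt1 Xi_iid N_poisson a l0). Qed.

Let mg l (g : C -> R) : 0 < l -> measurable_fun setT (fun w => g (tau l w)).
Proof. by move=> l0; exact: (measurable_fun_discrete g (mtau l0)). Qed.

Let lp_gt0 l a : 0 < l -> 0 < l * p a. Proof. by move=> l0; exact: mulr_gt0. Qed.

Let integrable_of_power (X : T -> R) : measurable_fun setT X -> integrable (fun w => `|X w| `^ r) -> integrable X.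
Proof.
move=> mX iX; have : integrable (fun w => `|X w| `^ 1).
  by apply: integrable_powR_le iX => //; rewrite ler01.
move=> i1; apply: (@integrable_le _ _ _ P _ (fun w => `|X w| `^ 1)) => // w.
by rewrite powRr1.
Qed.

Let sqr_integrable_of_power (X : T -> R) : measurable_fun setT X -> integrable (fun w => `|X w| `^ r) ->
  integrable (fun w => X w ^+ 2).
Proof.
move=> mX iX; have : integrable (fun w => `|X w| `^ 2).
  by apply: integrable_powR_le iX => //; rewrite ler0n ltW.
by apply: eq_integrable => // w _ /=; rewrite powR_mulrn// real_normK// num_real.
Qed.

Let integrable_power_shift (X : T -> R) c : measurable_fun setT X -> integrable (fun w => `|X w| `^ r) ->
  integrable (fun w => `|X w + c| `^ r).
Proof.
by move=> mX iX; apply: (@integrable_powR_add _ _ _ P r X (fun=> c)) => //; exact: integrable_cst.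
Qed.

Let phi_power : \forall l \near +oo_R, integrable (fun w => `|phi (tau l w).2| `^ r).
Proof.
apply: filterS2 phi_integrable (nbhs_pinfty_gt (num_real (0 : R))) => l iphi l0.
have mphi : measurable_fun setT (dphi l) by exact: (mg (fun c => phi c.2 - ephi l) l0).
have := integrable_power_shift (ephi l) mphi iphi; apply: eq_integrable => // w _ /=.
by rewrite /dphi subrK.
Qed.

Let Phi_power (L : R) : exists B, forall l, 0 < l -> l <= L ->
  integrable (fun w => `|Phi (tau l w).2| `^ r) /\ \int[P]_w (`|Phi (tau l w).2| `^ r) <= B.
Proof.
exact: (functional_moment_bounded A_gt1 p_gt0 p_sum Xi_iid N_poisson N_independent r_gt2 phi_power).
Qed.

Let mPhi l : 0 < l -> measurable_fun setT (fun w => Phi (tau l w).2).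
Proof. exact: (mg (fun c => Phi c.2)). Qed.

Lemma measurable_centered_functional l : 0 < l -> measurable_fun setT (U l).
Proof. exact: (mg (u l)). Qed.
Local Notation mU := measurable_centered_functional.

Let iPhi_power l : 0 < l -> integrable (fun w => `|Phi (tau l w).2| `^ r).
Proof. by move=> l0; have [B HB] := Phi_power l; exact: (HB l l0 (lexx _)).1. Qed.

Let iPhi l : 0 < l -> integrable (fun w => Phi (tau l w).2).
Proof. by move=> l0; apply: integrable_of_power; [exact: mPhi|exact: iPhi_power]. Qed.

Lemma centered_functional_integrable l : 0 < l -> integrable (fun w => `|U l w| `^ r).
Proof. by move=> l0; apply: (integrable_power_shift (- m l) (mPhi l0)); exact: iPhi_power. Qed.
Local Notation U_integrable := centered_functional_integrable.

Lemma centered_functional_mean l : 0 < l -> \int[P]_w U l w = 0.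
Proof.
move=> l0; apply: etrans (RintegralB measurableT (iPhi l0) (integrable_cst P (m l))) _.
by rewrite Rintegral_probability_cst subrr.
Qed.
Local Notation U_mean := centered_functional_mean.

Let U_bounded L : exists B, forall l, 0 < l -> l <= L -> \int[P]_w (`|U l w| `^ r) <= B.
Proof.
have [B HB] := Phi_power L.
exists ((1 + 1) `^ r * B + (1 + 1^-1) `^ r * (1 + B) `^ r) => l l0 lL.
have [iP PB] := HB l l0 lL.
have i1 : integrable (fun w => (1 + 1) `^ r * `|Phi (tau l w).2| `^ r).
  exact: (@integrable_scale _ _ _ P _ (fun w => `|Phi (tau l w).2| `^ r)).
have mB : `|m l| <= 1 + B.
  apply: (@le_trans _ _ (\int[P]_w (1 + `|Phi (tau l w).2| `^ r))).
    apply: ler_normr_Rintegral; first exact: iPhi.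
      by apply: integrable_add => //; exact: integrable_cst.
    move=> w; rewrite -[leLHS](powRr1 (normr_ge0 _)); apply: powR_le1D.
    by rewrite ler01 r_ge1.
  by rewrite (RintegralD measurableT (integrable_cst _ _) iP) Rintegral_probability_cst lerD2l.
apply: (@le_trans _ _ (\int[P]_w ((1 + 1) `^ r * `|Phi (tau l w).2| `^ r + (1 + 1^-1) `^ r * (1 + B) `^ r))).
  apply: le_Rintegral => //; first exact: U_integrable.
    by apply: integrable_add => //; exact: integrable_cst.
  move=> w _; apply: le_trans (powR_normD_le2 _ _ r_ge0 (@ltr01 R)) _; rewrite normrN lerD2l.
  by rewrite ler_wpM2l ?powR_ge0//; apply: powR_le.
rewrite (RintegralD measurableT i1 (integrable_cst _ _)) Rintegral_probability_cst lerD2r.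
by rewrite (RintegralZl _ measurableT iP) ler_wpM2l ?powR_ge0.
Qed.

Let iD l a : 0 < l -> integrable (fun w => u (l * p a) (D l a w)).
Proof.
move=> l0; apply: (integrable_same_law (mD a l0) (mtau (lp_gt0 a l0)) _ (g := u (l * p a))).
  move=> c; exact: (random_branch_law A_gt1 p_gt0 p_sum Xi_iid N_poisson N_independent a [set c] l0).
apply: integrable_of_power; first exact: mU (lp_gt0 a l0).
exact: U_integrable (lp_gt0 a l0).
Qed.

Let meanD l a : 0 < l -> \int[P]_w u (l * p a) (D l a w) = 0.
Proof.
move=> l0; apply: etrans (Rintegral_same_law (mD a l0) (mtau (lp_gt0 a l0)) _ (u (l * p a))) _.
  move=> c; exact: (random_branch_law A_gt1 p_gt0 p_sum Xi_iid N_poisson N_independent a [set c] l0).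
exact: U_mean (lp_gt0 a l0).
Qed.

(** The two tolls differ only for a single string, by the toll of a leaf; for no string both vanish
    because [phi] is a toll function. *)
Let branching_toll_near c : (c = (0%N, fset0) \/ c.1 = 1%N /\ c.2 = [fset [::]]%fset \/ (1 < c.1)%N) ->
  `|branching_toll phi c - phi c.2| <= `|chi|.
Proof.
rewrite /branching_toll; case=> [->|[[c1 c2]|c1]] /=.
- by rewrite phi_toll subrr normr0.
- by rewrite c1 /= sub0r normrN c2.
- by rewrite c1 subrr normr0.
Qed.

Let sized_trie_cases (s : seq (nat -> A)) : let c := sized_trie s in
  c = (0%N, fset0) \/ c.1 = 1%N /\ c.2 = [fset [::]]%fset \/ (1 < c.1)%N.
Proof.
rewrite /sized_trie; case: s => [|x [|x' s]] /=; first by left; rewrite trie_nil.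
- by right; left; rewrite trie1.
- by right; right.
Qed.

(** Almost surely [Y] is [branching_toll] minus the constant [k]. All the centred functionals have
    mean 0, which identifies [k] with the mean of [branching_toll]; the toll and its mean are each
    within [|chi|] of those of [phi]. *)
Let Y_bound : \forall l \near +oo_R, {ae P, forall w, `|Y l w| <= `|dphi l w| + 2 * `|chi|}.
Proof.
apply: filterS2 phi_power (nbhs_pinfty_gt (num_real (0 : R))) => l iphi_r l0.
have mphi : measurable_fun setT (fun w => phi (tau l w).2) by exact: (mg (fun c => phi c.2) l0).
have iphi : integrable (fun w => phi (tau l w).2) by exact: integrable_of_power.
pose b w := branching_toll phi (tau l w).
have mb : measurable_fun setT b by exact: (mg (branching_toll phi) l0).
have bphi w : `|b w - phi (tau l w).2| <= `|chi| by apply: branching_toll_near; exact: sized_trie_cases.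
have ib : integrable b.
  apply: (@integrable_le _ _ _ P _ (fun w => `|phi (tau l w).2| + `|chi|)) => //.
    by apply: integrable_add; [exact: integrable_abs|exact: integrable_cst].
  by move=> w; rewrite -[b w](subrK (phi (tau l w).2)) addrC; apply: le_trans (ler_normD _ _) _; rewrite lerD2l.
pose k := m l - \sum_a m (l * p a).
have Yb : {ae P, forall w, Y l w = b w - k}.
  have := random_strings_separatedS A_gt1 p_gt0 p_sum Xi_iid N_poisson N_independent l0.
  apply: filterS => w [L sL]; rewrite /Y /U /u /b /k /random_sized_trie.
  by rewrite (additive_functional_split phi sL) sumrB; ring.
have iU : integrable (U l).
  by apply: integrable_of_power; [exact: mU|exact: U_integrable].
have iS : integrable (fun w => \sum_a u (l * p a) (D l a w)).
  exact: (Rintegral_bigsum _ (fun a => iD a l0)).2.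
have mS : measurable_fun setT (fun w => \sum_a u (l * p a) (D l a w)).
  by apply: measurable_sum => a; exact: (measurable_fun_discrete (u (l * p a)) (mD a l0)).
have EY : \int[P]_w Y l w = 0.
  apply: etrans (RintegralB measurableT iU iS) _; rewrite (U_mean l0) sub0r.
  apply/eqP; rewrite oppr_eq0; apply/eqP.
  rewrite (Rintegral_bigsum _ (fun a => iD a l0)).1 big1// => a _; exact: meanD.
have kE : k = \int[P]_w b w.
  apply/esym/eqP; rewrite -subr_eq0; apply/eqP; apply: etrans EY.
  have mY : measurable_fun setT (Y l) by apply: measurable_funB; [exact: mU|].
  rewrite (eq_Rintegral_ae mY _ Yb); last exact: measurable_funB.
  by rewrite (RintegralB measurableT ib (integrable_cst _ _)) Rintegral_probability_cst.
have kphi : `|k - ephi l| <= `|chi|.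
  rewrite kE -[X in _ <= X](Rintegral_probability_cst P) /ephi -(RintegralB measurableT ib iphi).
  apply: ler_normr_Rintegral => //; [exact: integrable_sub|exact: integrable_cst].
apply: filterS Yb => w ->; rewrite /dphi.
have -> : b w - k = (phi (tau l w).2 - ephi l) + ((b w - phi (tau l w).2) - (k - ephi l)) by ring.
apply: le_trans (ler_normD _ _) _; rewrite lerD2l; apply: le_trans (ler_normB _ _) _.
by rewrite mulr_natl mulr2n; apply: lerD.
Qed.

Let iDr l a : 0 < l -> integrable (fun w => `|u (l * p a) (D l a w)| `^ r).
Proof.
move=> l0; apply: (integrable_same_law (mD a l0) (mtau (lp_gt0 a l0)) _ (g := fun c => `|u (l * p a) c| `^ r)).
  move=> c; exact: (random_branch_law A_gt1 p_gt0 p_sum Xi_iid N_poisson N_independent a [set c] l0).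
exact: U_integrable (lp_gt0 a l0).
Qed.

Let mS l : 0 < l -> measurable_fun setT (fun w => \sum_a u (l * p a) (D l a w)).
Proof.
by move=> l0; apply: measurable_sum => a; exact: (measurable_fun_discrete (u (l * p a)) (mD a l0)).
Qed.

Let mY l : 0 < l -> measurable_fun setT (Y l).
Proof. by move=> l0; apply: measurable_funB; [exact: mU|exact: mS]. Qed.

Let iY l : 0 < l -> integrable (fun w => `|Y l w| `^ r).
Proof.
move=> l0; apply: (@integrable_powR_add _ _ _ P r (U l) (fun w => - \sum_a u (l * p a) (D l a w))) => //.
- exact: mU.
- by apply: measurableT_comp => //; exact: mS.
- exact: U_integrable.
- under eq_fun do rewrite normrN.
  apply: (@integrable_discrete_sum _ _ _ P C A (D l) (fun a => u (l * p a)) (fun a => mD a l0) r) => // a.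
  exact: iDr.
Qed.

Let mdphi l : 0 < l -> measurable_fun setT (dphi l).
Proof. exact: (mg (fun c => phi c.2 - ephi l)). Qed.

Let Y_var e : 0 < e -> \forall l \near +oo_R, \int[P]_w (Y l w ^+ 2) <= e * l.
Proof.
move=> e0; have e4 : 0 < e / 4 by rewrite divr_gt0.
(* In [Y ^ 2 <= 2 * dphi ^ 2 + 8 * chi ^ 2] the first term has mean at most [e / 2 * l], and so has
   the second when [l >= 16 * chi ^ 2 / e]. *)
apply: filterS3 (filterI Y_bound phi_integrable) (phi_var e4) (nbhs_pinfty_ge (num_real (Num.max 1 (16 * `|chi| ^+ 2 / e)))).
move=> l [Yb iphi] vl; rewrite ge_max => /andP[l1 chil].
have l0 : 0 < l by apply: lt_le_trans l1.
have id2 : integrable (fun w => dphi l w ^+ 2) by apply: sqr_integrable_of_power iphi; exact: mdphi.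
have i2 : integrable (fun w => 2 * dphi l w ^+ 2).
  exact: (@integrable_scale _ _ _ P 2 (fun w => dphi l w ^+ 2)).
apply: (@le_trans _ _ (\int[P]_w (2 * dphi l w ^+ 2 + 8 * `|chi| ^+ 2))).
  apply: le_Rintegral_ae.
  - by apply: measurable_funX; exact: mY.
  - by apply: sqr_integrable_of_power; [exact: mY|exact: iY].
  - by apply: integrable_add => //; exact: integrable_cst.
  - by move=> w; exact: sqr_ge0.
  - by move=> w; rewrite addr_ge0// mulr_ge0// sqr_ge0.
  apply: filterS Yb => w h.
  rewrite -(real_normK (num_real (Y l w))) -(real_normK (num_real (dphi l w))).
  have h0 := normr_ge0 (Y l w); have h1 := normr_ge0 (dphi l w); have h2 := normr_ge0 chi.
  move: (`|Y l w|) (`|dphi l w|) (`|chi|) h h0 h1 h2 => a b c h h0 h1 h2.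
  by have := sqr_ge0 (b - 2 * c); nra.
rewrite (RintegralD measurableT i2 (integrable_cst _ _)) Rintegral_probability_cst.
rewrite (RintegralZl _ measurableT id2).
move: chil; rewrite ler_pdivrMr// mulrC => chil; lra.
Qed.

Let Y_moment : \forall l \near +oo_R,
  \int[P]_w (`|Y l w| `^ r) <= ((1 + 1) `^ r * `|y| + (1 + 1^-1) `^ r * (2 * `|chi|) `^ r) * l `^ (r / 2).
Proof.
apply: filterS3 (filterI Y_bound phi_integrable) phi_moment (nbhs_pinfty_ge (num_real (1 : R))).
move=> l [Yb iphi] vl l1; have l0 : 0 < l by apply: lt_le_trans l1.
have i2 : integrable (fun w => (1 + 1) `^ r * `|dphi l w| `^ r).
  exact: (@integrable_scale _ _ _ P _ (fun w => `|dphi l w| `^ r)).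
have x0 : 0 <= 2 * `|chi| by rewrite mulr_ge0.
apply: (@le_trans _ _ (\int[P]_w ((1 + 1) `^ r * `|dphi l w| `^ r + (1 + 1^-1) `^ r * (2 * `|chi|) `^ r))).
  apply: le_Rintegral_ae.
  - by apply: measurable_abs_powR; exact: mY.
  - exact: iY.
  - by apply: integrable_add => //; exact: integrable_cst.
  - by move=> w; exact: powR_ge0.
  - by move=> w; rewrite addr_ge0// mulr_ge0// powR_ge0.
  apply: filterS Yb => w h.
  have := powR_normD_le2 `|dphi l w| (2 * `|chi|) r_ge0 (@ltr01 R).
  rewrite normr_id (ger0_norm x0) (ger0_norm (addr_ge0 (normr_ge0 _) x0)).
  by apply: le_trans; apply: powR_le.
rewrite (RintegralD measurableT i2 (integrable_cst _ _)) Rintegral_probability_cst.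
rewrite (RintegralZl _ measurableT iphi) [leRHS]mulrDl; apply: lerD.
  rewrite -mulrA ler_wpM2l ?powR_ge0//; apply: le_trans vl _.
  by rewrite ler_wpM2r ?powR_ge0// ler_norm.
rewrite ler_peMr ?mulr_ge0 ?powR_ge0//.
by rewrite -[X in X <= _](powRr0 l); apply: ler_powR => //; rewrite divr_ge0.
Qed.

Definition functional_variance l := \int[P]_w (U l w ^+ 2).
Local Notation V := functional_variance.

Let q := Num.min r 3.

Let moment_growth : exists B, \forall l \near +oo_R, \int[P]_w (`|U l w| `^ r) <= B * l `^ (r / 2).
Proof.
have [rho rho01 p_rho] := max_letter A_gt1 p_gt0 p_sum.
exact: (@recursive_moment_growth _ _ _ P C A p rho r tau D u p_gt0 p_sum rho01 p_rho r_gt2 mtau mD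
  (fun l l0 => independent_random_branches A_gt1 p_gt0 p_sum Xi_iid N_poisson N_independent l0)
  (fun l a c l0 => random_branch_law A_gt1 p_gt0 p_sum Xi_iid N_poisson N_independent a [set c] l0)
  U_integrable U_bounded v Phi_var _ Y_moment).
Qed.

Let clt e : 0 < e -> \forall l \near +oo_R, forall K1 K f x,
  bounded_lipschitz K1 f -> taylor_bound q K f ->
  `|\int[P]_w f (x + U l w) - gauss_op (V l) f x| <= e * (K1 * Num.sqrt l + K * l `^ (q / 2)).
Proof.
have [rho rho01 p_rho] := max_letter A_gt1 p_gt0 p_sum.
exact: (@recursive_clt _ _ _ P C A p rho r tau D u p_gt0 p_sum rho01 p_rho r_gt2 mtau mD
  (fun l l0 => independent_random_branches A_gt1 p_gt0 p_sum Xi_iid N_poisson N_independent l0)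
  (fun l a c l0 => random_branch_law A_gt1 p_gt0 p_sum Xi_iid N_poisson N_independent a [set c] l0)
  U_integrable U_bounded U_mean v Phi_var Y_var _ Y_moment).
Qed.

Section scaled.
Variables (c dl v' : R -> R) (k : R) (X : R -> T -> R).
Hypothesis c_gt0 : \forall l \near +oo_R, 0 < c l.
Hypothesis c_le : \forall l \near +oo_R, c l <= k.
Hypothesis dl_small : forall e, 0 < e -> \forall l \near +oo_R, `|dl l| <= e.
Hypothesis v'_close : forall e, 0 < e -> \forall l \near +oo_R, `|(c l) ^+ 2 * (V l / l) - v' l| <= e.
Hypothesis XE : \forall l \near +oo_R, forall w, X l w = c l * (U l w / Num.sqrt l) + dl l.

Let transfer (g : R -> R) K s : continuous g -> 0 <= s -> s < r ->
  (forall x, `|g x| <= K * (1 + `|x| `^ s)) ->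
  approx_moment (fun=> P) X (fun l => centered_normal (v' l)) (fun=> id) g.
Proof.
move=> cg s0 sr gK; have mg' : measurable_fun setT g by exact: continuous_measurable_fun.
have [B HB] := moment_growth.
have q_gt2 : 2 < q by rewrite lt_min r_gt2 ltr_nat.
have q_le3 : q <= 3 by rewrite ge_min lexx orbT.
have q_le : q <= r by rewrite ge_min lexx.
have V_ge0 l : 0 <= V l by apply: Rintegral_ge0 => w _; exact: sqr_ge0.
have [h1 h2] := @continuous_transfer _ _ _ P q r v U V q_gt2 q_le3 q_le V_ge0 Phi_var clt
  mU U_integrable B HB c dl v' k c_gt0 c_le dl_small v'_close g K s cg s0 sr gK.
have XE' l : (forall w, X l w = c l * (U l w / Num.sqrt l) + dl l) ->
    g \o X l = (fun w => g (c l * (U l w / Num.sqrt l) + dl l)).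
  by move=> e; apply/funext => w; rewrite /= e.
split; first apply: filterS2 h1 XE => l [i1 i2] e.
  have [j1 _] := Rintegral_centered_normal mg' i2.
  by split; [rewrite /has_mean XE'|exact: j1].
move=> e e0; apply: filterS3 h1 XE (h2 e e0) => l [i1 i2] XEl hl.
have [_ j2] := Rintegral_centered_normal mg' i2.
rewrite normr1 mulr1; apply: le_trans hl; rewrite XE'// mean_Rintegral.
by rewrite le_eqVlt; apply/orP; left; apply/eqP; congr (`| _ - _ |).
Qed.

(** Bounded functions have growth exponent 0 and the moments of order [s] have exponent [s < r], so
    all of these test functions fall under one transfer statement. *)
Lemma scaled_functional_approx :
  approx_in_distribution (fun=> P) X (fun l => centered_normal (v' l)) (fun=> id) /\
  approx_moments_below (fun=> P) X (fun l => centered_normal (v' l)) (fun=> id) r.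
Proof.
split.
  move=> f [cf [M fM]].
  have h x : `|f x| <= M * (1 + `|x| `^ 0).
    have M0 : 0 <= M by exact: le_trans (normr_ge0 _) (fM 0).
    by rewrite powRr0; have := fM x; lra.
  by have [] := transfer cf (lexx 0) r_gt0 h.
split=> [s /andP[s0 sr]|n n0 nr].
  apply: (transfer (continuous_abs_powR s0) (ltW s0) sr (K := 1)) => x.
  by rewrite ger0_norm ?powR_ge0// mul1r lerDr.
apply: (transfer (@exprn_continuous R n) (ler0n _ _) nr (K := 1)) => x.
by rewrite mul1r normrX powR_mulrn// lerDr.
Qed.

End scaled.

End trie_clt.

Section constant_limit.
Context {d : measure_display} {T : measurableType d} {R : realType}.
Context {d' : measure_display} {T' : measurableType d'}.
Variables (P : R -> probability T R) (X : R -> T -> R) (Q : probability T' R) (Y : T' -> R).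

Lemma approx_cvg_mean g : approx_mean P X (fun=> Q) (fun=> Y) g -> cvg_mean P X Q Y g.
Proof.
move=> h; apply/cvgrPdist_le => e e0; apply: filterS (h e e0) => l.
by rewrite normr1 mulr1 distrC.
Qed.

Lemma approx_cvg_in_distribution : approx_in_distribution P X (fun=> Q) (fun=> Y) ->
  cvg_in_distribution P X Q Y.
Proof. by move=> h f bf; apply: approx_cvg_mean; exact: h. Qed.

Lemma approx_cvg_moment g : approx_moment P X (fun=> Q) (fun=> Y) g -> cvg_moment P X Q Y g.
Proof.
move=> [h1 h2]; split.
- by apply: filterS h1 => l [].
- by have [L _ HL] := (near_pinftyP _).1 h1; have [] := HL L (lexx _).
- exact: approx_cvg_mean.
Qed.

Lemma approx_cvg_moments_below r : approx_moments_below P X (fun=> Q) (fun=> Y) r ->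
  cvg_moments_below P X Q Y r.
Proof.
by move=> [h1 h2]; split=> [s sr|k k0 kr]; apply: approx_cvg_moment; [exact: h1|exact: h2].
Qed.

End constant_limit.

Lemma sqrt_ratio_bounds (R : realType) (kap l b : R) : 0 < kap -> 0 < l -> kap * l <= b ->
  [/\ 0 < b, 0 < Num.sqrt l / Num.sqrt b, Num.sqrt l / Num.sqrt b <= (Num.sqrt kap)^-1
    & (Num.sqrt l / Num.sqrt b) ^+ 2 = l / b].
Proof.
move=> k0 l0 klb; have b0 : 0 < b by apply: lt_le_trans klb; rewrite mulr_gt0.
have sk : 0 < Num.sqrt kap by rewrite sqrtr_gt0.
have sl : 0 < Num.sqrt l by rewrite sqrtr_gt0.
have sb : 0 < Num.sqrt b by rewrite sqrtr_gt0.
split=> //; first by rewrite divr_gt0.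
  rewrite ler_pdivrMr// ler_pdivlMl// -sqrtrM ?(ltW k0)//; exact: ler_wsqrtr.
by rewrite expr_div_n !sqr_sqrtr// ltW.
Qed.

Theorem theorem5p3 (R : realType) (A : finType) (p : A -> R)
    (d : measure_display) (Omega : measurableType d) (P : probability Omega R)
    (Xi : nat -> Omega -> nat -> A) (N : R -> Omega -> nat)
    (phi : {fset (seq A)} -> R) (a b : R -> R) (r : R) :
  let T := fun l => random_trie Xi (N l) in
  let phiT := fun l w => phi (T l w) in
  let PhiT := fun l w => additive_functional phi (T l w) in
  (1 < #|A|)%N ->
  (forall x, 0 < p x) -> \sum_x p x = 1 ->
  iid_strings P p Xi ->
  (forall l, 0 < l -> poisson_distributed P l (N l)) ->
  (forall l, 0 < l -> independent_of_strings P Xi (N l)) ->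
  toll_function phi ->
  2 < r ->
  (* the moments in the asymptotic hypotheses are finite for large l *)
  (\forall l \near +oo_R, PhiT l \in Lfun P 2%:E) ->
  (\forall l \near +oo_R, phiT l \in Lfun P 2%:E) ->
  (\forall l \near +oo_R,
     has_mean P (fun w => `|phiT l w - mean P (phiT l)| `^ r)) ->
  little_o (fun l => mean P (PhiT l) - a l) (fun l => Num.sqrt l) ->
  little_o (fun l => var P (PhiT l) - b l) (fun l => l) ->
  big_O (fun l => var P (PhiT l)) (fun l => l) ->
  little_o (fun l => var P (phiT l)) (fun l => l) ->
  big_O (fun l => mean P (fun w => `|phiT l w - mean P (phiT l)| `^ r))
    (fun l => l `^ (r / 2)) ->
  let X := fun l w => (PhiT l w - a l) / Num.sqrt l in
  let X' := fun l w => (PhiT l w - mean P (PhiT l)) / Num.sqrt l in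
  let N_b := fun l => centered_normal (b l / l) in
  let N_Var := fun l => centered_normal (var P (PhiT l) / l) in
  [/\ approx_in_distribution (fun=> P) X N_b (fun=> id),
      approx_moments_below (fun=> P) X N_b (fun=> id) r,
      approx_in_distribution (fun=> P) X' N_Var (fun=> id)
    & approx_moments_below (fun=> P) X' N_Var (fun=> id) r]
  /\
  (big_Omega b (fun l => l) ->
   let Y := fun l w => (PhiT l w - a l) / Num.sqrt (b l) in
   let Y' := fun l w =>
     (PhiT l w - mean P (PhiT l)) / Num.sqrt (var P (PhiT l)) in
   [/\ cvg_in_distribution (fun=> P) Y (centered_normal 1) id,
       cvg_moments_below (fun=> P) Y (centered_normal 1) id r,
       cvg_in_distribution (fun=> P) Y' (centered_normal 1) id
     & cvg_moments_below (fun=> P) Y' (centered_normal 1) id r]).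

Proof.
move=> T phiT PhiT A1 p0 p1 iid Npois Nind toll r2 _ _ phi_dev ha hb hV hphi hmom X X' N_b N_Var.
pose U := centered_functional P Xi N phi; pose V := functional_variance P Xi N phi.
pose m l := mean P (PhiT l).
have UE l w : U l w = PhiT l w - m l by rewrite /m mean_Rintegral.
have VE l : var P (PhiT l) = V l by rewrite var_Rintegral.
have near0 := nbhs_pinfty_gt (num_real (0 : R)).
have phi_int : \forall l \near +oo_R, P.-integrable setT (EFin \o
    (fun w => `|phi (random_sized_trie Xi N l w).2 - \int[P]_w phi (random_sized_trie Xi N l w).2| `^ r)).
  by apply: filterS phi_dev => l; rewrite /has_mean mean_Rintegral.
have [y phi_mom] : exists y, \forall l \near +oo_R, \int[P]_w
    (`|phi (random_sized_trie Xi N l w).2 - \int[P]_w phi (random_sized_trie Xi N l w).2| `^ r) <= y * l `^ (r / 2).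
  have [y hy] := hmom; exists y; apply: filterS hy => l; rewrite !mean_Rintegral => h.
  by apply: le_trans (ler_norm _) _; apply: le_trans h _; rewrite ger0_norm ?powR_ge0.
have phi_var e : 0 < e -> \forall l \near +oo_R, \int[P]_w
    ((phi (random_sized_trie Xi N l w).2 - \int[P]_w phi (random_sized_trie Xi N l w).2) ^+ 2) <= e * l.
  move=> e0; apply: filterS2 (hphi e e0) near0 => l; rewrite var_Rintegral => h l0.
  by apply: le_trans (ler_norm _) _; apply: le_trans h _; rewrite gtr0_norm.
have [v Phi_var] : exists v, \forall l \near +oo_R, \int[P]_w
    ((additive_functional phi (random_sized_trie Xi N l w).2 -
      \int[P]_w additive_functional phi (random_sized_trie Xi N l w).2) ^+ 2) <= v * l.
  have [v hv] := hV; exists v; apply: filterS2 hv near0 => l; rewrite var_Rintegral => h l0.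
  by apply: le_trans (ler_norm _) _; apply: le_trans h _; rewrite gtr0_norm.
have main := scaled_functional_approx A1 p0 p1 iid Npois Nind toll r2 phi_int phi_mom phi_var Phi_var.
have zero_small e : 0 < e -> \forall l \near +oo_R, `|(fun=> 0 : R) l| <= e.
  by move=> e0; apply: nearW => l; rewrite normr0 ltW.
have one_gt0 : \forall l \near +oo_R, 0 < (fun=> 1 : R) l by exact: nearW.
have one_le1 : \forall l \near +oo_R, (fun=> 1 : R) l <= 1 by exact: nearW.
have hm e : 0 < e -> \forall l \near +oo_R, `|m l - a l| <= e * Num.sqrt l.
  by move=> e0; apply: filterS (ha e e0) => l; rewrite [X in _ * X]ger0_norm ?sqrtr_ge0.
have hVb e : 0 < e -> \forall l \near +oo_R, `|V l - b l| <= e * l.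
  by move=> e0; apply: filterS2 (hb e e0) near0 => l + l0; rewrite VE (gtr0_norm l0).
have [X1 X2] : approx_in_distribution (fun=> P) X N_b (fun=> id) /\
    approx_moments_below (fun=> P) X N_b (fun=> id) r.
  (* The scale is unchanged; replacing the mean by [a l] is a vanishing shift, and replacing the
     variance by [b l] a vanishing error after division by [l]. *)
  apply: (main (fun=> 1) (fun l => (m l - a l) / Num.sqrt l) (fun l => b l / l) 1 X) => //.
  - move=> e e0; apply: filterS2 (hm e e0) near0 => l h l0.
    have sl : 0 < Num.sqrt l by rewrite sqrtr_gt0.
    by rewrite normrM normfV (gtr0_norm sl) ler_pdivrMr.
  - move=> e e0; apply: filterS2 (hVb e e0) near0 => l h l0.
    by rewrite expr1n mul1r -mulrBl normrM normfV (gtr0_norm l0) ler_pdivrMr.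
  - by apply: nearW => l w; rewrite mul1r -/(U l w) UE -mulrDl addrA subrK.
have [X'1 X'2] : approx_in_distribution (fun=> P) X' N_Var (fun=> id) /\
    approx_moments_below (fun=> P) X' N_Var (fun=> id) r.
  apply: (main (fun=> 1) (fun=> 0) (fun l => var P (PhiT l) / l) 1 X') => //.
  - by move=> e e0; apply: nearW => l; rewrite VE expr1n mul1r subrr normr0 ltW.
  - by apply: nearW => l w; rewrite mul1r addr0 -/(U l w) UE.
split=> // -[k k0 hk] Y Y'.
have bk : \forall l \near +oo_R, [/\ 0 < l, 0 < b l, 0 < Num.sqrt l / Num.sqrt (b l),
    Num.sqrt l / Num.sqrt (b l) <= (Num.sqrt k)^-1 & (Num.sqrt l / Num.sqrt (b l)) ^+ 2 = l / b l].
  by apply: filterS2 hk near0 => l kb l0; have [? ? ? ?] := sqrt_ratio_bounds k0 l0 kb; split.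
(* Eventually the variance is within [k / 2 * l] of [b l], so half of the lower bound on [b] passes
   to the variance. *)
have k20 : 0 < k / 2 by rewrite divr_gt0.
have Vk : \forall l \near +oo_R, [/\ 0 < l, 0 < V l, 0 < Num.sqrt l / Num.sqrt (V l),
    Num.sqrt l / Num.sqrt (V l) <= (Num.sqrt (k / 2))^-1 & (Num.sqrt l / Num.sqrt (V l)) ^+ 2 = l / V l].
  apply: filterS3 hk (hVb _ k20) near0 => l kb Vb l0.
  have kV : k / 2 * l <= V l by move: Vb; rewrite ler_norml => /andP[h _]; lra.
  by have [? ? ? ?] := sqrt_ratio_bounds k20 l0 kV; split.
have [Y1 Y2] : approx_in_distribution (fun=> P) Y (fun=> centered_normal 1) (fun=> id) /\
    approx_moments_below (fun=> P) Y (fun=> centered_normal 1) (fun=> id) r.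
  (* Division by [sqrt (b l)] is the scale [c l = sqrt l / sqrt (b l)], bounded because
     [b l >= k * l]; the approximating variance is then the constant 1. *)
  apply: (main (fun l => Num.sqrt l / Num.sqrt (b l)) (fun l => (m l - a l) / Num.sqrt (b l)) (fun=> 1)
    (Num.sqrt k)^-1 Y).
  - by apply: filterS bk => l [].
  - by apply: filterS bk => l [].
  - have sk : 0 < Num.sqrt k by rewrite sqrtr_gt0.
    move=> e e0; have ek : 0 < e * Num.sqrt k by rewrite mulr_gt0.
    apply: filterS2 (hm _ ek) bk => l h [l0 b0 _ ck _].
    have sb : 0 < Num.sqrt (b l) by rewrite sqrtr_gt0.
    rewrite normrM normfV (gtr0_norm sb) ler_pdivrMr//; apply: le_trans h _.
    by rewrite -mulrA ler_wpM2l ?(ltW e0)// -ler_pdivlMl// -ler_pdivrMr.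
  - move=> e e0; have ek : 0 < e * k by rewrite mulr_gt0.
    apply: filterS3 (hVb _ ek) bk hk => l h [l0 b0 _ _ ->] kb.
    have -> : l / b l * (V l / l) - 1 = (V l - b l) / b l by field; rewrite !gt_eqF.
    rewrite normrM normfV (gtr0_norm b0) ler_pdivrMr//; apply: le_trans h _.
    by rewrite -mulrA ler_wpM2l// ltW.
  - apply: filterS bk => l [l0 b0 _ _ _] w; rewrite -/(U l w) UE.
    have sl : Num.sqrt l != 0 by rewrite gt_eqF// sqrtr_gt0.
    by rewrite [Num.sqrt l / _ * _]mulrC mulrA divfK// -mulrDl addrA subrK.
have [Y'1 Y'2] : approx_in_distribution (fun=> P) Y' (fun=> centered_normal 1) (fun=> id) /\
    approx_moments_below (fun=> P) Y' (fun=> centered_normal 1) (fun=> id) r.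
  apply: (main (fun l => Num.sqrt l / Num.sqrt (V l)) (fun=> 0) (fun=> 1) (Num.sqrt (k / 2))^-1 Y') => //.
  - by apply: filterS Vk => l [].
  - by apply: filterS Vk => l [].
  - move=> e e0; apply: filterS Vk => l [l0 V0 _ _ VE2].
    have -> : (Num.sqrt l / Num.sqrt (V l)) ^+ 2 * (V l / l) - 1 = 0.
      by rewrite VE2; field; rewrite !gt_eqF.
    by rewrite normr0 ltW.
  - apply: filterS Vk => l [l0 V0 _ _ _] w; rewrite addr0 -/(U l w) UE /Y' VE.
    have sl : Num.sqrt l != 0 by rewrite gt_eqF// sqrtr_gt0.
    by rewrite [Num.sqrt l / _ * _]mulrC mulrA divfK.
by split; [exact: approx_cvg_in_distribution|exact: approx_cvg_moments_below
  |exact: approx_cvg_in_distribution|exact: approx_cvg_moments_below].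
Qed.
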